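(* Let $n\geq1$, and let $0<\sigma<1/2$ if $n=1$ and $\sigma\in(0,1/2)\cup(1/2,1)$ if $n\geq 2$. Assume $S_{n,\sigma}(\mathbb{R}^n_+)<S_{n,\sigma}(\mathbb{R}^n)$. Let $(u_k)\subset\mathring H^\sigma(\mathbb{R}^n_+)$ be a minimizing sequence for $S_{n,\sigma}(\mathbb{R}^n_+)$ with $I_{n,\sigma,\mathbb{R}^n_+}[u_k]=1$ for all $k$. Then $(u_k)$ is relatively compact in $\mathring H^\sigma(\mathbb{R}^n_+)$ up to translations parallel to the boundary and dilations, i.e. after passing to a subsequence there are $\lambda_k>0$ and $a_k\in\mathbb{R}^{n-1}$ such that $\lambda_k^{\frac{n-2\sigma}{2}}u_k(\lambda_k(x'-a_k),\lambda_k x_n)$ converges strongly in $\mathring H^\sigma(\mathbb{R}^n_+)$. In particular, the infimum $S_{n,\sigma}(\mathbb{R}^n_+)$ is attained.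
   Context: For an open set $\Omega\subset\mathbb{R}^n$ and a function $u$ on $\Omega$ let $I_{n,\sigma,\Omega}[u]=\iint_{\Omega\times\Omega}\frac{(u(x)-u(y))^2}{|x-y|^{n+2\sigma}}\,dx\,dy$. $\mathring H^\sigma(\mathbb{R}^n)$ denotes the space of real functions $u$ on $\mathbb{R}^n$ with $I_{n,\sigma,\mathbb{R}^n}[u]<\infty$ and $|\{|u|>\tau\}|<\infty$ for all $\tau>0$, and $S_{n,\sigma}(\mathbb{R}^n)=\inf_{0\not\equiv u\in\mathring H^\sigma(\mathbb{R}^n)} I_{n,\sigma,\mathbb{R}^n}[u]\big/\big(\int_{\mathbb{R}^n}|u|^{\frac{2n}{n-2\sigma}}dx\big)^{\frac{n-2\sigma}{n}}$. $\mathbb{R}^n_+=\{(x',x_n)\in\mathbb{R}^{n-1}\times\mathbb{R}: x_n>0\}$; $\mathring H^\sigma(\mathbb{R}^n_+)$ is the completion of $C^1_c(\mathbb{R}^n_+)$ with respect to the quadratic form $I_{n,\sigma,\mathbb{R}^n_+}$ (it embeds into $L^{\frac{2n}{n-2\sigma}}(\mathbb{R}^n_+)$), and $S_{n,\sigma}(\mathbb{R}^n_+)=\inf_{0\not\equiv u\in\mathring H^\sigma(\mathbb{R}^n_+)} I_{n,\sigma,\mathbb{R}^n_+}[u]\big/\big(\int_{\mathbb{R}^n_+}|u|^{\frac{2n}{n-2\sigma}}dx\big)^{\frac{n-2\sigma}{n}}$. A minimizing sequence is a sequence of nonzero elements along which this quotient tends to $S_{n,\sigma}(\mathbb{R}^n_+)$.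 *)

(* Defs.v *)
From HB Require Import structures.
From mathcomp Require Import all_boot all_order all_algebra.
From mathcomp Require Import all_classical all_reals all_analysis.
Set Implicit Arguments. Unset Strict Implicit. Unset Printing Implicit Defensive.
Import Order.TTheory GRing.Theory Num.Theory.
Import numFieldNormedType.Exports.
Local Open Scope classical_set_scope.
Local Open Scope ring_scope.

Section FracSobolev.
Variable R : realType.

Definition enorm (n : nat) (x : 'rV[R]_n) : R := Num.sqrt (\sum_(i < n) x 0 i ^+ 2).

Definition xlast (n : nat) (x : 'rV[R]_n) : R := \sum_(i < n | i.+1 == n) x 0 i.

Definition halfspace (n : nat) : set 'rV[R]_n := [set x | 0 < xlast x].

(* n-dimensional Lebesgue integral of a nonnegative function, as the iterated
   one-dimensional Lebesgue integral (equal to the integral against the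
   n-dimensional Lebesgue measure for measurable nonnegative functions, by
   Tonelli). *)
Fixpoint iint (n : nat) : ('rV[R]_n -> \bar R) -> \bar R :=
  match n return ('rV[R]_n -> \bar R) -> \bar R with
  | 0 => fun f => f 0
  | m.+1 => fun f =>
      (\int[@lebesgue_measure R]_(t in [set: R])
         iint (fun y : 'rV[R]_m => f (row_mx (const_mx t : 'rV[R]_1) y)))%E
  end.

Definition lebn (n : nat) (A : set 'rV[R]_n) : \bar R := iint (fun x => (\1_A x)%:E).

(* Borel measurability of u : R^n -> R (w.r.t. the product Borel sigma-algebra
   on n.-tuple R, which is the Borel sigma-algebra of R^n). *)
Definition Bmeas (n : nat) (u : 'rV[R]_n -> R) : Prop :=
  measurable_fun [set: n.-tuple R] (fun t : n.-tuple R => u (\row_i tnth t i)).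

Definition Igag (n : nat) (sigma : R) (Om : set 'rV[R]_n) (u : 'rV[R]_n -> R)
  : \bar R :=
  iint (fun x => iint (fun y =>
    (\1_Om x * \1_Om y * ((u x - u y) ^+ 2 / (enorm (x - y)) `^ (n%:R + 2 * sigma)))%:E)).

Definition crit (n : nat) (sigma : R) : R := 2 * n%:R / (n%:R - 2 * sigma).

Definition Lpint (n : nat) (Om : set 'rV[R]_n) (u : 'rV[R]_n -> R) (p : R) : \bar R :=
  iint (fun x => (\1_Om x * `|u x| `^ p)%:E).

Definition nonzero_on (n : nat) (Om : set 'rV[R]_n) (u : 'rV[R]_n -> R) : Prop :=
  lebn [set x | Om x /\ u x != 0] != 0%E.

Definition quot (n : nat) (sigma : R) (Om : set 'rV[R]_n) (u : 'rV[R]_n -> R) : R :=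
  fine (Igag sigma Om u) /
    (fine (Lpint Om u (crit n sigma))) `^ ((n%:R - 2 * sigma) / n%:R).

Definition Hfull (n : nat) (sigma : R) (u : 'rV[R]_n -> R) : Prop :=
  [/\ Bmeas u, (Igag sigma [set: 'rV[R]_n] u < +oo)%E &
      forall tau : R, 0 < tau -> (lebn [set x | (tau < `|u x|)%R] < +oo)%E].

Definition C1c_half (n : nat) (f : 'rV[R]_n -> R) : Prop :=
  [/\ continuous f,
      forall (i : 'I_n) (x : 'rV[R]_n), derivable f x (delta_mx 0 i),
      forall i : 'I_n, continuous (fun x => 'D_(delta_mx 0 i) f x),
      compact (closure [set x | f x != 0]) &
      closure [set x | f x != 0] `<=` @halfspace n].

(* The space \mathring H^sigma(R^n_+): completion of C^1_c(R^n_+) w.r.t. the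
   quadratic form I_{n,sigma,R^n_+}, realized inside L^{2n/(n-2sigma)}(R^n_+):
   u is a (Borel representative of a) limit of C^1_c(R^n_+) functions both in
   the form I and in L^{2n/(n-2sigma)}(R^n_+).  Values of u outside R^n_+
   are irrelevant. *)
Definition Hhalf (n : nat) (sigma : R) (u : 'rV[R]_n -> R) : Prop :=
  Bmeas u /\
  exists phi : nat -> 'rV[R]_n -> R,
    [/\ forall j, C1c_half (phi j),
        (fun j => Igag sigma (@halfspace n) (u \- phi j)) @ \oo --> 0%E &
        (fun j => Lpint (@halfspace n) (u \- phi j) (crit n sigma)) @ \oo --> 0%E].

Definition S_full (n : nat) (sigma : R) : R :=
  inf [set quot sigma [set: 'rV[R]_n] u |
        u in [set u | Hfull sigma u /\ nonzero_on [set: 'rV[R]_n] u]].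

Definition S_half (n : nat) (sigma : R) : R :=
  inf [set quot sigma (@halfspace n) u |
        u in [set u | Hhalf sigma u /\ nonzero_on (@halfspace n) u]].

(* Rescaled/translated function
   x |-> lam^{(n-2sigma)/2} u(lam (x' - a'), lam x_n), where a has x_n-coordinate 0. *)
Definition rescale (n : nat) (sigma lam : R) (a : 'rV[R]_n) (u : 'rV[R]_n -> R)
  : 'rV[R]_n -> R :=
  fun x => lam `^ ((n%:R - 2 * sigma) / 2) * u (lam *: (x - a)).

End FracSobolev.
Arguments halfspace {R} n.

(* Main.v *)
Require Import Defs.
From HB Require Import structures.
From mathcomp Require Import all_boot all_order all_algebra.
From mathcomp Require Import all_classical all_reals all_analysis.
From mathcomp Require Import measurable_realfun ring lra.
Set Implicit Arguments. Unset Strict Implicit. Unset Printing Implicit Defensive.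
Import Order.TTheory GRing.Theory Num.Theory.
Import numFieldNormedType.Exports.
Local Open Scope classical_set_scope.
Local Open Scope ring_scope.

(* Averaging over cubes gives a Morrey-type Sobolev inequality which also shows that
   a bounded sequence with non-vanishing L^p norm, p = 2n/(n-2sigma), carries a fixed
   amount of its L^2 mass in some cube; a dilation and a translation parallel to the
   boundary make this a unit cube at height s_k above the boundary.  If (s_k) stays
   bounded, a subsequence converges almost everywhere on the half-space to some v <> 0,
   and the Brezis-Lieb lemma, applied both to the L^p norm and to the quadratic form,
   splits w_k into v and w_k - v; strict subadditivity of t |-> t^(2/p) leaves no mass
   for w_k - v.  If s_k -> oo, the functions |w_k(. + s_k e_n)| converge to a function f
   on the whole space.  Their remainders (|w_k(. + s_k e_n)| - f)^+, shifted back, are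
   admissible on the half-space, and subadditivity forces S(R^n) <= S(R^n_+). *)

(** * Borel structure and Lebesgue measure on row vectors *)

(** The space on the half-space is a closure of compactly supported functions, so membership of
    limits and truncations is the recurrent obstacle. A bounded sequence of the space that converges
    almost everywhere keeps its limit in it: Brezis-Lieb makes the errors nearly orthogonal, so that
    suitable convex combinations approach the limit in energy, and the Sobolev inequality makes them
    converge in L^p too. When the mass escapes, the profile translated back need not vanish at the
    boundary and cannot be subtracted inside the space. The positive part of |w_k| minus this
    profile vanishes wherever w_k does, and stays admissible; the discarded negative part is
    dominated by the profile and tends to 0 in L^p. This is why moduli appear there. Cubes are based
    at their lower corner: those based in the half-space stay inside it, so the Sobolev inequality
    holds there without extension or reflection. *)

Definition rV_display : measure_display. Proof. exact: default_measure_display. Qed.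

Section row_measurable.
Variables (R : realType) (n : nat).

Definition tuple_row (t : n.-tuple R) : 'rV[R]_n := \row_i tnth t i.

(** The Borel sets are pulled back from tuples, so that [Bmeas u] becomes plain measurability of [u]
    on row vectors ([BmeasP]). *)
Definition row_measurable (A : set 'rV[R]_n) : Prop := measurable (tuple_row @^-1` A).

Let row_measurable0 : row_measurable set0.
Proof. by rewrite /row_measurable preimage_set0. Qed.

Let row_measurableC A : row_measurable A -> row_measurable (~` A).
Proof. by rewrite /row_measurable preimage_setC; exact: measurableC. Qed.

Let row_measurable_bigcup (F : (set 'rV[R]_n)^nat) :
  (forall i, row_measurable (F i)) -> row_measurable (\bigcup_i F i).
Proof. by move=> mF; rewrite /row_measurable preimage_bigcup; apply: bigcupT_measurable. Qed.

HB.instance Definition _ := @isMeasurable.Build rV_display 'rV[R]_n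
  row_measurable row_measurable0 row_measurableC row_measurable_bigcup.

Lemma BmeasP (u : 'rV[R]_n -> R) : Bmeas u <-> measurable_fun setT u.
Proof.
split=> mu _ Y mY; rewrite setTI.
- by have := mu measurableT Y mY; rewrite setTI.
- have := mu measurableT Y mY; rewrite setTI; exact.
Qed.

Lemma measurable_coord (i : 'I_n) : measurable_fun setT (fun x : 'rV[R]_n => x 0 i).
Proof.
move=> _ Y mY; rewrite setTI /measurable/= /row_measurable.
rewrite [X in measurable X](_ : _ = (@tnth _ R ^~ i) @^-1` Y); last first.
  by apply/funext => t /=; rewrite /tuple_row mxE.
by rewrite -[X in measurable X]setTI; exact: measurable_tnth.
Qed.

Lemma measurable_rowP d (T : measurableType d) (f : T -> 'rV[R]_n) :
  (forall i, measurable_fun setT (fun x => f x 0 i)) -> measurable_fun setT f.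
Proof.
move=> mf _ Y mY; rewrite setTI.
pose g x : n.-tuple R := [tuple f x 0 i | i < n].
have mg : measurable_fun setT g.
  apply/measurable_fun_tnthP => i; apply: eq_measurable_fun (mf i) => x _ /=.
  by rewrite tnth_mktuple.
rewrite [X in measurable X](_ : _ = g @^-1` (tuple_row @^-1` Y)); last first.
  apply/funext => x /=; congr (Y _); apply/rowP => i.
  by rewrite /tuple_row mxE tnth_mktuple.
by rewrite -[X in measurable X]setTI; exact: mg.
Qed.

End row_measurable.

(** * Lebesgue measure in dimension n+1 from dimension n *)

Section row_cons.
Variables (R : realType) (n : nat).

Definition rcons_mx (p : measurableTypeR R * 'rV[R]_n) : 'rV[R]_n.+1 :=
  row_mx (const_mx p.1 : 'rV[R]_1) p.2.

Definition runcons (x : 'rV[R]_n.+1) : measurableTypeR R * 'rV[R]_n :=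
  (x 0 ord0, \row_i x 0 (lift ord0 i)).

Lemma rcons_mx0 p : rcons_mx p 0 ord0 = p.1.
Proof.
have -> : ord0 = lshift n (ord0 : 'I_1) :> 'I_(1 + n) by apply: ord_inj.
by apply: (etrans (row_mxEl _ p.2 0 ord0)); rewrite mxE.
Qed.

Lemma rcons_mxS p i : rcons_mx p 0 (lift ord0 i) = p.2 0 i.
Proof.
have -> : lift ord0 i = rshift 1 i :> 'I_(1 + n) by apply: ord_inj.
exact: row_mxEr.
Qed.

Lemma rcons_mxK : cancel rcons_mx runcons.
Proof.
move=> [t y]; rewrite /runcons rcons_mx0/=; congr pair.
by apply/rowP => i; rewrite mxE rcons_mxS.
Qed.

Lemma runconsK : cancel runcons rcons_mx.
Proof.
move=> x; apply/rowP => i; case: (unliftP ord0 i) => [j ->|->].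
  by rewrite rcons_mxS mxE.
by rewrite rcons_mx0.
Qed.

Lemma measurable_rcons_mx : measurable_fun setT rcons_mx.
Proof.
apply: measurable_rowP => i; case: (unliftP ord0 i) => [j ->|->].
  under eq_fun do rewrite rcons_mxS.
  exact: (measurableT_comp (measurable_coord j) measurable_snd).
by under eq_fun do rewrite rcons_mx0; exact: measurable_fst.
Qed.

Lemma measurable_runcons : measurable_fun setT runcons.
Proof.
apply: measurable_fun_pair; first exact: measurable_coord.
apply: measurable_rowP => i; under eq_fun do rewrite mxE.
exact: measurable_coord.
Qed.

Section push.
Variable m : {sigma_finite_measure set 'rV[R]_n -> \bar R}.

Definition lamS : set 'rV[R]_n.+1 -> \bar R :=
  pushforward (@lebesgue_measure R \x m)%E rcons_mx.

HB.instance Definition _ := Measure.copy lamS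
  (measure_function_pushforward__canonical__measure_function_Measure
    (@lebesgue_measure R \x m)%E measurable_rcons_mx).

(** The next product with [lebesgue_measure] needs sigma-finiteness, so it is carried through the
    recursion. The exhausting sequences are taken increasing, so that both coordinates of a point
    are reached at a common index. *)
Lemma lamS_sigma_finite : sigma_finite setT lamS.
Proof.
have /sigma_finiteP[F [TF ndF Foo]] := sigma_finiteT (@lebesgue_measure R).
have /sigma_finiteP[G [TG ndG Goo]] := sigma_finiteT m.
have mFG k : measurable (F k `*` G k) by apply: measurableX; [case: (Foo k)|case: (Goo k)].
exists (fun k => runcons @^-1` (F k `*` G k)).
  rewrite -preimage_bigcup; apply/seteqP; split => // x _ /=.
  have [k _ Fk] : (\bigcup_i F i) (runcons x).1 by rewrite -TF.
  have [l _ Gl] : (\bigcup_i G i) (runcons x).2 by rewrite -TG.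
  exists (maxn k l) => //; split.
  - by move: Fk; exact/subsetPset/ndF/leq_maxl.
  - by move: Gl; exact/subsetPset/ndG/leq_maxr.
move=> k; split.
  by rewrite -[X in measurable X]setTI; apply: (measurable_runcons measurableT (mFG k)).
rewrite /lamS /pushforward -comp_preimage.
rewrite (_ : runcons \o rcons_mx = id); last by apply/funext => x; exact: rcons_mxK.
have [? ?] := Foo k; have [? ?] := Goo k.
by rewrite preimage_id product_measure1E// lte_mul_pinfty// ge0_fin_numE.
Qed.

HB.instance Definition _ := @Measure_isSigmaFinite.Build _ _ _ lamS lamS_sigma_finite.

Lemma integral_lamS (f : 'rV[R]_n.+1 -> \bar R) :
  measurable_fun setT f -> (forall x, 0 <= f x)%E ->
  (\int[lamS]_x f x = \int[@lebesgue_measure R]_t \int[m]_y f (rcons_mx (t, y)))%E.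
Proof.
move=> mf f0; rewrite /lamS ge0_integral_pushforward//; last exact: measurable_rcons_mx.
rewrite preimage_setT fubini_tonelli1//=.
by apply: measurableT_comp => //; exact: measurable_rcons_mx.
Qed.

End push.
End row_cons.

(** Follows the recursion of [iint], one coordinate at a time, so that [iintE] needs Tonelli only
    once per dimension. *)
Fixpoint lam (R : realType) (n : nat) : {sigma_finite_measure set 'rV[R]_n -> \bar R} :=
  match n with
  | 0 => [the {sigma_finite_measure set 'rV[R]_0 -> \bar R} of dirac (0 : 'rV[R]_0)]
  | m.+1 => [the {sigma_finite_measure set 'rV[R]_m.+1 -> \bar R} of lamS (lam R m)]
  end.

Lemma iintE (R : realType) (n : nat) (f : 'rV[R]_n -> \bar R) :
  measurable_fun setT f -> (forall x, 0 <= f x)%E ->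
  iint f = (\int[lam R n]_x f x)%E.
Proof.
elim: n f => [|n IH] f mf f0 /=.
  by rewrite integral_dirac// diracT mul1e.
rewrite integral_lamS//; apply: eq_integral => t _.
rewrite IH//; apply: measurableT_comp => //.
exact: (measurableT_comp (@measurable_rcons_mx _ _) (@pair1_measurable _ _ (measurableTypeR R) _ t)).
Qed.

Lemma lebnE (R : realType) (n : nat) (A : set 'rV[R]_n) : measurable A ->
  lebn A = lam R n A.
Proof.
move=> mA; rewrite /lebn iintE ?integral_indic ?setIT//.
exact/measurable_EFinP.
Qed.

(** * Integrals under dilations and translations *)

Section affine1.
Variable R : realType.
Local Notation mu := (@lebesgue_measure R).

Definition aff1 (c a : R) (t : measurableTypeR R) : measurableTypeR R := c * (t - a).

Lemma measurable_aff1 c a : measurable_fun setT (aff1 c a).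
Proof. by apply: measurable_funM => //; exact: measurable_funB. Qed.

Let nu (c : R) (c0 : 0 < c) (a : R) : {measure set (measurableTypeR R) -> \bar R} :=
  mscale (NngNum (ltW c0))
    (measure_function_pushforward__canonical__measure_function_Measure mu (measurable_aff1 c a)).

(** Lebesgue measure is determined by its values on half-open intervals, and the preimage of such an
    interval has its length divided by c. *)
Lemma lebesgue_aff1 (c a : R) (c0 : 0 < c) (A : set (measurableTypeR R)) : measurable A ->
  (nu c0 a A = mu A)%E.
Proof.
move=> mA; apply/esym/lebesgue_measure_unique => // _ [[x y] _ <-].
rewrite -[RHS]/(c%:E * mu (aff1 c a @^-1` `]x, y]%classic))%E.
rewrite (_ : _ @^-1` _ = `]x / c + a, y / c + a]%classic); last first.
  apply/seteqP; split => t /=; rewrite !in_itv/= /aff1.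
    by rewrite -ltrBrDr ltr_pdivrMr// [_ * c]mulrC -lerBlDr ler_pdivlMr// [_ * c]mulrC.
  by rewrite -ltrBrDr ltr_pdivrMr// [_ * c]mulrC -lerBlDr ler_pdivlMr// [_ * c]mulrC.
rewrite !lebesgue_measure_itv/= !lte_fin ltrD2r ltr_pM2r ?invr_gt0//.
case: ifPn => // _; last by rewrite mule0.
by rewrite -!EFinB -EFinM; congr EFin; field; rewrite gt_eqF.
Qed.

Lemma integral_aff1 (c a : R) (f : measurableTypeR R -> \bar R) : 0 < c ->
  measurable_fun setT f -> (forall x, 0 <= f x)%E ->
  (c%:E * \int[mu]_t f (c * (t - a))%R = \int[mu]_t f t)%E.
Proof.
move=> c0 mf f0.
have -> : (\int[mu]_t f t = \int[nu c0 a]_t f t)%E.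
  by apply: eq_measure_integral => A mA _; rewrite lebesgue_aff1.
rewrite ge0_integral_mscale// (ge0_integral_pushforward (measurable_aff1 c a))//.
Qed.

End affine1.

Section affine.
Variable R : realType.

Lemma measurable_affine (n : nat) (c : R) (a : 'rV[R]_n) :
  measurable_fun setT (fun x : 'rV[R]_n => c *: (x - a)).
Proof.
apply: measurable_rowP => i; under eq_fun do rewrite !mxE.
by apply: measurable_funM => //; apply: measurable_funB => //; exact: measurable_coord.
Qed.

Lemma integral_affine (n : nat) (c : R) (a : 'rV[R]_n) (f : 'rV[R]_n -> \bar R) :
  0 < c -> measurable_fun setT f -> (forall x, 0 <= f x)%E ->
  ((c ^+ n)%:E * \int[lam R n]_x f (c *: (x - a)) = \int[lam R n]_x f x)%E.
Proof.
move=> c0; elim: n a f => [|n IH] a f mf f0 /=.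
  rewrite !integral_dirac//; last exact: (measurableT_comp mf (@measurable_affine 0 c a)).
  rewrite expr0 mul1e.
  by rewrite diracT !mul1e; congr f; apply/rowP => -[].
rewrite !integral_lamS//; last first.
  exact: (measurableT_comp mf (@measurable_affine n.+1 c a)).
rewrite exprSr EFinM -muleA.
pose G (t : measurableTypeR R) := (\int[lam R n]_y f (rcons_mx (t, y)))%E.
have mG : measurable_fun setT G.
  apply: (@measurable_fun_fubini_tonelli_F _ _ (measurableTypeR R) _ _ (lam R n)
    (fun p => f (rcons_mx p))) => //.
  exact: (measurableT_comp mf (@measurable_rcons_mx R n)).
rewrite -(@integral_aff1 R c (a 0 ord0) G)//; last first.
  by move=> t; apply: integral_ge0.
rewrite muleCA; congr (_ * _)%E.
rewrite -ge0_integralZl ?lee_fin ?exprn_ge0 ?ltW//; last 2 first.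
- apply: (@measurable_fun_fubini_tonelli_F _ _ (measurableTypeR R) _ _ (lam R n)
    (fun p => f (c *: (rcons_mx p - a)))) => //.
  exact: (measurableT_comp mf (measurableT_comp (@measurable_affine n.+1 c a) (@measurable_rcons_mx _ _))).
- by move=> t _; apply: integral_ge0.
apply: eq_integral => t _; rewrite /G -(IH (\row_i a 0 (lift ord0 i)) (fun y => f (rcons_mx (c * (t - a 0 ord0), y))))//; last first.
  exact: (measurableT_comp mf (measurableT_comp (@measurable_rcons_mx R n) (@pair1_measurable _ _ (measurableTypeR R) _ _))).
congr (_ * _)%E; apply: eq_integral => y _; congr f.
apply/rowP => i; case: (unliftP ord0 i) => [j ->|->].
  by rewrite [LHS]mxE [X in _ * X]mxE [X in _ + X]mxE !rcons_mxS !mxE.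
by rewrite [LHS]mxE [X in _ * X]mxE [X in _ + X]mxE !rcons_mx0.
Qed.

End affine.

(** * Cubes and measurability of continuous functions *)

Section cube.
Variable R : realType.

(** The base point is the lower corner, not the centre, so a cube based in the half-space lies in
    it; half-open sides make the cells of a grid disjoint. *)
Definition cube (n : nat) (a : 'rV[R]_n) (l : R) : set 'rV[R]_n :=
  [set x | forall i, a 0 i <= x 0 i < a 0 i + l].

Lemma measurable_cube n (a : 'rV[R]_n) l : measurable (cube a l).
Proof.
rewrite (_ : cube a l = \bigcap_(i in [set: 'I_n])
    ((fun x : 'rV[R]_n => x 0 i) @^-1` `[a 0 i, a 0 i + l[%classic)); last first.
  apply/seteqP; split => x /=.
    by move=> h i _ /=; rewrite in_itv/=.
  by move=> h i; have := h i I; rewrite /= in_itv.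
apply: fin_bigcap_measurable => // i _.
by rewrite -[X in measurable X]setTI; exact: measurable_coord.
Qed.

Lemma lam_cube n (a : 'rV[R]_n) l : 0 <= l -> lam R n (cube a l) = (l ^+ n)%:E.
Proof.
move=> l0; elim: n a => [|n IH] a.
  by rewrite /= diracE mem_set// => -[].
rewrite /= /lamS /pushforward.
rewrite (_ : _ @^-1` _ = `[a 0 ord0, a 0 ord0 + l[%classic `*`
    cube (\row_i a 0 (lift ord0 i)) l); last first.
  apply/seteqP; split => [[t y]|[t y] [/= + h]] /=.
    move=> h; split => [|i]/=; first by have := h ord0; rewrite rcons_mx0 in_itv.
    by have := h (lift ord0 i); rewrite rcons_mxS mxE.
  rewrite in_itv/= => h0 i; case: (unliftP ord0 i) => [j ->|->].
    by have := h j; rewrite rcons_mxS mxE.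
  by rewrite rcons_mx0.
rewrite product_measure1E//; last exact: measurable_cube.
rewrite IH exprS EFinM; congr (_ * _)%E.
have := @lebesgue_measure_itv R `[a 0 ord0, a 0 ord0 + l[.
rewrite /= lte_fin ltrDl -EFinB (_ : _ + l - _ = l); last by ring.
move=> ->; case: ifPn => //; rewrite -leNgt => l0'.
by congr EFin; apply/eqP; rewrite eq_le l0.
Qed.

End cube.

Section continuous_measurable.
Variables (R : realType) (n : nat).

Let step (k : nat) (x : 'rV[R]_n) : 'rV[R]_n :=
  \row_i ((Num.floor (k.+1%:R * x 0 i))%:~R / k.+1%:R).

Let step_cvg x : step ^~ x @ \oo --> x.
Proof.
apply/cvgrPdist_lt => e e0; near=> k.
rewrite [`|_|]/Num.norm/= mx_normrE; apply/bigmax_ltP; split => // -[i j] _ /=.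
rewrite !mxE ord1.
have k0 : (0 : R) < k.+1%:R by [].
have ke : k.+1%:R^-1 < e by near: k; exact: near_infty_natSinv_lt (PosNum e0).
set t := k.+1%:R * x 0 j.
have /andP[h1 h2] : (Num.floor t)%:~R <= t < (Num.floor t)%:~R + 1.
  by rewrite floor_le/= -(intrD _ _ 1) floorD1_gt.
have -> : x 0 j - (Num.floor t)%:~R / k.+1%:R = (t - (Num.floor t)%:~R) * k.+1%:R^-1.
  by rewrite /t mulrBl mulrAC mulfV ?mul1r// gt_eqF.
rewrite ger0_norm; last by rewrite mulr_ge0// subr_ge0.
apply: le_lt_trans ke; rewrite ler_piMl ?invr_ge0// lerBlDl; exact: ltW.
Unshelve. all: end_near. Qed.

(** The sigma-algebra comes from coordinates, not from open sets. Rounding the coordinates down to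
    multiples of 1/(k+1) exhibits [f] as a pointwise limit of functions that are constant on
    countably many boxes. *)
Lemma continuous_measurable (f : 'rV[R]_n -> R) : continuous f -> measurable_fun setT f.
Proof.
move=> cf.
apply: (@measurable_fun_cvg _ _ _ _ (fun k x => f (step k x))); last first.
  by move=> x _; apply: (cvg_comp (step ^~ x) f); [exact: step_cvg|exact: cf].
move=> k _ Y mY; rewrite setTI.
pose pt (z : {ffun 'I_n -> int}) : 'rV[R]_n := \row_i ((z i)%:~R / k.+1%:R).
pose B (z : {ffun 'I_n -> int}) : set 'rV[R]_n :=
  [set x | forall i, Num.floor (k.+1%:R * x 0 i) = z i].
rewrite [X in measurable X](_ : _ = \bigcup_(z in [set z | Y (f (pt z))])
    B z); last first.
  apply/seteqP; split => [x Yx|x [z Yz xz]] /=.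
    exists [ffun i => Num.floor (k.+1%:R * x 0 i)]; last by move=> i; rewrite ffunE.
    rewrite /= (_ : pt _ = step k x)//.
    by apply/rowP => i; rewrite !mxE ffunE.
  rewrite (_ : step k x = pt z)//.
  by apply/rowP => i; rewrite !mxE xz.
rewrite bigcup_mkcond; apply: countable_bigcupT_measurable => [|z]; first exact: countableP.
case: ifPn => // _.
rewrite (_ : B z = \bigcap_(i in [set: 'I_n])
    ((fun x : 'rV[R]_n => k.+1%:R * x 0 i) @^-1` `[(z i)%:~R, (z i)%:~R + 1[%classic)); last first.
  apply/seteqP; split => x /=.
    by move=> h i _ /=; rewrite in_itv/= -h floor_le -(intrD _ _ 1) floorD1_gt.
  move=> h i; have := h i I; rewrite /= in_itv/= => /andP[h1 h2].
  by apply: floor_def; rewrite h1 intrD.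
apply: fin_bigcap_measurable => // i _.
rewrite -[X in measurable X]setTI; apply: measurable_funM => //.
exact: measurable_coord.
Qed.

End continuous_measurable.

Section enorm.
Variables (R : realType) (n : nat).

Lemma enorm_ge0 (x : 'rV[R]_n) : 0 <= enorm x.
Proof. exact: sqrtr_ge0. Qed.

Lemma enormZ (c : R) (x : 'rV[R]_n) : 0 <= c -> enorm (c *: x) = c * enorm x.
Proof.
move=> c0; rewrite /enorm -[in RHS](ger0_norm c0) -sqrtr_sqr -sqrtrM ?sqr_ge0//.
congr Num.sqrt; rewrite mulr_sumr; apply: eq_bigr => i _.
by rewrite mxE exprMn.
Qed.

Lemma enormN (x : 'rV[R]_n) : enorm (- x) = enorm x.
Proof.
by rewrite /enorm; congr Num.sqrt; apply: eq_bigr => i _; rewrite mxE sqrrN.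
Qed.

Lemma enorm_le (x : 'rV[R]_n) (d : R) : 0 <= d -> (forall i, `|x 0 i| <= d) ->
  enorm x <= Num.sqrt n%:R * d.
Proof.
move=> d0 xd; rewrite /enorm -[X in _ * X](ger0_norm d0) -sqrtr_sqr -sqrtrM//.
apply: ler_wsqrtr; rewrite -[n in n%:R]card_ord -sumr_const mulr_suml.
apply: ler_sum => i _; rewrite mul1r -[x 0 i ^+ 2]real_normK ?num_real//.
by rewrite ler_sqr ?nnegrE.
Qed.

Lemma enorm_gt0 (x : 'rV[R]_n) : x != 0 -> 0 < enorm x.
Proof.
move=> x0; rewrite /enorm sqrtr_gt0 lt_neqAle sumr_ge0 ?andbT; last first.
  by move=> i _; rewrite sqr_ge0.
apply: contra_neqT x0; rewrite negbK eq_sym psumr_eq0; last by move=> i _; rewrite sqr_ge0.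
move=> /allP h; apply/rowP => i; rewrite mxE.
by have := h i (mem_index_enum _); rewrite /= sqrf_eq0 => /eqP.
Qed.

Lemma measurable_enorm : measurable_fun setT (@enorm R n).
Proof.
rewrite /enorm; apply: measurableT_comp.
  apply: continuous_measurable_fun; exact: sqrt_continuous.
apply: measurable_sum => i; apply: measurable_funX; exact: measurable_coord.
Qed.

Lemma measurable_sub_row : measurable_fun setT (fun z : 'rV[R]_n * 'rV[R]_n => z.1 - z.2).
Proof.
apply: measurable_rowP => i; under eq_fun do rewrite !mxE.
apply: measurable_funB; apply: (measurableT_comp (@measurable_coord _ _ i)).
  exact: measurable_fst.
exact: measurable_snd.
Qed.

End enorm.

(** * Integrals of nonnegative real functions *)

Lemma measurable_powR_comp d (T : measurableType d) (R : realType) (f : T -> R) (p : R) :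
  measurable_fun setT f -> measurable_fun setT (fun x => f x `^ p).
Proof. by move=> mf; exact: (measurableT_comp (measurable_powR p) mf). Qed.

Lemma measurable_norm_comp d (T : measurableType d) (R : realType) (f : T -> R) :
  measurable_fun setT f -> measurable_fun setT (fun x => `|f x|).
Proof. by move=> mf; exact: (measurableT_comp (@normr_measurable R setT) mf). Qed.

Ltac meas := repeat match goal with
  | |- measurable_fun _ (fun x => (_)%:E) => apply/measurable_EFinP
  | |- measurable_fun _ (fun x => (_ + - _)%R) => apply: measurable_funB
  | |- measurable_fun _ (fun x => (_ + _)%R) => apply: measurable_funD
  | |- measurable_fun _ (fun x => (_ * _)%R) => apply: measurable_funM
  | |- measurable_fun _ (fun x => (_ ^+ _)%R) => apply: measurable_funX
  | |- measurable_fun _ (fun x => (`|_|)%R) => apply: measurable_norm_comp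
  | |- measurable_fun _ (fun x => (_ `^ _)%R) => apply: measurable_powR_comp
  | |- measurable_fun _ (fun x => Num.max _ _) => apply: measurable_maxr
  | |- measurable_fun _ (fun x => Num.min _ _) => apply: measurable_minr
  | H : measurable_fun _ ?f |- measurable_fun _ ?f => exact: H
  | H : forall k, measurable_fun _ (?f k) |- measurable_fun _ (?f ?k) => exact: (H k)
  | H : measurable_fun _ ?f |- measurable_fun _ (fun x => ?f x) => exact: H
  | H : forall k, measurable_fun _ (?f k) |- measurable_fun _ (fun x => ?f ?k x) => exact: (H k)
  | H : measurable_fun _ ?f |- measurable_fun _ (fun x => ?f _) => apply: (measurableT_comp H)
  | H : forall k, measurable_fun _ (?f k) |- measurable_fun _ (fun x => ?f ?k _) =>
      apply: (measurableT_comp (H k))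
  | |- measurable_fun _ fst => exact: measurable_fst
  | |- measurable_fun _ snd => exact: measurable_snd
  | |- measurable_fun _ (fun x => fst x) => exact: measurable_fst
  | |- measurable_fun _ (fun x => snd x) => exact: measurable_snd
  | |- measurable_fun _ (fun x => ?c) => exact: (@measurable_cst _ _ _ _ _ c)
  end.

Lemma indic_nneg (R : numDomainType) (T : Type) (A : set T) (x : T) : 0 <= \1_A x :> R.
Proof. by rewrite indicE ler0n. Qed.

Ltac nng := intros; repeat first
  [ done | exact: powR_ge0 | exact: sqr_ge0 | exact: normr_ge0 | exact: indic_nneg | exact: ltW
  | apply: addr_ge0 | apply: mulr_ge0 ].

Ltac side := try solve [ meas | nng ].

Section Int.
Local Open Scope ereal_scope.
Context d (T : measurableType d) (R : realType) (mu : {measure set T -> \bar R}).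
Implicit Types f g : T -> R.

Definition Int (f : T -> R) : \bar R := \int[mu]_x (f x)%:E.

Lemma Int_ge0 f : (forall x, 0 <= f x)%R -> 0 <= Int f.
Proof. by move=> f0; apply: integral_ge0 => x _; rewrite lee_fin. Qed.

Lemma le_Int f g : measurable_fun setT f -> measurable_fun setT g ->
  (forall x, 0 <= f x)%R -> (forall x, f x <= g x)%R -> Int f <= Int g.
Proof.
move=> mf mg f0 fg; apply: ge0_le_integral => //.
- by move=> x _; rewrite lee_fin.
- exact/measurable_EFinP.
- exact/measurable_EFinP.
- by move=> x _; rewrite lee_fin.
Qed.

Lemma IntD f g : measurable_fun setT f -> measurable_fun setT g ->
  (forall x, 0 <= f x)%R -> (forall x, 0 <= g x)%R ->
  Int (fun x => f x + g x)%R = Int f + Int g.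
Proof.
move=> mf mg f0 g0; rewrite /Int; under eq_integral do rewrite EFinD.
by rewrite ge0_integralD//; do ?[exact/measurable_EFinP | by move=> x _; rewrite lee_fin].
Qed.

Lemma IntZ (c : R) f : (0 <= c)%R -> measurable_fun setT f -> (forall x, 0 <= f x)%R ->
  Int (fun x => c * f x)%R = c%:E * Int f.
Proof.
move=> c0 mf f0; rewrite /Int; under eq_integral do rewrite EFinM.
by rewrite ge0_integralZl//; do ?[exact/measurable_EFinP | by move=> x _; rewrite lee_fin].
Qed.

Lemma ae_le_Int f g : measurable_fun setT f -> measurable_fun setT g ->
  (forall x, 0 <= f x)%R -> (forall x, 0 <= g x)%R ->
  {ae mu, forall x, (f x <= g x)%R} -> Int f <= Int g.
Proof.
move=> mf mg f0 g0 fg; apply: ae_ge0_le_integral => //.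
- by move=> x _; rewrite lee_fin.
- exact/measurable_EFinP.
- by move=> x _; rewrite lee_fin.
- exact/measurable_EFinP.
- by apply: filterS fg => x fgx _; rewrite lee_fin.
Qed.

(** The exceptional set is cut out before Fatou is applied, since the lower limit is known to equal
    [g] only off it. *)
Lemma fatou_le (f : nat -> T -> R) g (M : \bar R) :
  (forall k, measurable_fun setT (f k)) -> measurable_fun setT g ->
  (forall k x, 0 <= f k x)%R -> (forall x, 0 <= g x)%R ->
  {ae mu, forall x, f ^~ x @ \oo --> g x} ->
  (\forall k \near \oo, Int (f k) <= M) -> Int g <= M.
Proof.
move=> mf mg f0 g0 [N [mN N0 fgN]] fM.
have mfE k : measurable_fun setT (EFin \o f k) by exact/measurable_EFinP.
have mgE : measurable_fun setT (EFin \o g) by exact/measurable_EFinP.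
rewrite /Int (ge0_negligible_integral mN measurableT mgE)//; last first.
  by move=> x _; rewrite lee_fin.
apply: (@le_trans _ _ (\int[mu]_(x in setT `\` N) limn_einf (fun k => (f k x)%:E))).
  rewrite le_eqVlt; apply/orP; left; apply/eqP; apply: eq_integral => x.
  rewrite inE => -[_ Nx].
  have fgx : (fun k => (f k x)%:E) @ \oo --> (g x)%:E.
    apply/fine_cvgP; split; first exact: nearW.
    by apply: contrapT => nfg; apply: Nx; exact: fgN.
  by rewrite (cvg_limn_einf_sup fgx).
apply: (@le_trans _ _ _ _ _ (fatou mu (measurableD measurableT mN) _ _)) => //.
- by move=> k; apply: measurable_funTS; exact: mfE.
- by move=> k x _; rewrite lee_fin.
rewrite limn_einf_lim; apply: lime_le; first exact: is_cvg_einfs.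
near=> k; apply: (@le_trans _ _ (Int (f k))); last by near: k.
apply: (@le_trans _ _ (\int[mu]_(x in setT `\` N) (f k x)%:E)).
  by apply: ereal_inf_lbound; exists k => /=.
apply: ge0_subset_integral => //; first exact: measurableD.
exact: mfE.
by move=> x _; rewrite lee_fin.
Unshelve. all: end_near. Qed.

Lemma dct0 (h : nat -> T -> R) (G : T -> R) :
  (forall k, measurable_fun setT (h k)) -> measurable_fun setT G ->
  (forall k x, 0 <= h k x)%R -> (forall k x, h k x <= G x)%R ->
  {ae mu, forall x, h ^~ x @ \oo --> 0%R} -> Int G < +oo ->
  (fun k => Int (h k)) @ \oo --> 0.
Proof.
move=> mh mG h0 hG hcvg IG.
have := @dominated_convergence _ _ _ mu setT measurableT
  (fun k x => (h k x)%:E) (cst 0) (EFin \o G).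
case => //.
- by move=> k; exact/measurable_EFinP.
- by apply: filterS hcvg => x hx _ /=; apply/fine_cvgP; split => //; exact: nearW.
- apply/integrableP; split; first exact/measurable_EFinP.
  under eq_integral do rewrite /= ger0_norm ?(le_trans (h0 0%N _) (hG 0%N _))//.
  by [].
- by apply: aeW => x k _ /=; rewrite lee_fin ger0_norm.
by move=> _ _; rewrite integral0.
Qed.

End Int.

Lemma cvge0P (R : realType) (X : nat -> \bar R) : (forall k, 0 <= X k)%E ->
  (X @ \oo --> 0%E <-> forall e : R, 0 < e -> \forall k \near \oo, (X k <= e%:E)%E).
Proof.
move=> X0; split => [X00 e e0|h].
  have [fX fX0] := (fine_cvgP _ _).1 X00.
  move/cvgrPdist_le : fX0 => /(_ _ e0) fX0.
  near=> k; rewrite -(@fineK _ (X k)) ?lee_fin; last by near: k.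
  by have : `|0 - (fine \o X) k| <= e; [near: k|rewrite sub0r normrN; apply: le_trans; exact: ler_norm].
apply/fine_cvgP; split.
  have [N _ hN] := h 1 ltr01; exists N => // k Nk.
  by rewrite ge0_fin_numE//; apply: le_lt_trans (hN _ Nk) _; rewrite ltry.
apply/cvgrPdist_le => e e0; have [N _ hN] := h e e0; exists N => // k Nk /=.
rewrite sub0r normrN ger0_norm ?fine_ge0// -lee_fin fineK ?hN//.
by rewrite ge0_fin_numE//; apply: le_lt_trans (hN _ Nk) _; rewrite ltry.
Unshelve. all: end_near. Qed.

Lemma squeeze_norm0 (R : realType) (u v : nat -> R) :
  (forall k, 0 <= u k <= `|v k|) -> v @ \oo --> 0 -> u @ \oo --> 0.
Proof.
move=> uv /cvgrPdist_le v0; apply/cvgrPdist_le => e /v0; apply: filterS => k.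
rewrite !sub0r !normrN; apply: le_trans; have /andP[u0 ?] := uv k.
by rewrite ger0_norm.
Qed.

(** * The Brezis-Lieb lemma *)

Section powR_ineq.
Variables (R : realType) (p : R).
Hypothesis p0 : 0 < p.

Lemma powR_le_mono (a b : R) : 0 <= a -> a <= b -> a `^ p <= b `^ p.
Proof. by move=> a0 ab; apply: ge0_ler_powR; rewrite ?nnegrE ?(le_trans a0 ab)// ltW. Qed.

Lemma powRVK (a : R) : 0 <= a -> (a `^ p^-1) `^ p = a.
Proof. by move=> a0; rewrite -powRrM mulVf ?gt_eqF// powRr1. Qed.

Lemma powR_normD_le (a b : R) : `|a + b| `^ p <= 2 `^ p * (`|a| `^ p + `|b| `^ p).
Proof.
wlog ba : a b / `|b| <= `|a|.
  move=> h; have [/h//|/ltW ab] := leP `|b| `|a|.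
  by rewrite addrC (addrC (_ `^ p)); exact: h.
apply: (@le_trans _ _ ((2 * `|a|) `^ p)).
  apply: powR_le_mono => //; rewrite (le_trans (ler_normD _ _))//; lra.
by rewrite powRM// ler_wpM2l ?powR_ge0// lerDl powR_ge0.
Qed.

Lemma powR_near1 (e : R) : 0 < e -> exists2 t, 0 < t < 1 &
  [/\ (1 + t) `^ p <= 1 + e, 1 - e <= (1 - t) `^ p & t `^ p <= e].
Proof.
move=> e0.
have h1 : (1 : R) `^ p^-1 = 1 by rewrite powR1.
have pw1 : (1 : R) < (1 + e) `^ p^-1.
  rewrite -[ltLHS]h1.
  by apply: gt0_ltr_powR; rewrite ?nnegrE ?invr_gt0//; lra.
pose e' := Num.min e (1/2).
have e'0 : 0 < e' by rewrite lt_min e0; lra.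
have e'e : e' <= e by rewrite ge_min lexx.
have e'2 : e' <= 1/2 by rewrite ge_min lexx orbT.
have pw2 : (1 - e') `^ p^-1 < 1.
  rewrite -[ltRHS]h1.
  by apply: gt0_ltr_powR; rewrite ?nnegrE ?invr_gt0//; lra.
pose t := Num.min (Num.min ((1 + e) `^ p^-1 - 1) (1 - (1 - e') `^ p^-1)) (Num.min (e `^ p^-1) (1/2)).
have t1 : t <= (1 + e) `^ p^-1 - 1 by rewrite !ge_min lexx.
have t2 : t <= 1 - (1 - e') `^ p^-1 by rewrite !ge_min lexx !orbT.
have t3 : t <= e `^ p^-1 by rewrite !ge_min lexx !orbT.
have t4 : t <= 1/2 by rewrite !ge_min lexx !orbT.
have t0 : 0 < t by rewrite !lt_min !subr_gt0 pw1 pw2 powR_gt0//=; lra.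
exists t; first by rewrite t0; lra.
split.
- rewrite -[leRHS]powRVK; last by lra.
  by apply: powR_le_mono; lra.
- apply: (@le_trans _ _ (1 - e')); first by lra.
  rewrite -[leLHS]powRVK; last by lra.
  by apply: powR_le_mono; [exact: powR_ge0|lra].
- by rewrite -[leRHS](powRVK (ltW e0)); apply: powR_le_mono => //; exact: ltW.
Qed.

(** Two regimes. If |b| <= t |a| with t small, |a + b|^p differs from |a|^p by a small multiple of
    |a|^p, and |b|^p is itself below such a multiple. Otherwise |a| <= |b| / t, and all three powers
    are at most multiples of |b|^p. No convexity enters, so every p > 0 is allowed. *)
Lemma powR_brezis_lieb (e : R) : 0 < e -> exists2 C, 0 <= C &
  forall a b : R, `| `|a + b| `^ p - `|a| `^ p - `|b| `^ p| <= e * `|a| `^ p + C * `|b| `^ p.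
Proof.
move=> e0; have [t /andP[t0 t1] [h1 h2 h3]] : exists2 t, 0 < t < 1 &
  [/\ (1 + t) `^ p <= 1 + e/2, 1 - e/2 <= (1 - t) `^ p & t `^ p <= e/2].
  by apply: powR_near1; lra.
exists ((1 + t^-1) `^ p + t^-1 `^ p + 1).
  by rewrite !addr_ge0 ?powR_ge0.
move=> a b.
have [bta|abt] := leP `|b| (t * `|a|).
- have hb : `|b| `^ p <= e/2 * `|a| `^ p.
    apply: (@le_trans _ _ ((t * `|a|) `^ p)); first exact: powR_le_mono.
    rewrite powRM//; last exact: ltW.
    by apply: ler_wpM2r => //; exact: powR_ge0.
  have hu : `|a + b| `^ p <= (1 + e/2) * `|a| `^ p.
    apply: (@le_trans _ _ (((1 + t) * `|a|) `^ p)).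
      apply: powR_le_mono => //; rewrite (le_trans (ler_normD _ _))//; lra.
    by rewrite powRM; [apply: ler_wpM2r => //; exact: powR_ge0|lra|exact: normr_ge0].
  have hl : (1 - e/2) * `|a| `^ p <= `|a + b| `^ p.
    apply: (@le_trans _ _ (((1 - t) * `|a|) `^ p)).
      by rewrite powRM; [apply: ler_wpM2r => //; exact: powR_ge0|lra|exact: normr_ge0].
    apply: powR_le_mono; first by rewrite mulr_ge0//; lra.
    have := ler_normB (a + b) b; rewrite addrK; lra.
  have C0 : 0 <= ((1 + t^-1) `^ p + t^-1 `^ p) * `|b| `^ p.
    by rewrite mulr_ge0 ?addr_ge0 ?powR_ge0.
  have := powR_ge0 `|b| p.
  rewrite ler_norml; move: C0 hb hu hl; rewrite !mulrDl mul1r; lra.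
- have ha : `|a| <= t^-1 * `|b| by rewrite mulrC ler_pdivlMr// mulrC ltW.
  have ha' : `|a| `^ p <= t^-1 `^ p * `|b| `^ p.
    by rewrite -powRM ?invr_ge0//; [apply: powR_le_mono|exact: ltW].
  have hu : `|a + b| `^ p <= (1 + t^-1) `^ p * `|b| `^ p.
    rewrite -powRM//; last by rewrite addr_ge0 ?invr_ge0//; exact: ltW.
    by apply: powR_le_mono => //; rewrite (le_trans (ler_normD _ _))//; lra.
  have := powR_ge0 `|b| p; have := powR_ge0 `|a| p; have := powR_ge0 `|a + b| p.
  have : 0 <= e * `|a| `^ p by rewrite mulr_ge0 ?powR_ge0//; exact: ltW.
  rewrite ler_norml; move: ha' hu; rewrite !mulrDl mul1r; lra.
Qed.

(** The preceding inequality with a = l and b = u k - l bounds the difference by a small multiple of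
    |l|^p plus a multiple of |u k - l|^p. *)
Lemma powR_norm_cvg (u : nat -> R) (l : R) : u @ \oo --> l ->
  (fun k => `|u k| `^ p) @ \oo --> `|l| `^ p.
Proof.
move=> ul; apply/cvgrPdist_le => e e0.
have lp1 : 0 < `|l| `^ p + 1 by rewrite ltr_wpDl ?powR_ge0.
have [|C C0 hC] := @powR_brezis_lieb (e / 2 / (`|l| `^ p + 1)).
  by rewrite !divr_gt0.
pose t := (e / 2 / (C + 1)) `^ p^-1.
have t0 : 0 < t by rewrite powR_gt0// !divr_gt0//; lra.
move/cvgrPdist_le : ul => /(_ t t0); apply: filterS => k hk.
have := hC l (u k - l); rewrite subrKC distrC -/t => h.
have hb : `|u k - l| `^ p <= e / 2 / (C + 1).
  rewrite distrC -[leRHS]powRVK; last by rewrite !divr_ge0// ltW//; lra.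
  exact: powR_le_mono.
have hl : e / 2 / (`|l| `^ p + 1) * `|l| `^ p <= e/2.
  rewrite mulrAC ler_pdivrMr//; apply: ler_wpM2l; last by rewrite lerDl.
  by rewrite divr_ge0// ltW.
have hb2 : (C + 1) * `|u k - l| `^ p <= e / 2.
  by rewrite mulrC -ler_pdivlMr//; lra.
move: h; rewrite distrC; have := powR_ge0 `|u k - l| p.
move: hb2 hl; set A := `|u k| `^ p; set B := `|l| `^ p; set D := `|u k - l| `^ p.
set E := e / 2 / _ * B; rewrite mulrDl mul1r !ler_norml => ? ? ? /andP[? ?].
by apply/andP; split; lra.
Qed.

End powR_ineq.

Section brezis_lieb.
Local Open Scope ereal_scope.
Context d (T : measurableType d) (R : realType) (mu : {measure set T -> \bar R}).
Variables (p : R) (p0 : (0 < p)%R) (f : nat -> T -> R) (g : T -> R) (M : R).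
Hypothesis mf : forall k, measurable_fun setT (f k).
Hypothesis mg : measurable_fun setT g.
Hypothesis fg : {ae mu, forall x, f ^~ x @ \oo --> g x}.
Hypothesis fM : forall k, Int mu (fun x => `|f k x| `^ p)%R <= M%:E.

Lemma Int_powR_lim_le : Int mu (fun x => `|g x| `^ p)%R <= M%:E.
Proof.
apply: (@fatou_le _ _ _ mu (fun k x => `|f k x| `^ p)%R).
- by move=> k; meas.
- by meas.
- by move=> k x; exact: powR_ge0.
- by move=> x; exact: powR_ge0.
- by apply: filterS fg => x; exact: powR_norm_cvg.
- exact: nearW.
Qed.

(** The defect [D] is not dominated, but its excess [W] over a small multiple of |f_k - g|^p is, by
    C |g|^p, so the integral of [W] tends to 0. The subtracted part is small because the integrals
    of |f_k - g|^p stay below [M']. *)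
Lemma brezis_lieb :
  (fun k => Int mu (fun x => `| `|f k x| `^ p - `|f k x - g x| `^ p - `|g x| `^ p |)%R)
  @ \oo --> 0.
Proof.
pose D k x : R := (`| `|f k x| `^ p - `|f k x - g x| `^ p - `|g x| `^ p |)%R.
have mD k : measurable_fun setT (D k) by rewrite /D; meas.
pose M' := (2 `^ p * (M + M))%R.
have fgM k : Int mu (fun x => `|f k x - g x| `^ p)%R <= M'%:E.
  apply: (@le_trans _ _ (Int mu (fun x => 2 `^ p * (`|f k x| `^ p + `|g x| `^ p))%R)).
    apply: le_Int; [by meas|by meas|by move=> x; exact: powR_ge0|move=> x].
    by have := powR_normD_le p0 (f k x) (- g x)%R; rewrite normrN.
  rewrite IntZ; side.
  rewrite IntD; side.
  rewrite /M' EFinM lee_wpmul2l ?lee_fin ?powR_ge0// EFinD leeD//.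
  exact: Int_powR_lim_le.
have DgI k : Int mu (D k) >= 0 by apply: Int_ge0 => x; exact: normr_ge0.
have M0 : (0 <= M)%R by rewrite -lee_fin; apply: le_trans (fM 0%N); apply: Int_ge0 => x; exact: powR_ge0.
have M'0 : (0 <= M')%R by rewrite mulr_ge0 ?powR_ge0// addr_ge0.
apply/(cvge0P DgI) => e e0.
have [|C C0 hC] := @powR_brezis_lieb _ p p0 (e / 2 / (M' + 1)).
  by rewrite !divr_gt0//; lra.
set e' := (e / 2 / (M' + 1))%R in hC.
have e'0 : (0 <= e')%R by rewrite !divr_ge0// ?ltW//; lra.
pose W k x : R := Num.max 0%R (D k x - e' * `|f k x - g x| `^ p)%R.
have mW k : measurable_fun setT (W k) by rewrite /W; meas; exact: mD.
have W0 k x : (0 <= W k x)%R by rewrite le_max lexx.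
have D_le k x : (D k x <= W k x + e' * `|f k x - g x| `^ p)%R.
  by rewrite -lerBlDr le_max lexx orbT.
have W_le k x : (W k x <= C * `|g x| `^ p)%R.
  rewrite ge_max mulr_ge0 ?powR_ge0//= lerBlDl.
  by have := hC (f k x - g x)%R (g x); rewrite subrK.
have Wcvg : (fun k => Int mu (W k)) @ \oo --> 0.
  apply: (@dct0 _ _ _ mu W (fun x => C * `|g x| `^ p)%R) => //; first by meas.
  - apply: filterS fg => x fgx.
    have fg0 : (fun k => f k x - g x)%R @ \oo --> (0%R:R).
      by rewrite -[0%R](subrr (g x)); apply: cvgB fgx _; exact: cvg_cst.
    have h1 := powR_norm_cvg p0 fgx.
    have := powR_norm_cvg p0 fg0; rewrite normr0 powR0 ?gt_eqF// => h2.
    have h3 : (fun k => D k x) @ \oo --> (`| (`|g x| `^ p) - 0 - (`|g x| `^ p) |)%R.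
      by apply: cvg_norm; apply: cvgB; [apply: cvgB|exact: cvg_cst].
    rewrite subr0 subrr normr0 in h3.
    have h4 : (fun k => D k x - e' * `|f k x - g x| `^ p)%R @ \oo --> (0 - e' * 0)%R.
      by apply: cvgB => //; apply: cvgMr.
    move: h4; rewrite mulr0 subr0 => h4; apply: squeeze_norm0 h4 => k.
    by rewrite W0/= ge_max normr_ge0 ler_norm.
  - rewrite IntZ; side.
    apply: (@le_lt_trans _ _ (C%:E * M%:E)); last by rewrite -EFinM ltry.
    by rewrite lee_wpmul2l ?lee_fin//; exact: Int_powR_lim_le.
have W0' k : 0 <= Int mu (W k) by exact: Int_ge0.
have e2 : (0 < e / 2)%R by lra.
have := (cvge0P W0').1 Wcvg _ e2; apply: filterS => k hk.
apply: (@le_trans _ _ (Int mu (fun x => W k x + e' * `|f k x - g x| `^ p)%R)).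
  by apply: le_Int; side.
rewrite IntD; side.
rewrite IntZ; side.
rewrite [e in leRHS](_ : e = (e/2 + e/2)%R); last by lra.
rewrite EFinD leeD//; apply: (@le_trans _ _ (e'%:E * M'%:E)).
  by rewrite lee_wpmul2l ?lee_fin.
rewrite -EFinM lee_fin /e' mulrAC ler_pdivrMr//; last by lra.
apply: ler_wpM2l; last by rewrite lerDl.
by rewrite divr_ge0// ltW.
Qed.

(** Both bounds are stated with sums, so that no difference of extended reals has to be formed. *)
Lemma brezis_lieb_near (e : R) : (0 < e)%R -> \forall k \near \oo,
  Int mu (fun x => `|f k x| `^ p)%R <=
    Int mu (fun x => `|f k x - g x| `^ p)%R + Int mu (fun x => `|g x| `^ p)%R + e%:E /\
  Int mu (fun x => `|f k x - g x| `^ p)%R + Int mu (fun x => `|g x| `^ p)%R <=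
    Int mu (fun x => `|f k x| `^ p)%R + e%:E.
Proof.
move=> e0.
have D0 k : 0 <= Int mu (fun x => `| `|f k x| `^ p - `|f k x - g x| `^ p - `|g x| `^ p |)%R.
  by apply: Int_ge0 => x; exact: normr_ge0.
have := (cvge0P D0).1 brezis_lieb e e0; apply: filterS => k hk.
have pw (h : T -> R) (x : T) : (0 <= `|h x| `^ p)%R by exact: powR_ge0.
split.
- rewrite -IntD; side.
  apply: le_trans (leeD2l _ hk); rewrite -IntD; side.
  apply: le_Int; side; move=> x.
  set a := (_ `^ p)%R; set b := (_ `^ p)%R; set c := (_ `^ p)%R.
  have := ler_norm (a - b - c)%R; lra.
- rewrite -IntD; side.
  apply: le_trans (leeD2l _ hk); rewrite -IntD; side.
  apply: le_Int; side; move=> x.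
  set b := (`|_ - _| `^ p)%R; set c := (`|g x| `^ p)%R; set a := (_ `^ p)%R.
  have := ler_norm (- (a - b - c))%R; rewrite normrN; lra.
Qed.

End brezis_lieb.

(** * Weighted Gagliardo energies *)

Section ae_product.
Local Open Scope ereal_scope.
Context d (T : measurableType d) (R : realType)
  (mu : {sigma_finite_measure set T -> \bar R}).

Lemma ae_prod (P : T -> Prop) : {ae mu, forall x, P x} ->
  {ae (mu \x mu), forall z, P z.1 /\ P z.2}.
Proof.
move=> [N [mN N0 PN]]; exists (N `*` setT `|` setT `*` N); split.
- by apply: measurableU; exact: measurableX.
- apply/null_set_setU; try exact: measurableX.
  + exact: (etrans (product_measure1E mu mu mN measurableT)
      (etrans (congr1 (fun t => t * _) N0) (mul0e _))).
  + exact: (etrans (product_measure1E mu mu measurableT mN)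
      (etrans (congr1 (fun t => _ * t) N0) (mule0 _))).
- move=> [x y] /= /not_andP[nP|nP]; [left|right]; split => //; exact: PN.
Qed.

End ae_product.

Section J.
Local Open Scope ereal_scope.
Context d (T : measurableType d) (R : realType)
  (mu : {sigma_finite_measure set T -> \bar R}) (w : T * T -> R).
Hypothesis mw : measurable_fun setT w.
Hypothesis w0 : forall z, (0 <= w z)%R.
Implicit Types (A B : set T) (u v h : T -> R).

(** The weight enters through its square root: [J A u] is then the square of an L^2 norm on pairs,
    and the Brezis-Lieb lemma applies to it with exponent 2. *)
Definition dq A u (z : T * T) : R :=
  (\1_A z.1 * \1_A z.2 * (u z.1 - u z.2) * w z `^ 2^-1)%R.

Definition J A u : \bar R := Int (mu \x mu) (fun z => dq A u z ^+ 2)%R.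

Lemma measurable_dq A u : measurable A -> measurable_fun setT u ->
  measurable_fun setT (dq A u).
Proof.
move=> mA mu'; have mI : measurable_fun setT (\1_A : T -> R) by exact: measurable_indic.
rewrite /dq; meas.
Qed.

Lemma J_ge0 A u : 0 <= J A u.
Proof. by apply: Int_ge0 => z; exact: sqr_ge0. Qed.

Lemma dq_sqr A u z : (dq A u z ^+ 2 = \1_A z.1 * \1_A z.2 * ((u z.1 - u z.2) ^+ 2 * w z))%R.
Proof.
rewrite /dq !exprMn -!(powR_mulrn _ (powR_ge0 _ _)) -powRrM mulVf// powRr1//.
rewrite !indicE -!natrX; do 2 case: (_ \in _); rewrite ?expr0n ?expr1n /=; ring.
Qed.

Lemma le_J A B u v : measurable A -> measurable B -> A `<=` B ->
  measurable_fun setT u -> measurable_fun setT v ->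
  (forall x y, A x -> A y -> (u x - u y) ^+ 2 <= (v x - v y) ^+ 2)%R ->
  J A u <= J B v.
Proof.
move=> mA mB AB mu' mv uv.
have := measurable_dq mA mu'; have := measurable_dq mB mv => m1 m2.
apply: le_Int => [| |z|[x y]]; [by meas|by meas|exact: sqr_ge0|].
rewrite !dq_sqr !indicE /=.
have r0 : (0 <= (x \in B)%:R * (y \in B)%:R * ((v x - v y) ^+ 2 * w (x, y)))%R.
  by apply: mulr_ge0; apply: mulr_ge0; rewrite ?ler0n ?sqr_ge0.
case: (boolP (x \in A)) => [/set_mem Ax|_]; last by rewrite !mul0r.
case: (boolP (y \in A)) => [/set_mem Ay|_]; last by rewrite !mulr0 !mul0r.
rewrite !mem_set; [|exact: AB|exact: AB].
by rewrite !mul1r; apply: ler_wpM2r => //; exact: uv.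
Qed.

Lemma le_J2 A h u v (a b : R) : measurable A -> (0 <= a)%R -> (0 <= b)%R ->
  measurable_fun setT h -> measurable_fun setT u -> measurable_fun setT v ->
  (forall x y, A x -> A y ->
    (h x - h y) ^+ 2 <= a * (u x - u y) ^+ 2 + b * (v x - v y) ^+ 2)%R ->
  J A h <= a%:E * J A u + b%:E * J A v.
Proof.
move=> mA a0 b0 mh mu' mv huv.
have mdh := measurable_dq mA mh; have mdu := measurable_dq mA mu'.
have mdv := measurable_dq mA mv.
rewrite /J -IntZ//; [|by meas|by move=> z; exact: sqr_ge0].
rewrite -IntZ//; [|by meas|by move=> z; exact: sqr_ge0].
rewrite -IntD; [|by meas|by meas|move=> z|move=> z]; last 2 first.
- by rewrite mulr_ge0 ?sqr_ge0.
- by rewrite mulr_ge0 ?sqr_ge0.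
apply: le_Int => [| |z|[x y]]; [by meas|by meas|exact: sqr_ge0|].
rewrite !dq_sqr !indicE /=.
case: (boolP (x \in A)) => [/set_mem Ax|_]; last by rewrite !mul0r !mulr0 addr0.
case: (boolP (y \in A)) => [/set_mem Ay|_]; last by rewrite !mulr0 !mul0r !mulr0 addr0.
by rewrite !mul1r (mulrA a) (mulrA b) -mulrDl; apply: ler_wpM2r => //; exact: huv.
Qed.

Lemma J_le_2D A u v : measurable A -> measurable_fun setT u -> measurable_fun setT v ->
  J A (fun x => u x - v x)%R <= 2%:E * J A u + 2%:E * J A v.
Proof.
move=> mA mu' mv; apply: le_J2 => //; first by meas.
move=> x y _ _; set p := (u x - u y)%R; set q := (v x - v y)%R.
rewrite (_ : _ - _ = p - q)%R; last by rewrite /p /q; ring.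
have := sqr_ge0 (p + q); nra.
Qed.

(** The convexity identity of a quadratic form. Its second term is the gain that [weak_closure]
    exploits. *)
Lemma J_convex A u v (t : R) : measurable A -> (0 <= t <= 1)%R ->
  measurable_fun setT u -> measurable_fun setT v ->
  J A (fun x => (1 - t) * u x + t * v x)%R + (t * (1 - t))%:E * J A (fun x => u x - v x)%R =
  (1 - t)%:E * J A u + t%:E * J A v.
Proof.
move=> mA /andP[t0 t1] mu' mv.
have mdu := measurable_dq mA mu'; have mdv := measurable_dq mA mv.
have mdb := @measurable_dq A (fun x => u x - v x)%R mA ltac:(by meas).
have mdc := @measurable_dq A (fun x => (1 - t) * u x + t * v x)%R mA ltac:(by meas).
have t1' : (0 <= 1 - t)%R by lra.
rewrite /J -!IntZ; side.
rewrite -!IntD; side.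
congr Int; apply/funext => -[x y]; rewrite /dq /=; ring.
Qed.

Section cvg.
Variables (Ak : nat -> set T) (A : set T) (uk : nat -> T -> R) (v : T -> R) (M : R).
Hypothesis mAk : forall k, measurable (Ak k).
Hypothesis mA : measurable A.
Hypothesis muk : forall k, measurable_fun setT (uk k).
Hypothesis mv : measurable_fun setT v.
Hypothesis ukv : {ae mu, forall x, 
  (A x /\ (\forall k \near \oo, Ak k x) /\ uk ^~ x @ \oo --> v x) \/
  (~ A x /\ \forall k \near \oo, ~ Ak k x)}.
Hypothesis JM : forall k, J (Ak k) (uk k) <= M%:E.

(** The domains vary with k because in the escaping case they are translated half-spaces that
    eventually contain each point. The alternative in [ukv] makes their indicators eventually
    constant at almost every point. *)
Lemma dq_cvg : {ae (mu \x mu), forall z,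
  (fun k => dq (Ak k) (uk k) z) @ \oo --> dq A v z}.
Proof.
move: (ae_prod ukv); apply: filterS => -[x y] [/= hx hy].
case: hx => [[Ax [Akx ux]]|[nAx nAkx]]; last first.
  rewrite (_ : dq A v (x, y) = 0)%R; last first.
    by rewrite /dq indicE memNset//= !mul0r.
  apply: (cvg_near_cst 0%R); apply: filterS nAkx => k nAk.
  by rewrite /dq indicE memNset//= !mul0r.
case: hy => [[Ay [Aky uy]]|[nAy nAky]]; last first.
  rewrite (_ : dq A v (x, y) = 0)%R; last first.
    by rewrite /dq !indicE (memNset nAy)//= mulr0 !mul0r.
  apply: (cvg_near_cst 0%R); apply: filterS nAky => k nAk.
  by rewrite /dq !indicE (memNset nAk)//= mulr0 !mul0r.
rewrite /dq !indicE !mem_set//= !mul1r.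
have h : (fun k => (uk k x - uk k y) * w (x, y) `^ 2^-1)%R @ \oo -->
    ((v x - v y) * w (x, y) `^ 2^-1)%R.
  by apply: cvgMl; exact: cvgB.
apply: cvg_trans h; apply: near_eq_cvg; near=> k.
rewrite !indicE !mem_set/= ?mul1r//; by near: k.
Unshelve. all: end_near. Qed.

Let norm2 (a : R) : (`|a| `^ 2 = a ^+ 2)%R.
Proof. by rewrite powR_mulrn ?normr_ge0// real_normK// num_real. Qed.

Let Int2 (F : T * T -> R) : Int (mu \x mu) (fun z => `|F z| `^ 2)%R = Int (mu \x mu) (fun z => F z ^+ 2)%R.
Proof. by congr Int; apply/funext => z; exact: norm2. Qed.

Lemma J_lim_le : J A v <= M%:E.
Proof.
have := @Int_powR_lim_le _ _ _ (mu \x mu)%E 2 (ltr0Sn _ _)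
  (fun k => dq (Ak k) (uk k)) (dq A v) M.
rewrite Int2; apply.
- by move=> k; exact: measurable_dq.
- exact: measurable_dq.
- exact: dq_cvg.
- by move=> k; rewrite Int2; exact: JM.
Qed.

Lemma J_brezis_lieb (e : R) : (0 < e)%R -> \forall k \near \oo,
  J (Ak k) (uk k) <= Int (mu \x mu) (fun z => (dq (Ak k) (uk k) z - dq A v z) ^+ 2)%R + J A v + e%:E /\
  Int (mu \x mu) (fun z => (dq (Ak k) (uk k) z - dq A v z) ^+ 2)%R + J A v <= J (Ak k) (uk k) + e%:E.
Proof.
move=> e0.
have := @brezis_lieb_near _ _ _ (mu \x mu)%E 2 (ltr0Sn _ _)
  (fun k => dq (Ak k) (uk k)) (dq A v) M _ _ _ _ e e0.
case.
- by move=> k; exact: measurable_dq.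
- exact: measurable_dq.
- exact: dq_cvg.
- by move=> k; rewrite Int2; exact: JM.
move=> N _ hN; exists N => // k Nk; have := hN k Nk.
by rewrite !Int2.
Qed.

End cvg.
End J.

(** * Weak closure of convex sets *)

Lemma ge0_le_fin (R : realType) (X : \bar R) (M : R) : (0 <= X)%E -> (X <= M%:E)%E ->
  exists2 r : R, X = r%:E & 0 <= r <= M.
Proof.
by case: X => [r| |]//; rewrite !lee_fin => r0 rM; exists r => //; rewrite r0.
Qed.

Section weak_closure.
Context d (T : measurableType d) (R : realType)
  (mu : {sigma_finite_measure set T -> \bar R}) (w : T * T -> R).
Hypothesis mw : measurable_fun setT w.
Hypothesis w0 : forall z, 0 <= w z.
Variables (A : set T) (H : (T -> R) -> Prop) (g : nat -> T -> R) (v : T -> R) (C : R).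
Hypothesis mA : measurable A.
Hypothesis mH : forall u, H u -> measurable_fun setT u.
Hypothesis Hconvex : forall u1 u2 t, 0 <= t <= 1 -> H u1 -> H u2 ->
  H (fun x => (1 - t) * u1 x + t * u2 x).
Hypothesis mv : measurable_fun setT v.
Hypothesis Hg : forall k, H (g k).
Hypothesis gC : forall k, (J mu w A (g k) <= C%:E)%E.
Hypothesis gv : {ae mu, forall x, A x -> g ^~ x @ \oo --> v x}.

Local Notation "'\J' f" := (J mu w A f%R) (at level 10, f at level 8).

Let mg k : measurable_fun setT (g k). Proof. exact: mH. Qed.

Let ae_shift (f : T -> R) : {ae mu, forall x,
  (A x /\ (\forall k \near \oo, A x) /\ (fun k => g k x - f x) @ \oo --> (v x - f x)) \/
  (~ A x /\ \forall k \near \oo, ~ A x)}.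
Proof.
apply: filterS gv => x gvx; have [Ax|nAx] := pselect (A x); last by right; split => //; exact: nearW.
left; split => //; split; first exact: nearW.
by apply: cvgB; [exact: gvx|exact: cvg_cst].
Qed.

Let C0 : 0 <= C.
Proof. by rewrite -lee_fin; apply: le_trans (gC 0%N); exact: J_ge0. Qed.

Let Jv : (\J v <= C%:E)%E.
Proof.
apply: (J_lim_le mw (fun=> mA) mA mg mv _ gC).
apply: filterS gv => x gvx; have [Ax|nAx] := pselect (A x).
  by left; split => //; split; [exact: nearW|exact: gvx].
by right; split => //; exact: nearW.
Qed.

Let Jvg k : (\J (fun x => v x - g k x) <= (4 * C)%:E)%E.
Proof.
apply: le_trans (J_le_2D mu mw w0 mA mv (mg k)) _.
rewrite (_ : 4 * C = 2 * C + 2 * C); last by ring.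
by rewrite (EFinD (2 * C)) (EFinM 2) leeD// lee_wpmul2l// lee_fin.
Qed.

Let E : set R := [set r | exists2 f, H f & \J (fun x => v x - f x) = r%:E].

Let E_ge0 r : E r -> 0 <= r.
Proof. by move=> [f _ Jr]; rewrite -lee_fin -Jr; exact: J_ge0. Qed.

Let hasinfE : has_inf E.
Proof.
split; last by exists 0 => r; exact: E_ge0.
have [r Jr _] := ge0_le_fin (J_ge0 _ _ _ _) (Jvg 0%N).
by exists r; exists (g 0%N).
Qed.

Let dE := inf E.

(** Brezis-Lieb for g_k - f, which tends to v - f, says that for large N the inner product of v -
    g_N and v - f is at most e / 2. The energy of v minus (1 - t) f + t g_N is then, up to e, at
    most that of a sum of orthogonal vectors, (1 - t)^2 r + t^2 J(v - g_N), and J(v - g_N) <= 4C. *)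
Let d_le (r t : R) : E r -> 0 < t < 1 -> dE <= (1 - t) ^+ 2 * r + t ^+ 2 * (4 * C).
Proof.
move=> Er /andP[t0 t1]; have r0 := E_ge0 Er; case: Er => f Hf Jr.
have mf := mH Hf.
have Jf : (\J f <= (2 * C + 2 * r)%:E)%E.
  have -> : f = (fun x => v x - (v x - f x)) by apply/funext => x; ring.
  apply: le_trans (J_le_2D mu mw w0 mA mv _) _; first by meas.
  by rewrite Jr (EFinD (2 * C)) !(EFinM 2) leeD// lee_wpmul2l// lee_fin.
pose M := 2 * C + 2 * (2 * C + 2 * r).
have Jgf k : (\J (fun x => g k x - f x) <= M%:E)%E.
  apply: le_trans (J_le_2D mu mw w0 mA (mg k) mf) _.
  by rewrite (EFinD (2 * C)) !(EFinM 2) leeD// lee_wpmul2l// lee_fin.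
apply/ler_addgt0Pr => e e0.
have [N _ hN] := J_brezis_lieb mw (fun=> mA) mA
  (uk := fun k x => g k x - f x) (v := fun x => v x - f x)
  (fun k => measurable_funB (mg k) mf) (measurable_funB mv mf) (ae_shift f) Jgf e0.
have [_ hk] := hN N (leqnn N).
(* The near-orthogonality: expanding the energy of g_N - f as the difference of v - f and v - g_N
   leaves only the mixed term. *)
have BL : (\J (fun x => v x - g N x) + \J (fun x => v x - f x) <=
    \J (fun x => g N x - f x) + e%:E)%E.
  apply: le_trans hk; rewrite leeD2r// le_eqVlt; apply/orP; left; apply/eqP.
  by congr Int; apply/funext => z; rewrite /dq; ring.
have [b Jb /andP[b0 _]] := ge0_le_fin (J_ge0 _ _ _ _) (Jgf N).
have [a Ja /andP[a0 aC]] := ge0_le_fin (J_ge0 _ _ _ _) (Jvg N).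
rewrite Jb Ja Jr -!EFinD lee_fin in BL.
have t01 : 0 <= t <= 1 by rewrite !ltW.
have := J_convex mu mw mA t01 (measurable_funB mv mf) (measurable_funB mv (mg N)).
rewrite (_ : (fun x => v x - f x - (v x - g N x)) = fun x => g N x - f x); last first.
  by apply/funext => x; ring.
rewrite Jb Ja Jr.
rewrite (_ : (fun x => (1 - t) * (v x - f x) + t * (v x - g N x)) = fun x => v x - ((1 - t) * f x + t * g N x)); last first.
  by apply/funext => x; ring.
move=> cvx.
have JX : (\J (fun x => v x - ((1 - t) * f x + t * g N x)) <= ((1 - t) * r + t * a)%:E)%E.
  by rewrite EFinD !EFinM -cvx leeDl// mule_ge0 ?lee_fin//; apply: mulr_ge0; lra.
have [r' Jr' _] := ge0_le_fin (J_ge0 _ _ _ _) JX.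
have dr' : dE <= r'.
  apply: ge_inf; first exact: hasinfE.2.
  by exists (fun x => (1 - t) * f x + t * g N x) => //; exact: Hconvex.
move: cvx; rewrite Jr' -!EFinM -!EFinD => -[cvx].
have h1 : t * (1 - t) * (a + r - e) <= t * (1 - t) * b.
  by apply: ler_wpM2l; [apply: mulr_ge0; lra|lra].
have h2 : t ^+ 2 * a <= t ^+ 2 * (4 * C).
  by apply: ler_wpM2l => //; exact: sqr_ge0.
have h3 : t * (1 - t) * e <= e.
  by rewrite ler_piMl ?(ltW e0)//; nra.
apply: (le_trans dr'); nra.
Qed.

(** A substitute for Mazur's theorem. If the squared distance [dE] from v to H were positive, [d_le]
    at near-minimal f would give dE <= (1 - t)^2 dE + 4C t^2 for every t in (0,1), which fails for
    small t. *)
Lemma weak_closure (e : R) : 0 < e ->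
  exists2 f, H f & (\J (fun x => v x - f x) <= e%:E)%E.
Proof.
move=> e0; have d0 : 0 <= dE by apply: lb_le_inf; [exact: hasinfE.1|exact: E_ge0].
have dd t : 0 < t < 1 -> dE <= (1 - t) ^+ 2 * dE + t ^+ 2 * (4 * C).
  move=> t01; apply/ler_addgt0Pr => h h0.
  have [r Er rd] := inf_adherent h0 hasinfE.
  apply: le_trans (d_le Er t01) _; rewrite addrAC lerD2r.
  apply: (@le_trans _ _ ((1 - t) ^+ 2 * (dE + h))).
    by apply: ler_wpM2l; [exact: sqr_ge0|exact: ltW].
  rewrite mulrDr lerD2l ler_piMl ?(ltW h0)// expr_le1//; lra.
have [d00|dgt0] := leP dE 0.
  have [r [f Hf Jr] rd] := inf_adherent e0 hasinfE.
  by exists f => //; rewrite Jr lee_fin ltW//; apply: lt_le_trans rd _; rewrite gerDr.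
have C0' : 0 <= C := C0.
(* With this value t (4C + dE) < dE, whereas the bound, divided by t, demands 2 dE <= t (4C +
   dE). *)
exfalso; pose t := dE / (4 * C + dE + 1).
have den0 : 0 < 4 * C + dE + 1 by lra.
have tE : t * (4 * C + dE + 1) = dE by rewrite /t divfK// gt_eqF.
have t0 : 0 < t by rewrite divr_gt0.
have t1 : t < 1 by rewrite ltr_pdivrMr//; lra.
have t01 : 0 < t < 1 by rewrite t0.
have := dd _ t01; nra.
Qed.

End weak_closure.

(** * The fractional Sobolev inequality and concentration *)

Section kernel.
Variables (R : realType) (n : nat) (sigma : R).
Local Notation mu := (lam R n).
Local Notation p := (crit n sigma).

Implicit Types (Om : set 'rV[R]_n) (u : 'rV[R]_n -> R).

Definition ker (z : 'rV[R]_n * 'rV[R]_n) : R :=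
  (enorm (z.1 - z.2) `^ (n%:R + 2 * sigma))^-1.

Lemma ker_ge0 z : 0 <= ker z.
Proof. by rewrite invr_ge0 powR_ge0. Qed.

Lemma measurable_ker : measurable_fun setT ker.
Proof.
rewrite /ker; under eq_fun do rewrite -powRN; apply: measurable_powR_comp.
exact: (measurableT_comp (@measurable_enorm R n) (@measurable_sub_row R n)).
Qed.

Definition LL (Om : set 'rV[R]_n) (u : 'rV[R]_n -> R) : \bar R :=
  Int mu (fun x => \1_Om x * `|u x| `^ p).

Lemma LpintE Om u : measurable Om -> measurable_fun setT u -> Lpint Om u p = LL Om u.
Proof.
move=> mOm mu'; have mI : measurable_fun setT (\1_Om : _ -> R) by exact: measurable_indic.
rewrite /Lpint iintE//; first by meas.
Qed.

Definition Dx (Om : set 'rV[R]_n) (u : 'rV[R]_n -> R) (x : 'rV[R]_n) : \bar R :=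
  Int mu (fun y => \1_Om x * \1_Om y * ((u x - u y) ^+ 2 * ker (x, y))).

Lemma pair_integrand_ge0 Om (u : 'rV[R]_n -> R) x y :
  0 <= \1_Om x * \1_Om y * ((u x - u y) ^+ 2 * ker (x, y)).
Proof.
by rewrite !indicE; apply: mulr_ge0; apply: mulr_ge0; rewrite ?ler0n ?sqr_ge0 ?ker_ge0.
Qed.

Lemma measurable_pair_integrand Om u : measurable Om -> measurable_fun setT u ->
  measurable_fun setT (fun z => \1_Om z.1 * \1_Om z.2 * ((u z.1 - u z.2) ^+ 2 * ker z)).
Proof.
move=> mOm mu'; have mI : measurable_fun setT (\1_Om : _ -> R) by exact: measurable_indic.
by have := measurable_ker => mk; meas.
Qed.

Lemma J_Dx Om u : measurable Om -> measurable_fun setT u ->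
  J mu ker Om u = (\int[mu]_x Dx Om u x)%E.
Proof.
move=> mOm mu'; rewrite /J /Int.
under eq_integral do rewrite (dq_sqr ker_ge0).
apply: (@fubini_tonelli1 _ _ _ _ _ mu mu
  (fun z => (\1_Om z.1 * \1_Om z.2 * ((u z.1 - u z.2) ^+ 2 * ker z))%:E)).
  by apply/measurable_EFinP; exact: measurable_pair_integrand.
by move=> [x y]; rewrite lee_fin pair_integrand_ge0.
Qed.

Lemma measurable_Dx Om u : measurable Om -> measurable_fun setT u ->
  measurable_fun setT (Dx Om u).
Proof.
move=> mOm mu'.
apply: (@measurable_fun_fubini_tonelli_F _ _ _ _ _ mu
  (fun z => (\1_Om z.1 * \1_Om z.2 * ((u z.1 - u z.2) ^+ 2 * ker z))%:E)).
  by apply/measurable_EFinP; exact: measurable_pair_integrand.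
by move=> [x y]; rewrite lee_fin pair_integrand_ge0.
Qed.

Lemma IgagE Om u : measurable Om -> measurable_fun setT u ->
  Igag sigma Om u = J mu ker Om u.
Proof.
move=> mOm mu'; rewrite J_Dx// /Igag.
have -> : (fun x => iint (fun y => (\1_Om x * \1_Om y *
    ((u x - u y) ^+ 2 / enorm (x - y) `^ (n%:R + 2 * sigma)))%:E)) = Dx Om u.
  apply/funext => x; rewrite iintE//.
  - exact: (measurableT_comp ((measurable_EFinP _ _).2 (measurable_pair_integrand mOm mu'))
      (pair1_measurable x)).
  - by move=> y; rewrite lee_fin (pair_integrand_ge0 _ _ x y).
rewrite iintE//; first exact: measurable_Dx.
by move=> x; apply: Int_ge0 => y; exact: pair_integrand_ge0.
Qed.

End kernel.

Section optimise.
Variables (R : realType) (N s K M a : R).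
Hypotheses (s0 : 0 < s) (sN : 2 * s < N) (K0 : 0 <= K) (M0 : 0 < M) (a0 : 0 <= a).

Let b := N / (N - 2 * s).
Let be := 2 * s / (N - 2 * s).
Let Ns : 0 < N - 2 * s. Proof. by rewrite subr_gt0. Qed.
Let N0 : 0 < N. Proof. by apply: lt_trans sN; rewrite mulr_gt0. Qed.

Let optimise_pos (r : R) : 0 < r ->
  (forall l, 0 < l -> a <= 2 * M * l `^ (2 * s - N) + 2 * K * r * l `^ (2 * s)) ->
  a `^ b <= (2 + 2 * K) `^ b * M `^ be * r.
Proof.
move=> r0 h; pose t := M / r; have t0 : 0 < t by rewrite divr_gt0.
have l0 : 0 < t `^ N^-1 by rewrite powR_gt0.
have := h _ l0; rewrite -!powRrM.
have -> : M = r * t by rewrite /t mulrC divfK// gt_eqF.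
have e1 : t * t `^ (N^-1 * (2 * s - N)) = t `^ (N^-1 * (2 * s)).
  rewrite -{1}(powRr1 (ltW t0)) -powRD; last by rewrite (gt_eqF t0) implybT.
  by congr (_ `^ _); field; rewrite gt_eqF.
have -> : 2 * (r * t) * t `^ (N^-1 * (2 * s - N)) = 2 * r * t `^ (N^-1 * (2 * s)).
  by rewrite -e1; ring.
have -> : 2 * r * t `^ (N^-1 * (2 * s)) + 2 * K * r * t `^ (N^-1 * (2 * s)) =
  (2 + 2 * K) * (r * t `^ (N^-1 * (2 * s))) by ring.
move=> ha.
have b0 : 0 < b by rewrite divr_gt0.
apply: le_trans (powR_le_mono b0 a0 ha) _.
have K2 : 0 <= 2 + 2 * K by rewrite addr_ge0// mulr_ge0.
have rt : 0 <= r * t `^ (N^-1 * (2 * s)) by rewrite mulr_ge0 ?powR_ge0// ltW.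
rewrite powRM//.
rewrite -mulrA; apply: ler_wpM2l; first exact: powR_ge0.
rewrite (powRM _ (ltW r0) (powR_ge0 _ _)) -powRrM.
have -> : N^-1 * (2 * s) * b = be by rewrite /b /be; field; rewrite !gt_eqF.
have -> : r `^ b = r * r `^ be.
  rewrite -{2}(powRr1 (ltW r0)) -powRD; last by rewrite (gt_eqF r0) implybT.
  by congr (_ `^ _); rewrite /b /be; field; rewrite gt_eqF.
by rewrite (powRM _ (ltW r0) (ltW t0)) le_eqVlt; apply/orP; left; apply/eqP; ring.
Qed.

(** The two terms balance when l^N equals M / r, and both are then multiples of r^((N-2s)/N)
    M^(2s/N). The case r = 0 is reached by enlarging r by an arbitrarily small amount. *)
Lemma morrey_optimise (r : R) : 0 <= r ->
  (forall l, 0 < l -> a <= 2 * M * l `^ (2 * s - N) + 2 * K * r * l `^ (2 * s)) ->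
  a `^ b <= (2 + 2 * K) `^ b * M `^ be * r.
Proof.
move=> r0 h; set Q := (2 + 2 * K) `^ b * M `^ be.
have Q0 : 0 <= Q by rewrite mulr_ge0 ?powR_ge0.
apply/ler_addgt0Pr => e e0.
have d0 : 0 < e / (Q + 1) by rewrite divr_gt0//; lra.
apply: le_trans (optimise_pos (r := r + e / (Q + 1)) _ _) _; first by lra.
  move=> l l0; apply: le_trans (h l l0) _; rewrite lerD2l.
  apply: ler_wpM2r; first exact: powR_ge0.
  by apply: ler_wpM2l; [rewrite mulr_ge0|rewrite lerDl ltW].
rewrite -/Q mulrDr lerD2l mulrCA ler_piMr ?(ltW e0)//.
have Q1 : 0 < Q + 1 by lra.
by rewrite ler_pdivrMr// mul1r lerDl.
Qed.

End optimise.

Section morrey.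
Variables (R : realType) (n : nat) (sigma : R).
Hypotheses (s0 : 0 < sigma) (sn : 2 * sigma < n%:R).
Local Notation mu := (lam R n).
Local Notation p := (crit n sigma).
Local Notation ker := (@ker R n sigma).
Local Notation J := (J mu ker).
Local Notation LL := (@LL R n sigma).
Local Notation Dx := (@Dx R n sigma).
Local Notation be := (2 * sigma / (n%:R - 2 * sigma)).
Local Notation b := (n%:R / (n%:R - 2 * sigma)).

Let ns : 0 < n%:R - 2 * sigma. Proof. by rewrite subr_gt0. Qed.
Let n0 : (0 : R) < n%:R. Proof. by apply: lt_trans sn; rewrite mulr_gt0. Qed.

Lemma critE : p = 2 * b.
Proof. by rewrite /crit; ring. Qed.

Lemma crit_gt2 : 2 < p.
Proof. by rewrite critE; rewrite -[ltLHS]mulr1 ltr_pM2l// ltr_pdivlMr// mul1r gtrBl mulr_gt0. Qed.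

Lemma norm_crit (a : R) : `|a| `^ p = (a ^+ 2) `^ b.
Proof.
by rewrite critE powRrM; congr (_ `^ _); rewrite powR_mulrn// real_normK// num_real.
Qed.

Definition kexp : R := n%:R + 2 * sigma.
Definition Kn : R := Num.sqrt n%:R `^ kexp.

Lemma Kn_ge0 : 0 <= Kn. Proof. exact: powR_ge0. Qed.

(** Points at distance at most l in each coordinate are at Euclidean distance at most sqrt(n) l,
    whence [Kn]. On the diagonal the kernel is the inverse of 0, that is 0, so c has to vanish
    there. *)
Lemma ker_lower (x y : 'rV[R]_n) (l : R) (c : R) : 0 < l ->
  (forall i, `|(x - y) 0 i| <= l) -> (x = y -> c = 0) -> 0 <= c ->
  c <= Kn * l `^ kexp * (c * ker (x, y)).
Proof.
move=> l0 xyl xyc c0; have [xy|xy] := eqVneq x y; first by rewrite (xyc xy) mul0r mulr0.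
have e0 : 0 < enorm (x - y) by apply: enorm_gt0; rewrite subr_eq0.
rewrite mulrCA -[leLHS]mulr1; apply: ler_wpM2l => //.
rewrite /ker /= ler_pdivlMr ?powR_gt0// mul1r /Kn -(powRM _ (sqrtr_ge0 _) (ltW l0)).
apply: powR_le_mono; rewrite ?enorm_ge0//; first by rewrite /kexp addr_gt0 ?mulr_gt0.
by apply: enorm_le => //; exact: ltW.
Qed.

Lemma cube_dist (a x y : 'rV[R]_n) l : cube a l x -> cube a l y ->
  forall i, `|(x - y) 0 i| <= l.
Proof.
move=> ax ay i; have := ax i; have := ay i; rewrite !mxE ler_norml; lra.
Qed.

Lemma Int_cube (x : 'rV[R]_n) (l : R) : 0 <= l -> Int mu \1_(cube x l) = (l ^+ n)%:E.
Proof.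
move=> l0; rewrite /Int integral_indic//; last exact: measurable_cube.
by rewrite setIT; exact: lam_cube.
Qed.

Section domain.
Variable Om : set 'rV[R]_n.
Hypothesis mOm : measurable Om.
Hypothesis Omcube : forall x l, Om x -> 0 < l -> cube x l `<=` Om.
Variable u : 'rV[R]_n -> R.
Hypothesis mu' : measurable_fun setT u.

Let mI : measurable_fun setT (\1_Om : _ -> R). Proof. exact: measurable_indic. Qed.
Let mC x l : measurable_fun setT (\1_(cube x l) : 'rV[R]_n -> R).
Proof. apply: measurable_indic; exact: measurable_cube. Qed.

(** The inequality u(x)^2 <= 2 u(y)^2 + 2 (u(x) - u(y))^2 is averaged over y in the cube based at x.
    The first term is controlled by the Morrey bound M, the second by the kernel, which is bounded
    below on the cube off the diagonal. Optimising in l produces the critical power of u(x). *)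
Let pointwise (M : R) (x : 'rV[R]_n) : 0 < M -> Om x ->
  (forall l, 0 < l -> (Int mu (fun y => \1_(cube x l) y * u y ^+ 2)%R <= (M * l `^ (2 * sigma))%:E)%E) ->
  ((`|u x| `^ p)%:E <= ((2 + 2 * Kn) `^ b * M `^ be)%:E * Dx Om u x)%E.
Proof.
move=> M0 Omx hM.
have D0 : (0 <= Dx Om u x)%E by apply: Int_ge0 => y; exact: pair_integrand_ge0.
have Q0 : 0 < (2 + 2 * Kn) `^ b * M `^ be.
  apply: mulr_gt0; apply: powR_gt0 => //.
  by rewrite ltr_pwDl// mulr_ge0 ?Kn_ge0.
case HD : (Dx Om u x) D0 => [r| |] // D0; last by rewrite gt0_muley ?lte_fin// leey.
rewrite lee_fin in D0; rewrite -EFinM lee_fin norm_crit.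
apply: morrey_optimise => //; [exact: Kn_ge0|exact: sqr_ge0|move=> l l0].
pose h y := \1_Om x * \1_Om y * ((u x - u y) ^+ 2 * ker (x, y)).
have mh : measurable_fun setT h.
  exact: (measurableT_comp (measurable_pair_integrand sigma mOm mu') (pair1_measurable x)).
have h0 y : 0 <= h y by exact: pair_integrand_ge0.
have key : (Int mu (fun y => u x ^+ 2 * \1_(cube x l) y)%R <=
   (2 * (M * l `^ (2 * sigma)) + 2 * Kn * l `^ kexp * r)%:E)%E.
  rewrite EFinD 2!EFinM.
  apply: (@le_trans _ _ (Int mu (fun y => 2 * (\1_(cube x l) y * u y ^+ 2) +
     2 * Kn * l `^ kexp * h y)%R)).
    have mCl := mC x l.
    apply: le_Int; side.
    move=> y; rewrite indicE; have K0 : 0 <= 2 * Kn * l `^ kexp * h y.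
      by nng.
    have [/set_mem xy|_] := boolP (y \in cube x l); last first.
      by rewrite mulr0 mul0r mulr0 add0r.
    rewrite mulr1 mul1r.
    have hy : (u x - u y) ^+ 2 <= Kn * l `^ kexp * h y.
      rewrite /h !indicE !mem_set//; last exact: (Omcube Omx l0).
      rewrite !mul1r; apply: ker_lower => //; last exact: sqr_ge0.
      - apply: cube_dist xy => i; rewrite lexx; lra.
      - by move=> ->; rewrite subrr expr0n.
    rewrite (_ : 2 * Kn * l `^ kexp * h y = 2 * (Kn * l `^ kexp * h y)); last by ring.
    have := sqr_ge0 (u x - 2 * u y); move: hy; set H := Kn * _ * h y; nra.
  have mCl := mC x l.
  rewrite IntD; side.
  rewrite IntZ; side.
  rewrite IntZ; side.
  rewrite leeD//; last by rewrite -[Int _ h]/(Dx Om u x) HD.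
  by rewrite lee_wpmul2l ?lee_fin//; exact: hM.
move: key; rewrite IntZ; side.
rewrite (Int_cube _ (ltW l0)) -EFinM lee_fin => key.
have ln : l ^+ n = l `^ n%:R by rewrite powR_mulrn// ltW.
have e1 : l `^ (2 * sigma - n%:R) = l `^ (2 * sigma) / l ^+ n.
  by rewrite ln powRB// (gt_eqF l0) implybT.
have e2 : l `^ kexp = l `^ (2 * sigma) * l ^+ n.
  by rewrite ln /kexp addrC powRD// (gt_eqF l0) implybT.
have ln0 : 0 < l ^+ n by exact: exprn_gt0.
move: key; rewrite e2 -ler_pdivlMr// => /le_trans; apply.
by rewrite e1 le_eqVlt; apply/orP; left; apply/eqP; field; rewrite gt_eqF.
Qed.

(** Since M enters with a positive power, a function of bounded energy whose L^2 mass is thin on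
    every cube has a small L^p norm; [concentration] is the contrapositive. *)
Lemma morrey (M : R) : 0 < M ->
  (forall x l, Om x -> 0 < l ->
     (Int mu (fun y => \1_(cube x l) y * u y ^+ 2)%R <= (M * l `^ (2 * sigma))%:E)%E) ->
  (LL Om u <= ((2 + 2 * Kn) `^ b * M `^ be)%:E * J Om u)%E.
Proof.
move=> M0 hM; rewrite J_Dx//.
have Q0 : 0 <= (2 + 2 * Kn) `^ b * M `^ be by rewrite mulr_ge0 ?powR_ge0.
have D0 x : (0 <= Dx Om u x)%E by apply: Int_ge0 => y; exact: pair_integrand_ge0.
rewrite -ge0_integralZl//; last exact: measurable_Dx.
apply: ge0_le_integral => //.
- by apply/measurable_EFinP; meas.
- by apply: measurable_funeM; exact: measurable_Dx.
move=> x _; rewrite indicE; have [/set_mem Omx|_] := boolP (x \in Om); last first.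
  by rewrite mul0r mule_ge0.
by rewrite mul1r; apply: pointwise => // l l0; exact: hM.
Qed.

(** Hölder's inequality on the cube, up to the factor 2: a^2 is at most s where it is small, and at
    most s^(1-p/2) |a|^p where it is large. *)
Lemma sqr_cube_le (x : 'rV[R]_n) (l L : R) : cube x l `<=` Om -> 0 < l -> 0 < L ->
  (LL Om u <= L%:E)%E ->
  (Int mu (fun y => \1_(cube x l) y * u y ^+ 2)%R <= (2 * L `^ (2 / p) * l `^ (2 * sigma))%:E)%E.
Proof.
move=> QOm l0 L0 hL.
have p0 : 0 < p by apply: lt_trans crit_gt2.
have ln0 : 0 < l ^+ n by exact: exprn_gt0.
(* At this threshold the two contributions s l^n and s^(1-p/2) L are equal. *)
pose s : R := (L / l ^+ n) `^ (2 / p).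
have s1 : 0 < s by rewrite powR_gt0 ?divr_gt0.
have pw (a : R) : a ^+ 2 <= s + s `^ (1 - p / 2) * `|a| `^ p.
  have [sa|as_] := leP (a ^+ 2) s.
    by apply: le_trans sa _; rewrite lerDl mulr_ge0 ?powR_ge0.
  apply: (@le_trans _ _ (s `^ (1 - p / 2) * `|a| `^ p)); last by rewrite lerDr ltW.
  have a0 : 0 < a ^+ 2 by apply: lt_trans as_.
  have -> : `|a| `^ p = (a ^+ 2) `^ (p / 2).
    rewrite norm_crit critE; congr (_ `^ _).
    by rewrite [RHS]mulrAC divff ?mul1r.
  rewrite (_ : 1 - p / 2 = - (p / 2 - 1)); last by ring.
  rewrite powRN mulrC ler_pdivlMr ?powR_gt0 ?divr_gt0//.
  rewrite [in leRHS](_ : p / 2 = 1 + (p / 2 - 1)); last by ring.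
  rewrite [leRHS]powRD ?(gt_eqF a0) ?implybT// powRr1 ?(ltW a0)//.
  apply: ler_wpM2l; first exact: ltW.
  apply: ge0_ler_powR; rewrite ?nnegrE ?(ltW s1) ?(ltW a0) ?(ltW as_)//.
  by rewrite subr_ge0 ler_pdivlMr// mul1r ltW// crit_gt2.
have mCl := mC x l.
apply: (@le_trans _ _ (Int mu (fun y => s * \1_(cube x l) y + s `^ (1 - p / 2) * (\1_Om y * `|u y| `^ p))%R)).
  apply: le_Int; side => y; rewrite !indicE.
  have [/set_mem xy|_] := boolP (y \in cube x l); last first.
    by rewrite mul0r mulr0 add0r !mulr_ge0 ?powR_ge0.
  by rewrite mem_set; [rewrite !mul1r mulr1; exact: pw|exact: QOm].
rewrite IntD; side.
rewrite IntZ; side.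
rewrite IntZ; side.
rewrite (Int_cube _ (ltW l0)) -/(LL Om u).
apply: (@le_trans _ _ (s%:E * (l ^+ n)%:E + (s `^ (1 - p / 2))%:E * L%:E)%E).
  by rewrite leeD2l// lee_wpmul2l// lee_fin powR_ge0.
rewrite -!EFinM -EFinD lee_fin.
have ln : l ^+ n = l `^ n%:R by rewrite powR_mulrn// ltW.
have e1 : s `^ (1 - p / 2) * L = s * l ^+ n.
  rewrite powRD ?(gt_eqF s1) ?implybT// powRr1 ?(ltW s1)// -mulrA; congr (_ * _).
  rewrite /s powRN -powRrM (_ : 2 / p * (p / 2) = 1); last by field; rewrite gt_eqF.
  by rewrite powRr1 ?ltW ?divr_gt0// invf_div divfK// gt_eqF.
have e2 : s * l ^+ n = L `^ (2 / p) * l `^ (2 * sigma).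
  rewrite /s powRM ?invr_ge0 ?ltW// -mulrA; congr (_ * _).
  rewrite ln -powRN -powRrM -powRD ?(gt_eqF l0) ?implybT//.
  by congr (_ `^ _); rewrite /crit; field; rewrite !gt_eqF.
by rewrite e1 e2 le_eqVlt; apply/orP; left; apply/eqP; ring.
Qed.


Let be0 : 0 < be. Proof. by rewrite divr_gt0 ?mulr_gt0. Qed.

Let Kb0 : 0 < (2 + 2 * Kn) `^ b.
Proof. by apply: powR_gt0; rewrite ltr_pwDl// mulr_ge0 ?Kn_ge0. Qed.

Definition Csob : R := (2 + 2 * Kn) `^ b * 2 `^ be.

(** By [sqr_cube_le] the function itself supplies the Morrey bound M = 2 L^(2/p). Then [morrey]
    gives L <= C L^(1-2/p) j, and L^(1-2/p) may be divided out because L is finite and, apart from a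
    trivial case, positive. *)
Lemma sobolev (L j : R) : LL Om u = L%:E -> J Om u = j%:E -> L `^ (2 / p) <= Csob * j.
Proof.
move=> hL hJ.
have L0 : 0 <= L.
  by rewrite -lee_fin -hL; apply: Int_ge0 => x; rewrite mulr_ge0 ?powR_ge0 ?indic_nneg.
have j0 : 0 <= j by rewrite -lee_fin -hJ; exact: J_ge0.
have p0 : 0 < p by apply: lt_trans crit_gt2.
have [L1|Lle0] := ltP 0 L; last first.
  have -> : L = 0 by apply/eqP; rewrite eq_le Lle0 L0.
  rewrite powR0; first by rewrite !mulr_ge0 ?powR_ge0.
  by rewrite gt_eqF// divr_gt0.
have M0 : 0 < 2 * L `^ (2 / p) by rewrite mulr_gt0 ?powR_gt0.
have LL1 : (LL Om u <= L%:E)%E by rewrite hL.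
have := morrey M0 (fun x l Omx l0 => sqr_cube_le (Omcube Omx l0) l0 L1 LL1).
rewrite hL hJ -EFinM lee_fin powRM ?powR_ge0// -powRrM.
have e1 : 2 / p * be = 1 - 2 / p.
  by rewrite /crit; field; rewrite !gt_eqF.
rewrite e1 powRB; last by rewrite (gt_eqF L1) implybT.
rewrite powRr1// => h.
have Lp0 : 0 < L `^ (2 / p) by rewrite powR_gt0.
rewrite -(ler_pM2l L1).
apply: (@le_trans _ _ (((2 + 2 * Kn) `^ b * (2 `^ be * (L / L `^ (2 / p))) * j) * L `^ (2 / p))).
  by apply: ler_wpM2r => //; exact: ltW.
by rewrite /Csob le_eqVlt; apply/orP; left; apply/eqP; field; rewrite gt_eqF.
Qed.

(** The Morrey bound for which [morrey] at energy 1 bounds the L^p mass by L0 / 2. *)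
Definition conc (L0 : R) : R := (L0 / 2 / (2 + 2 * Kn) `^ b) `^ be^-1.

Lemma conc_gt0 (L0 : R) : 0 < L0 -> 0 < conc L0.
Proof. by move=> L00; rewrite powR_gt0// !divr_gt0. Qed.

Lemma concentration (L0 : R) : 0 < L0 -> (J Om u <= 1)%E -> (L0%:E <= LL Om u)%E ->
  exists x l, [/\ Om x, 0 < l &
    ((conc L0 * l `^ (2 * sigma))%:E < Int mu (fun y => \1_(cube x l) y * u y ^+ 2)%R)%E].
Proof.
move=> L00 J1 hL; apply: contrapT => /forallNP h.
have M0 := conc_gt0 L00.
have := morrey M0 _ => /(_ _)/wrap[].
  move=> x l Omx l0; rewrite leNgt; apply/negP => hl; apply: (h x); by exists l.
apply/negP; rewrite -ltNge.
apply: (@le_lt_trans _ _ ((2 + 2 * Kn) `^ b * conc L0 `^ be)%:E).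
  rewrite -[leRHS]mule1 lee_wpmul2l// lee_fin mulr_ge0 ?powR_ge0//.
apply: lt_le_trans hL; rewrite lte_fin /conc -powRrM mulVf ?gt_eqF// powRr1; last first.
  by rewrite !divr_ge0 ?powR_ge0 ?ltW.
by rewrite mulrC divfK ?gt_eqF// ltr_pdivrMr// ltr_pMr// ltrDl.
Qed.

End domain.
End morrey.

(** * Local compactness *)

Lemma cvg_geometric_increments (R : realType) (u : nat -> R) (N : nat) (C : R) :
  (forall i, (N <= i)%N -> `|u i.+1 - u i| <= C * 2^-1 ^+ i) -> cvgn u.
Proof.
move=> h.
pose a i := u (i + N)%N.
have ha i : `|telescope a i| <= geometric (C * 2^-1 ^+ N) 2^-1 i.
  rewrite /= -mulrA -exprD (addnC N i); exact: (h _ (leq_addl _ _)).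
have C0 i : 0 <= geometric (C * 2^-1 ^+ N) 2^-1 i by apply: le_trans (ha i).
have ca : cvgn (series (telescope a)).
  apply: normed_cvg.
  apply: (series_le_cvg (v_ := geometric (C * 2^-1 ^+ N) 2^-1)) => //.
    by move=> i; exact: normr_ge0.
  by apply: is_cvg_geometric_series; rewrite ger0_norm ?invr_ge0// invf_lt1// ltr1n.
have {}ca : cvgn a.
  rewrite (_ : a = fun i => a 0%N + series (telescope a) i); last first.
    by apply/funext => i; rewrite -eq_sum_telescope.
  by apply: is_cvgD => //; exact: is_cvg_cst.
by move/cvg_ex : ca => [l al]; apply/cvg_ex; exists l; rewrite -(cvg_shiftn N).
Qed.

Section ae_bounded.
Context d (T : measurableType d) (R : realType) (mu : {measure set T -> \bar R}).

(** The sum of all h_i has integral at most 2 and is therefore finite almost everywhere; it bounds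
    each term. *)
Lemma ae_bounded (h : nat -> T -> R) :
  (forall i, measurable_fun setT (h i)) -> (forall i x, 0 <= h i x) ->
  (forall i, (Int mu (h i) <= (2^-1 ^+ i)%:E)%E) ->
  {ae mu, forall x, exists K, forall i, h i x <= K}.
Proof.
move=> mh h0 hI.
have mhE i : measurable_fun setT (EFin \o h i) by apply/measurable_EFinP; exact: mh.
pose G x := (\sum_(0 <= i <oo) (h i x)%:E)%E.
have G0 x : (0 <= G x)%E by apply: nneseries_ge0 => i _ _; rewrite lee_fin.
have IG : (\int[mu]_x G x < +oo)%E.
  rewrite integral_nneseries//; last by move=> i x _; rewrite lee_fin.
  apply: (@le_lt_trans _ _ (\sum_(0 <= i <oo) (2^-1 ^+ i)%:E)%E).
    apply: lee_nneseries => [i _ _|i _]; last exact: hI.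
    by apply: integral_ge0 => x _; rewrite lee_fin.
  rewrite (_ : (\sum_(0 <= i <oo) _)%E = 2%:E) ?ltry//.
  apply/cvg_lim => //.
  have -> : (fun n => (\sum_(0 <= i < n) (2^-1 ^+ i)%:E)%E) =
      (fun n => (series (geometric (1:R) 2^-1) n)%:E).
    by apply/funext => k; rewrite sumEFin /series/=; congr EFin; apply: eq_bigr => i _; rewrite mul1r.
  apply/fine_cvgP; split; first exact: nearW.
  have := @cvg_geometric_series R 1 2^-1; rewrite ger0_norm ?invr_ge0//.
  rewrite invf_lt1// ltr1n => /(_ isT).
  by rewrite (_ : 1 / (1 - 2^-1) = 2 :> R)//; field.
have mG : measurable_fun setT G.
  by apply: ge0_emeasurable_sum => [i x _ _|i _]; [rewrite lee_fin|exact: mhE].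

have iG : mu.-integrable setT G.
  apply/integrableP; split => //.
  by under eq_integral do rewrite gee0_abs//.
have := integrable_ae measurableT iG; apply: filterS => x /(_ I) fG.
exists (fine (G x)) => i; rewrite -lee_fin fineK//.
apply: (@le_trans _ _ (\sum_(0 <= j < i.+1) (h j x)%:E)%E).
  rewrite big_nat_recr//= leeDr//; apply: sume_ge0 => j _; by rewrite lee_fin.
by apply: nneseries_lim_ge => j _ _; rewrite lee_fin.
Qed.

End ae_bounded.

(** * Almost everywhere convergence from finitely many cell values per scale *)

Section compactness.
Context d (T : measurableType d) (R : realType) (mu : {measure set T -> \bar R}).
Variables (f : nat -> T -> R) (Z : nat -> finType) (q : forall i, T -> Z i)
  (c : forall i, nat -> Z i -> R) (B : nat -> nat -> set T) (Om : set T).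
Arguments c : clear implicits.
Hypothesis mf : forall k, measurable_fun setT (f k).
Hypothesis c_bounded : forall i z, exists C, forall k, `|c i k z| <= C.
Let g i k x := \1_(B i k) x * (f k x - c i k (q i x)) ^+ 2.
Hypothesis mg : forall i k, measurable_fun setT (g i k).
Hypothesis gI : forall i k, (Int mu (g i k) <= (8^-1 ^+ i)%:E)%E.
Hypothesis BOm : forall x, Om x -> exists N, forall i k, (N <= i)%N -> (N <= k)%N -> B i k x.

(** An ultrafilter supplies the limits of all the values [c i k z] at once. Only phi i and phi (i+1)
    are compared at scale i, so the index phi (i+1) has to be good just at the scales i and i+1, and
    no diagonal extraction is needed. *)
Let subseq : exists phi : nat -> nat, {homo phi : i j / (i < j)%N >-> (i < j)%N} /\
  forall i z, `|c i (phi i) z - c i (phi i.+1) z| <= 2^-1 ^+ i.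
Proof.
have [U [UU oU]] := @ultraFilterLemma nat \oo _.
have lim_c i z : exists l : R, c i k z @[k --> U] --> l.
  have [C hC] := c_bounded z.
  have [] := @segment_compact R (- C) C (c i k z @[k --> U]) _.
    by apply: (@filterS _ U _ setT) => [k _|]; [rewrite /= in_itv/= -ler_norml|exact: filterT].
  move=> l [_ hl]; exists l => V Vl.
  have [//|nV] := in_ultra_setVsetC ((fun k => c i k z) @^-1` V) UU.
  by have [x []] := hl _ _ (nV : (c i k z @[k --> U]) (~` V)) Vl.
pose cl i z := projT1 (cid (@lim_c i z)).
have clP i z : c i k z @[k --> U] --> @cl i z by exact: projT2 (cid (@lim_c i z)).
pose good i k := forall z : Z i, `|c i k z - @cl i z| <= 2^-1 ^+ i.+1.
have goodU i : \forall k \near U, good i k.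
  apply: filter_forall => z; have /cvgrPdist_le := @clP i z.
  have e0 : (0 : R) < 2^-1 ^+ i.+1 by rewrite exprn_gt0// invr_gt0.
  by move/(_ _ e0); apply: filterS => k; rewrite distrC.
have step i m : exists k, [/\ (m < k)%N, good i k & good i.+1 k].
  have [k [h1 [h2 h3]]] : exists k, (m < k)%N /\ good i k /\ good i.+1 k.
    apply: (@filter_ex _ U); apply: filterI; last by apply: filterI; exact: goodU.
    by apply: oU; exists m.+1.
  by exists k.
pose nxt i m := projT1 (cid (step i m)).
have nxtP i m : [/\ (m < nxt i m)%N, good i (nxt i m) & good i.+1 (nxt i m)].
  exact: projT2 (cid (step i m)).
pose phi := fix F i := match i with 0 => nxt 0%N 0%N | i'.+1 => nxt i' (F i') end.
have good0 i : good i (phi i).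
  by case: i => [|i]; [have [] := nxtP 0%N 0%N|have [] := nxtP i (phi i)].
exists phi; split.
  by apply: homo_ltn => [i j k|i]; [exact: ltn_trans|have [] := nxtP i (phi i)].
move=> i z; have [_ h1 _] := nxtP i (phi i); have h2 := good0 i.
have := h1 z; have := h2 z; rewrite -/(phi i.+1) exprS.
set A := 2^-1 ^+ i; rewrite !ler_norml; lra.
Qed.

(** Both f (phi i) and f (phi (i+1)) are compared with cell values at scale i. The squared errors
    have integrals at most 8^-i, hence at almost every point they are at most a constant times 4^-i,
    and the increments are summable. *)
Lemma ae_cvg_subseq : exists (phi : nat -> nat) (v : T -> R),
  [/\ {homo phi : i j / (i < j)%N >-> (i < j)%N}, measurable_fun setT v &
   {ae mu, forall x, Om x -> (fun j => f (phi j) x) @ \oo --> v x}].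
Proof.
have [phi [phi_inc phic]] := subseq.
(* The upper limit is measurable on the whole space, whether or not the sequence converges there. *)
pose v x := fine (limn_esup (fun j => (f (phi j) x)%:E)).
exists phi, v; split => //.
  apply: (measurableT_comp (f := fine)) => //.
  by apply: measurable_fun_limn_esup => k; apply/measurable_EFinP; exact: mf.
have phi_ge i : (i <= phi i)%N.
  by elim: i => // i IH; apply: leq_ltn_trans IH (phi_inc _ _ (ltnSn i)).
(* The weight leaves an integral of at most (4/8)^i = 2^-i, as [ae_bounded] requires. *)
pose h i x := (4 ^+ i / 2) * (g i (phi i) x + g i (phi i.+1) x).
have g0 i k x : 0 <= g i k x by rewrite mulr_ge0 ?sqr_ge0 ?indic_nneg.
have h0 i x : 0 <= h i x by rewrite mulr_ge0 ?addr_ge0// divr_ge0// exprn_ge0.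
have mh i : measurable_fun setT (h i).
  by have m1 := mg i (phi i); have m2 := mg i (phi i.+1); rewrite /h; meas.
have hI i : (Int mu (h i) <= (2^-1 ^+ i)%:E)%E.
  have m1 := mg i (phi i); have m2 := mg i (phi i.+1).
  have c4 : (0 : R) <= 4 ^+ i / 2 by rewrite divr_ge0// exprn_ge0.
  rewrite /h IntZ; side.
  rewrite IntD; side.
  apply: (@le_trans _ _ ((4 ^+ i / 2)%:E * (8^-1 ^+ i + 8^-1 ^+ i)%:E)%E).
    by rewrite lee_wpmul2l ?lee_fin// EFinD leeD.
  rewrite -EFinM lee_fin.
  rewrite (_ : 4 ^+ i / 2 * (8^-1 ^+ i + 8^-1 ^+ i) = (4 * 8^-1) ^+ i); last by rewrite exprMn; field.
  by rewrite (_ : 4 * 8^-1 = 2^-1 :> R)//; field.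
have := ae_bounded mh h0 hI; apply: filterS => x [K hK] Omx.
have [N hN] := BOm Omx.
have K0 : 0 <= K by apply: le_trans (hK 0%N).
have dist i k : (N <= i)%N -> k = phi i \/ k = phi i.+1 ->
    `|f k x - c i k (q i x)| <= Num.sqrt (2 * K) * 2^-1 ^+ i.
  move=> Ni hk.
  have gK : g i k x <= 2 * K * (2^-1 ^+ i) ^+ 2.
    have := hK i; rewrite /h.
    have -> : (2^-1 ^+ i) ^+ 2 = (4 ^+ i)^-1 :> R.
      by rewrite -exprM mulnC exprM -[RHS]exprVn; congr (_ ^+ _); field.
    have p4 : (0 : R) < 4 ^+ i by exact: exprn_gt0.
    move=> hKi; rewrite ler_pdivlMr//.
    by have := g0 i (phi i) x; have := g0 i (phi i.+1) x; case: hk => ->; nra.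
  have Bk : B i k x.
    by apply: hN => //; case: hk => ->; apply: leq_trans Ni _ => //; apply: leq_trans (phi_ge _); rewrite ?leqnSn.
  move: gK; rewrite /g indicE mem_set// mul1r -ler_sqrt; last first.
    by rewrite mulr_ge0 ?sqr_ge0// mulr_ge0.
  rewrite sqrtr_sqr sqrtrM ?mulr_ge0// sqrtr_sqr [X in _ * X]ger0_norm//.
have cvgx : cvgn (fun j => f (phi j) x).
  apply: (@cvg_geometric_increments _ _ N (2 * Num.sqrt (2 * K) + 1)) => i Ni.
  have d1 := dist i _ Ni (or_introl erefl); have d2 := dist i _ Ni (or_intror erefl).
  have := phic i (q i x); move: d1 d2; set S := Num.sqrt _ * _.
  have -> : (2 * Num.sqrt (2 * K) + 1) * 2^-1 ^+ i = 2 * S + 2^-1 ^+ i by rewrite /S; ring.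
  by rewrite !ler_norml; lra.
move/cvg_ex : cvgx => [l fl]; rewrite /v.
have fle : (fun j => (f (phi j) x)%:E) @ \oo --> l%:E.
  by apply/fine_cvgP; split => //; exact: nearW.
by rewrite (cvg_limn_einf_sup fle).
Qed.

End compactness.

Lemma IntSum d (T : measurableType d) (R : realType) (mu : {measure set T -> \bar R})
    (I : Type) (s : seq I) (P : pred I) (F : I -> T -> R) :
  (forall i, measurable_fun setT (F i)) -> (forall i x, 0 <= F i x) ->
  (Int mu (fun x => \sum_(i <- s | P i) F i x)%R = \sum_(i <- s | P i) Int mu (F i))%E.
Proof.
move=> mF F0; elim: s => [|i s IH].
  by rewrite big_nil /Int; under eq_integral do rewrite big_nil; rewrite integral0.
rewrite big_cons -IH; case: ifPn => Pi.
  rewrite -IntD//; last 2 first.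
  - under eq_fun do rewrite big_mkcond.
    by apply: measurable_sum => j; case: (P j).
  - by move=> x; exact: sumr_ge0.
  by congr Int; apply/funext => x; rewrite big_cons Pi.
by congr Int; apply/funext => x; rewrite big_cons (negbTE Pi).
Qed.

(** * Cell values on a grid and local compactness *)

Section compactness_rV.
Variables (R : realType) (n : nat) (sigma : R).
Hypotheses (s0 : 0 < sigma) (sn : 2 * sigma < n%:R).
Local Notation mu := (lam R n).
Local Notation p := (crit n sigma).
Local Notation ker := (@ker R n sigma).
Local Notation J := (J mu ker).
Local Notation LL := (@LL R n sigma).
Local Notation Dx := (@Dx R n sigma).
Local Notation Kn := (@Kn R n sigma).
Local Notation kexp := (@kexp R n sigma).

(** A fractional Poincaré inequality with the value of u at one point in place of its mean. Some y
    in the cube has inner energy [Dx] not much above the average j / l^n, and c = u y. The term e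
    makes the contradiction strict when every y is assumed to fail. *)
Lemma cell_value (a : 'rV[R]_n) (l e j : R) (u : 'rV[R]_n -> R) :
  0 < l -> 0 < e -> measurable_fun setT u -> J (cube a l) u = j%:E ->
  exists c, (Int mu (fun x => \1_(cube a l) x * (u x - c) ^+ 2)%R <=
    (Kn * l `^ (2 * sigma) * j + e)%:E)%E.
Proof.
move=> l0 e0 mu' Jj; set Q := cube a l.
have mQ : measurable Q by exact: measurable_cube.
have mI : measurable_fun setT (\1_Q : _ -> R) by exact: measurable_indic.
have ln0 : 0 < l ^+ n by exact: exprn_gt0.
have lk0 : 0 < Kn * l `^ kexp + 1 by rewrite ltr_wpDl// mulr_ge0 ?powR_ge0.
have e2 : l `^ kexp = l `^ (2 * sigma) * l ^+ n.
  by rewrite -(powR_mulrn _ (ltW l0)) /kexp addrC powRD// (gt_eqF l0) implybT.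
set Bd := Kn * l `^ (2 * sigma) * j + e.
have [y [Qy hy]] : exists y, Q y /\ ((Kn * l `^ kexp)%:E * Dx Q u y <= Bd%:E)%E.
  apply: contrapT => /forallNP h.
  have h' y : Q y -> (Bd%:E < (Kn * l `^ kexp)%:E * Dx Q u y)%E.
    by move=> Qy; rewrite ltNge; apply/negP => hy; apply: (h y).
  have : (Int mu (fun y => Bd * \1_Q y)%R <= (Kn * l `^ kexp)%:E * J Q u)%E.
    rewrite J_Dx// -ge0_integralZl//; last 3 first.
    - exact: measurable_Dx.
    - by move=> x _; apply: Int_ge0 => y; exact: pair_integrand_ge0.
    - by rewrite lee_fin mulr_ge0 ?powR_ge0.
    have D0 x : (0 <= (Kn * l `^ kexp)%:E * Dx Q u x)%E.
      by rewrite mule_ge0 ?lee_fin ?mulr_ge0 ?powR_ge0//; apply: Int_ge0 => y; exact: pair_integrand_ge0.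
    have Bd0 : 0 <= Bd.
      rewrite addr_ge0 ?(ltW e0)// !mulr_ge0 ?powR_ge0// -lee_fin -Jj; exact: J_ge0.
    apply: ge0_le_integral => //.
    - by move=> x _; rewrite lee_fin mulr_ge0 ?indic_nneg.
    - by apply/measurable_EFinP; meas.
    - by apply: measurable_funeM; exact: measurable_Dx.
    move=> x _; rewrite indicE; have [/set_mem Qx|_] := boolP (x \in Q).
      by rewrite mulr1 ltW// h'.
    by rewrite mulr0.
  apply/negP; rewrite -ltNge Jj -EFinM IntZ; side; last first.
    by rewrite addr_ge0 ?(ltW e0)// !mulr_ge0 ?powR_ge0// -lee_fin -Jj; exact: J_ge0.
  rewrite (Int_cube _ (ltW l0)) -EFinM lte_fin /Bd e2 -subr_gt0.
  by rewrite (_ : _ - _ = e * l ^+ n) ?mulr_gt0//; ring.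
exists (u y); apply: le_trans hy; rewrite -IntZ; last 3 first.
- by rewrite mulr_ge0 ?powR_ge0.
- exact: (measurableT_comp (measurable_pair_integrand sigma mQ mu') (pair1_measurable y)).
- by move=> x; exact: pair_integrand_ge0.
apply: le_Int; side.
- apply: measurable_funM => //.
  exact: (measurableT_comp (measurable_pair_integrand sigma mQ mu') (pair1_measurable y)).
- move=> x; have [Qx|nQx] := boolP (x \in Q); last first.
    rewrite [\1_Q x in leLHS]indicE (negbTE nQx) mul0r.
    apply: mulr_ge0; last exact: pair_integrand_ge0.
    by rewrite mulr_ge0 ?powR_ge0.
  rewrite !indicE (mem_set Qy) Qx !mul1r -sqrrN opprB; apply: ker_lower => //.
  - by move=> i; apply: (cube_dist Qy); exact: set_mem.
  - by move=> ->; rewrite subrr expr0n.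
  - exact: sqr_ge0.
Qed.

Section sequence.
Variables (f : nat -> 'rV[R]_n -> R) (A : nat -> set 'rV[R]_n) (Om : set 'rV[R]_n) (L : R).
Hypothesis mf : forall k, measurable_fun setT (f k).
Hypothesis mA : forall k, measurable (A k).
Hypothesis J1 : forall k, (J (A k) (f k) <= 1)%E.
Hypothesis L0 : 0 < L.
Hypothesis LLf : forall k, (LL (A k) (f k) <= L%:E)%E.
Hypothesis AOm : forall x, Om x -> exists2 e, 0 < e & exists N, forall k, (N <= k)%N ->
  [set y : 'rV[R]_n | forall i, `|y 0 i - x 0 i| < e] `<=` A k.

(** The first bound makes the cells shrink to points, the second makes the Poincaré constant of a
    cell at most 8^-i / 2. *)
Let l (i : nat) : R := Num.min (2^-1 ^+ i) ((8^-1 ^+ i / 2 / (Kn + 1)) `^ (2 * sigma)^-1).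

Let l0 i : 0 < l i.
Proof.
rewrite lt_min exprn_gt0 ?invr_gt0//= powR_gt0// !divr_gt0 ?exprn_gt0 ?invr_gt0//.
by rewrite ltr_wpDl// Kn_ge0.
Qed.

Let l_small i : Kn * l i `^ (2 * sigma) <= 8^-1 ^+ i / 2.
Proof.
have K1 : 0 < Kn + 1 by rewrite ltr_wpDl// Kn_ge0.
have e0 : 0 <= 8^-1 ^+ i / 2 / (Kn + 1) by rewrite !divr_ge0 ?exprn_ge0 ?invr_ge0// ltW.
have s2 : 0 < 2 * sigma by rewrite mulr_gt0.
apply: (@le_trans _ _ (Kn * (8^-1 ^+ i / 2 / (Kn + 1)))).
  apply: ler_wpM2l; first exact: Kn_ge0.
  rewrite -[leRHS](powRVK s2 e0); apply: powR_le_mono => //; first exact: ltW.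
  by rewrite ge_min lexx orbT.
rewrite mulrCA ler_piMr ?divr_ge0 ?exprn_ge0 ?invr_ge0//.
by rewrite ler_pdivrMr// mul1r lerDl.
Qed.

Let Ncell (i : nat) : nat := Num.truncn (2 * i%:R / l i).
Let Z (i : nat) : finType := {ffun 'I_n -> 'I_(Ncell i).+1}.
(** Points outside the grid receive an arbitrary cell, so that x lies in [Q (q i x)] is a separate
    fact ([q_Q]). *)
Let q (i : nat) (x : 'rV[R]_n) : Z i := [ffun j => inord (Num.truncn ((x 0 j + i%:R) / l i))].
Let corner (i : nat) (z : Z i) : 'rV[R]_n := \row_j (l i * (z j)%:R - i%:R).
Let Q (i : nat) (z : Z i) := cube (corner z) (l i).

Let Q_q i (z : Z i) (x : 'rV[R]_n) : Q z x -> q i x = z.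
Proof.
move=> Qx; apply/ffunP => j; rewrite ffunE; have := Qx j; rewrite mxE => /andP[h1 h2].
have -> : Num.truncn ((x 0 j + i%:R) / l i) = z j.
  apply/truncn_def; rewrite ler_pdivlMr// ltr_pdivrMr// -natr1 mulrDl mul1r.
  by rewrite ![_%:R * l i]mulrC; apply/andP; split; lra.
by rewrite inord_val.
Qed.

Let q_Q i (x : 'rV[R]_n) : (forall j, `|x 0 j| <= i%:R) -> Q (q i x) x.
Proof.
move=> xi j; rewrite mxE ffunE; have := xi j; rewrite ler_norml => /andP[x1 x2].
have h0 : 0 <= (x 0 j + i%:R) / l i by rewrite divr_ge0 ?(ltW (l0 i))//; lra.
have h1 : (Num.truncn (((x 0 j + i%:R) / l i)%R) < (Ncell i).+1)%N.
  rewrite ltnS; apply: le_truncn; rewrite ler_pM2r ?invr_gt0//; lra.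
rewrite inordK//; have /andP[] := truncn_itv h0; rewrite -[_.+1%:R]natr1.
set m := (Num.truncn _)%:R; rewrite ler_pdivlMr// ltr_pdivrMr// => h2 h3.
have := mulrDl m 1 (l i); rewrite mul1r [m * l i]mulrC => h4.
by apply/andP; split; lra.
Qed.

Let good i k (z : Z i) := `[< Q z `<=` A k >].
(** Half of the error allowed at scale i, shared equally among the cells. *)
Let eps (i : nat) : R := 8^-1 ^+ i / 2 / #|Z i|%:R.

Let Zpos i : (0 : R) < #|Z i|%:R.
Proof. by rewrite ltr0n; apply/card_gt0P; exists [ffun=> ord0]. Qed.

Let eps0 i : 0 < eps i.
Proof. by rewrite !divr_gt0 ?exprn_gt0 ?invr_gt0. Qed.

Let jQ i k (z : Z i) : R := fine (J (Q z) (f k)).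

Let mQ i (z : Z i) : measurable (Q z). Proof. exact: measurable_cube. Qed.

Let jQE i k (z : Z i) : good k z -> J (Q z) (f k) = (jQ k z)%:E.
Proof.
move=> /asboolP QA; rewrite fineK// ge0_fin_numE ?J_ge0//.
apply: (@le_lt_trans _ _ 1%E); last by rewrite ltry.
apply: le_trans (J1 k); apply: le_J => //; [exact: measurable_ker|exact: ker_ge0].
Qed.

Let cell i k (z : Z i) : exists c, good k z ->
  (Int mu (fun x => \1_(Q z) x * (f k x - c) ^+ 2)%R <=
    (Kn * l i `^ (2 * sigma) * jQ k z + eps i)%:E)%E.
Proof.
have [gz|ngz] := boolP (good k z); last by exists 0.
have [c hc] := cell_value (l0 i) (eps0 i) (mf k) (jQE gz).
by exists c.
Qed.

Let c0 i k (z : Z i) : R := projT1 (cid (cell k z)).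

Let c0P i k (z : Z i) : good k z ->
  (Int mu (fun x => \1_(Q z) x * (f k x - c0 k z) ^+ 2)%R <=
    (Kn * l i `^ (2 * sigma) * jQ k z + eps i)%:E)%E.
Proof. exact: projT2 (cid (cell k z)). Qed.

(** Cells not contained in [A k] get the value 0, so that boundedness in k holds for every cell. *)
Let c i k (z : Z i) : R := if good k z then c0 k z else 0.

Let cP i k (z : Z i) : good k z ->
  (Int mu (fun x => \1_(Q z) x * (f k x - c k z) ^+ 2)%R <=
    (Kn * l i `^ (2 * sigma) * jQ k z + eps i)%:E)%E.
Proof. by move=> gz; rewrite /c gz; exact: c0P. Qed.

(** On a good cell f_k is close to its constant in L^2, so a large constant would contradict the L^2
    bound that [sqr_cube_le] draws from the L^p bound. *)
Let c_bounded i (z : Z i) : exists C, forall k, `|c k z| <= C.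
Proof.
have ln0 : 0 < l i ^+ n by exact: exprn_gt0.
pose a := 2 * L `^ (2 / p) * l i `^ (2 * sigma); pose b := Kn * l i `^ (2 * sigma) * 1 + eps i.
pose X := 2 * a + 2 * b.
have X0 : 0 <= X.
  by rewrite /X /a /b !addr_ge0// !mulr_ge0 ?powR_ge0 ?addr_ge0 ?mulr_ge0 ?powR_ge0// ltW.
exists (Num.sqrt (X / l i ^+ n)) => k; rewrite /c; case: ifPn => [gz|_]; last first.
  by rewrite normr0 sqrtr_ge0.
have := c0P gz; set cz := c0 k z => hc.
have QA : Q z `<=` A k by exact/asboolP.
have mI : measurable_fun setT (\1_(Q z) : _ -> R) by exact: measurable_indic.
have mfk := mf k.
have h2 := sqr_cube_le s0 sn (mA k) (mf k) QA (l0 i) L0 (LLf k).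
have jz1 : jQ k z <= 1.
  rewrite -lee_fin -jQE//; apply: le_trans (J1 k); apply: le_J => //.
  exact: measurable_ker.
  exact: ker_ge0.
have : (Int mu (fun x => cz ^+ 2 * \1_(Q z) x)%R <= X%:E)%E.
  apply: (@le_trans _ _ (Int mu (fun x => 2 * (\1_(Q z) x * f k x ^+ 2) + 2 * (\1_(Q z) x * (f k x - cz) ^+ 2))%R)).
    apply: le_Int; side => x.
    rewrite indicE; case: (x \in Q z); last by rewrite !mul0r !mulr0 addr0.
    by rewrite !mul1r mulr1; have := sqr_ge0 (2 * f k x - cz); nra.
  rewrite IntD; side.
  rewrite IntZ; side.
  rewrite IntZ; side.
  rewrite /X (EFinD (2 * a)) (EFinM 2 a) (EFinM 2 b) leeD//; first by rewrite lee_wpmul2l.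
  rewrite lee_wpmul2l//; apply: le_trans hc _; rewrite lee_fin lerD2r.
  by apply: ler_wpM2l => //; rewrite mulr_ge0 ?powR_ge0.
rewrite IntZ; side.
rewrite (Int_cube _ (ltW (l0 i))) -EFinM lee_fin -ler_pdivlMr// => h.
by rewrite -sqrtr_sqr ler_wsqrtr.
Qed.

Let B i k : set 'rV[R]_n := [set x | good k (q i x) /\ Q (q i x) x].

Let BE i k (x : 'rV[R]_n) : (\1_(B i k) x : R) = \sum_(z : Z i | good k z) \1_(Q z) x.
Proof.
have [/set_mem[gz Qz]|nB] := boolP (x \in B i k).
  rewrite indicE mem_set//= (bigD1 (q i x))//= big1 ?addr0; last first.
    move=> z /andP[_ zq]; rewrite indicE memNset// => /Q_q/eqP; rewrite eq_sym.
    by rewrite (negbTE zq).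
  by rewrite indicE mem_set.
rewrite indicE (negbTE nB) big1// => z gz; rewrite indicE memNset// => Qz.
by move/negP: nB; apply; rewrite inE; split; rewrite (Q_q Qz).
Qed.

Let mB i k : measurable_fun setT (\1_(B i k) : _ -> R).
Proof.
rewrite (_ : \1_(B i k) = fun x => \sum_(z : Z i | good k z) \1_(Q z) x); last first.
  by apply/funext => x; exact: BE.
under eq_fun do rewrite big_mkcond.
by apply: measurable_sum => z; case: (good k z) => //; exact: measurable_indic.
Qed.

Let gE i k (x : 'rV[R]_n) : \1_(B i k) x * (f k x - c k (q i x)) ^+ 2 =
  \sum_(z : Z i | good k z) \1_(Q z) x * (f k x - c k z) ^+ 2.
Proof.
rewrite BE mulr_suml; apply: eq_bigr => z _; rewrite indicE.
by have [/set_mem/Q_q ->//|_] := boolP (x \in Q z); rewrite !mul0r.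
Qed.

Let mt i k (z : Z i) : measurable_fun setT (fun x => \1_(Q z) x * (f k x - c k z) ^+ 2).
Proof.
have mI : measurable_fun setT (\1_(Q z) : _ -> R) by exact: measurable_indic.
by meas.
Qed.

Let mg i k : measurable_fun setT (fun x => \1_(B i k) x * (f k x - c k (q i x)) ^+ 2).
Proof.
under eq_fun do rewrite gE big_mkcond.
by apply: measurable_sum => z; case: (good k z) => //; exact: mt.
Qed.

(** The squares of disjoint cells are disjoint in the product: for a given pair (x, y) only the cell
    of x can contribute. *)
Let sumJ i k : (\sum_(z : Z i | good k z) J (Q z) (f k) <= 1)%E.
Proof.
apply: le_trans (J1 k); rewrite /J -IntSum; last 2 first.
- move=> z; apply: measurable_funX; apply: measurable_dq => //; exact: measurable_ker.
- by move=> z x; exact: sqr_ge0.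
apply: le_Int => [| |z|[x y]].
- under eq_fun do rewrite big_mkcond.
  apply: measurable_sum => z; case: (good k z) => //.
  by apply: measurable_funX; apply: measurable_dq => //; exact: measurable_ker.
- by apply: measurable_funX; apply: measurable_dq => //; exact: measurable_ker.
- by apply: sumr_ge0 => ? _; exact: sqr_ge0.
have zero z : q i x != z -> dq ker (Q z) (f k) (x, y) = 0.
  move=> qz; rewrite /dq indicE memNset/= ?mul0r// => /Q_q/eqP.
  by rewrite (negbTE qz).
have [gz|ngz] := boolP (good k (q i x)); last first.
  rewrite big1 ?sqr_ge0// => z gz; rewrite zero ?expr0n//.
  by apply: contraNneq ngz => ->.
rewrite (bigD1 (q i x))//= big1 ?addr0; last first.
  by move=> z /andP[_ zq]; rewrite zero ?expr0n// eq_sym.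
have QA : Q (q i x) `<=` A k by exact/asboolP.
rewrite !(dq_sqr (@ker_ge0 _ _ _)) /= !indicE.
have r0 : 0 <= (x \in A k)%:R * (y \in A k)%:R * ((f k x - f k y) ^+ 2 * ker (x, y)).
  by apply: mulr_ge0; apply: mulr_ge0; rewrite ?ler0n ?sqr_ge0 ?ker_ge0.
have [/set_mem Qx|_] := boolP (x \in Q (q i x)); last by rewrite !mul0r.
have [/set_mem Qy|_] := boolP (y \in Q (q i x)); last by rewrite mulr0 !mul0r.
by rewrite !mem_set//; exact: QA.
Qed.

Let gI i k : (Int mu (fun x => \1_(B i k) x * (f k x - c k (q i x)) ^+ 2)%R <= (8^-1 ^+ i)%:E)%E.
Proof.
rewrite (_ : (fun x => _) = fun x => \sum_(z : Z i | good k z) \1_(Q z) x * (f k x - c k z) ^+ 2); last first.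
  by apply/funext => x; exact: gE.
rewrite IntSum; last 2 first.
- by move=> z; exact: mt.
- by move=> z x; rewrite mulr_ge0 ?sqr_ge0 ?indic_nneg.
apply: (@le_trans _ _ (\sum_(z : Z i | good k z) (Kn * l i `^ (2 * sigma) * jQ k z + eps i)%:E)%E).
  by apply: lee_sum => z gz; exact: cP.
rewrite sumEFin lee_fin big_split /=.
have s1 : \sum_(z : Z i | good k z) jQ k z <= 1.
  rewrite -lee_fin -sumEFin; apply: le_trans (sumJ i k).
  by rewrite le_eqVlt; apply/orP; left; apply/eqP; apply: eq_bigr => z gz; rewrite jQE.
have s2 : \sum_(z : Z i | good k z) eps i <= 8^-1 ^+ i / 2.
  apply: (@le_trans _ _ (\sum_(z : Z i) eps i)).
    rewrite [leLHS]big_mkcond; apply: ler_sum => z _.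
    by case: ifP => // _; exact: ltW.
  by rewrite sumr_const -[leLHS]mulr_natr /eps divfK// gt_eqF.
rewrite -mulr_sumr.
have K0 : 0 <= Kn * l i `^ (2 * sigma) by rewrite mulr_ge0 ?powR_ge0.
have := ler_wpM2l K0 s1; rewrite mulr1 => s3; have := l_small i; move: s2 s3.
set a := \sum_(_ | _) _; set b := Kn * _ * _; set t := Kn * _; lra.
Qed.

(** The cell of x at scale i has side at most 2^-i, so it fits into the neighbourhood supplied by
    [AOm] once i is large; x lies in the grid once i exceeds its coordinates. *)
Let BOm x : Om x -> exists N, forall i k, (N <= i)%N -> (N <= k)%N -> B i k x.
Proof.
move=> /AOm[e e0 [N0 hN0]].
have [N1 _ hN1] : \forall i \near \oo, (2^-1 ^+ i : R) < e.
  have : (fun i => 2^-1 ^+ i : R) @ \oo --> 0.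
    by apply: cvg_expr; rewrite ger0_norm ?invr_ge0// invf_lt1// ltr1n.
  by move/cvgrPdist_lt/(_ e e0); apply: filterS => i; rewrite sub0r normrN; apply: le_lt_trans; exact: ler_norm.
pose N2 := (\max_j (Num.truncn (`|x 0 j|)%R).+1)%N.
exists (maxn N0 (maxn N1 N2)) => i k; rewrite !geq_max => /and3P[_ i1 i2] /and3P[k0 _ _].
have Qx : Q (q i x) x.
  apply: q_Q => j; apply: ltW; apply: lt_le_trans (truncnS_gt _) _.
  by rewrite ler_nat; apply: leq_trans i2; exact: (leq_bigmax j).
split => //; apply/asboolP => y Qy; apply: (hN0 k k0) => j /=.
have := cube_dist Qy Qx j; rewrite !mxE => h; apply: le_lt_trans h _.
by apply: le_lt_trans (hN1 i i1); rewrite ge_min lexx.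
Qed.

Lemma local_compactness : exists (phi : nat -> nat) (v : 'rV[R]_n -> R),
  [/\ {homo phi : i j / (i < j)%N >-> (i < j)%N}, measurable_fun setT v &
   {ae mu, forall x, Om x -> (fun j => f (phi j) x) @ \oo --> v x}].
Proof. exact: (ae_cvg_subseq mf c_bounded mg gI BOm). Qed.

End sequence.
End compactness_rV.

(** * Dilations and translations *)

Section halfspace.
Variables (R : realType) (n : nat).
Hypothesis n0 : (0 < n)%N.

Lemma ilast_subproof : (n.-1 < n)%N. Proof. by rewrite ltn_predL. Qed.
Definition ilast : 'I_n := Ordinal ilast_subproof.

Lemma xlastE (x : 'rV[R]_n) : xlast x = x 0 ilast.
Proof.
rewrite /xlast (bigD1 ilast)/=; last by rewrite prednK.
rewrite big1 ?addr0// => i /andP[/eqP ni /eqP[]].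
by apply: val_inj => /=; rewrite -[LHS]/(i.+1.-1) ni.
Qed.

Lemma measurable_halfspace : measurable (@halfspace R n).
Proof.
rewrite (_ : halfspace n = (fun x : 'rV[R]_n => x 0 ilast) @^-1` `]0, +oo[%classic).
  by rewrite -[X in measurable X]setTI; exact: measurable_coord.
by apply/seteqP; split => x; rewrite /halfspace /= xlastE in_itv/= andbT.
Qed.

Lemma halfspace_cube (x : 'rV[R]_n) l : halfspace n x -> 0 < l -> cube x l `<=` halfspace n.
Proof.
rewrite /halfspace /= !xlastE => x0 l0 y /(_ ilast) /andP[xy _].
by rewrite /= xlastE; exact: lt_le_trans xy.
Qed.

End halfspace.

Section rescale.
Variables (R : realType) (n : nat) (sigma : R).
Hypotheses (s0 : 0 < sigma) (sn : 2 * sigma < n%:R).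
Local Notation mu := (lam R n).
Local Notation p := (crit n sigma).
Local Notation ker := (@ker R n sigma).
Local Notation J := (J mu ker).
Local Notation LL := (@LL R n sigma).
Local Notation Dx := (@Dx R n sigma).
Variables (c : R) (a : 'rV[R]_n).
Hypothesis c0 : 0 < c.

Definition aff (x : 'rV[R]_n) := c *: (x - a).
Local Notation T := aff.

Lemma measurable_aff_comp (u : 'rV[R]_n -> R) :
  measurable_fun setT u -> measurable_fun setT (fun x => u (T x)).
Proof. by move=> mu'; exact: (measurableT_comp mu' (@measurable_affine R n c a)). Qed.

Lemma measurable_preimage_aff (Om : set 'rV[R]_n) : measurable Om -> measurable (T @^-1` Om).
Proof.
by move=> mOm; rewrite -[X in measurable X]setTI; exact: (@measurable_affine R n c a).
Qed.

Lemma Int_aff (f : 'rV[R]_n -> R) : measurable_fun setT f -> (forall x, 0 <= f x) ->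
  ((c ^+ n)%:E * Int mu (fun x => f (T x)) = Int mu f)%E.
Proof.
move=> mf f0; apply: integral_affine => //; first exact/measurable_EFinP.
Qed.

Lemma indic_preimage_aff (Om : set 'rV[R]_n) x : \1_(T @^-1` Om) x = \1_Om (T x) :> R.
Proof. by rewrite !indicE. Qed.

Let cn : c ^+ n = c `^ n%:R. Proof. by rewrite powR_mulrn// ltW. Qed.

Lemma measurable_rescale (u : 'rV[R]_n -> R) : measurable_fun setT u ->
  measurable_fun setT (rescale sigma c a u).
Proof.
by move=> mu'; have := measurable_aff_comp mu' => h; rewrite /rescale; apply: measurable_funM.
Qed.

Lemma LL_rescale (Om : set 'rV[R]_n) (u : 'rV[R]_n -> R) :
  measurable Om -> measurable_fun setT u ->
  LL (T @^-1` Om) (rescale sigma c a u) = LL Om u.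
Proof.
move=> mOm mu'; have mI : measurable_fun setT (\1_Om : _ -> R) by exact: measurable_indic.
rewrite /LL -[RHS]Int_aff; [|by meas|by move=> x; nng].
rewrite -IntZ; [|by rewrite exprn_ge0// ltW| |by move=> x; nng]; last first.
  by apply: (@measurable_aff_comp (fun x => \1_Om x * `|u x| `^ p)); meas.
congr Int; apply/funext => x; rewrite indic_preimage_aff /rescale -/(T x).
rewrite normrM powRM// ger0_norm ?powR_ge0// -powRrM.
rewrite (_ : (n%:R - 2 * sigma) / 2 * p = n%:R) ?cn; first by ring.
by rewrite /crit; field; rewrite gt_eqF// subr_gt0.
Qed.

(** Unlike the energy and the L^p norm, local L^2 mass is not invariant. The factor cancels the
    power l^(2 sigma) of [concentration] when the cube is scaled to side 1. *)
Lemma sqr_rescale (Q : set 'rV[R]_n) (u : 'rV[R]_n -> R) :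
  measurable Q -> measurable_fun setT u ->
  (Int mu (fun x => \1_(T @^-1` Q) x * rescale sigma c a u x ^+ 2)%R =
   (c `^ (- (2 * sigma)))%:E * Int mu (fun x => \1_Q x * u x ^+ 2)%R)%E.
Proof.
move=> mQ mu'; have mI : measurable_fun setT (\1_Q : _ -> R) by exact: measurable_indic.
rewrite -[in RHS]Int_aff; [|by meas|by move=> x; nng].
have mh := @measurable_aff_comp (fun x => \1_Q x * u x ^+ 2) ltac:(by meas).
rewrite -IntZ; [|by rewrite exprn_ge0// ltW|exact: mh|by move=> x; nng].
rewrite -IntZ; [|by rewrite powR_ge0|by apply: measurable_funM|move=> x]; last first.
  by rewrite mulr_ge0 ?exprn_ge0// ?(ltW c0)//; nng.
congr Int; apply/funext => x; rewrite indic_preimage_aff /rescale -/(T x) exprMn cn.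
rewrite -(powR_mulrn 2 (powR_ge0 _ _)) -powRrM.
have -> : c `^ ((n%:R - 2 * sigma) / 2 * 2) = c `^ (- (2 * sigma)) * c `^ n%:R.
  by rewrite -powRD ?(gt_eqF c0) ?implybT//; congr (_ `^ _); field.
by ring.
Qed.

Lemma ker_aff x y : ker (x, y) = c `^ (n%:R + 2 * sigma) * ker (T x, T y).
Proof.
rewrite /ker /= /aff -scalerBr (_ : x - a - (y - a) = x - y); last first.
  by rewrite opprB addrA subrK.
rewrite enormZ ?(ltW c0)// powRM ?enorm_ge0 ?(ltW c0)// invfM mulrA divff ?mul1r//.
by rewrite gt_eqF// powR_gt0.
Qed.

(** The powers of c match: n from each of the two changes of variables, against n + 2 sigma from the
    kernel and n - 2 sigma from the squared amplitude. *)
Lemma J_rescale (Om : set 'rV[R]_n) (u : 'rV[R]_n -> R) :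
  measurable Om -> measurable_fun setT u ->
  J (T @^-1` Om) (rescale sigma c a u) = J Om u.
Proof.
move=> mOm mu'.
rewrite (J_Dx _ (measurable_preimage_aff mOm) (measurable_rescale mu')) (J_Dx _ mOm mu').
have D0 x : (0 <= Dx Om u x)%E by apply: Int_ge0 => y; exact: pair_integrand_ge0.
have cn0 : 0 <= c ^+ n by rewrite exprn_ge0// ltW.
rewrite -[RHS](@integral_affine R n c a)//; last exact: measurable_Dx.
rewrite -ge0_integralZl//; last first.
  exact: (measurableT_comp (measurable_Dx sigma mOm mu') (@measurable_affine R n c a)).
apply: eq_integral => x _; rewrite /Dx -/(T x).
have mh : measurable_fun setT (fun y => \1_Om (T x) * \1_Om y * ((u (T x) - u y) ^+ 2 * ker (T x, y))).
  exact: (measurableT_comp (measurable_pair_integrand sigma mOm mu') (pair1_measurable (T x))).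
have h0 y : 0 <= \1_Om (T x) * \1_Om y * ((u (T x) - u y) ^+ 2 * ker (T x, y)).
  exact: pair_integrand_ge0.
rewrite -[in RHS](Int_aff mh h0) muleA -EFinM.
rewrite -IntZ; [|by rewrite mulr_ge0|exact: (measurable_aff_comp mh)|by move=> y; exact: h0].
congr Int; apply/funext => y; rewrite !indic_preimage_aff (ker_aff x y) /rescale -/(T x) -/(T y).
rewrite -mulrBr exprMn -(powR_mulrn 2 (powR_ge0 _ _)) -powRrM cn.
have -> : c `^ n%:R * c `^ n%:R = c `^ ((n%:R - 2 * sigma) / 2 * 2) * c `^ (n%:R + 2 * sigma).
  by rewrite -!powRD ?(gt_eqF c0) ?implybT//; congr (_ `^ _); field.
by ring.
Qed.

End rescale.

(** * Smooth truncations *)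

Section smooth_pos.
Variables (R : realType) (e : R).
Hypothesis e0 : 0 < e.

(** For t > 0 this is t^2 / (t + e), a C^1 substitute for the positive part. The form chosen makes
    differences factor, with a slope between 0 and 1 ([smooth_posB]). *)
Definition smooth_pos (t : R) : R := Num.max t 0 - e + e ^+ 2 / (Num.max t 0 + e).
Definition dsmooth_pos (t : R) : R := 1 - e ^+ 2 / (Num.max t 0 + e) ^+ 2.

Let pos (t : R) := Num.max t 0.
Let pos0 t : 0 <= pos t. Proof. by rewrite le_max lexx orbT. Qed.
Let pe t : 0 < pos t + e. Proof. by rewrite ltr_wpDl. Qed.

Lemma smooth_pos_le0 t : t <= 0 -> smooth_pos t = 0.
Proof.
by move=> t0; rewrite /smooth_pos (max_idPr t0) !add0r expr2 mulfK ?gt_eqF// addNr.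
Qed.

Let smooth_posB a b : smooth_pos a - smooth_pos b = (pos a - pos b) * (1 - e ^+ 2 / ((pos a + e) * (pos b + e))).
Proof.
have /lt0r_neq0 ha := pe a; have /lt0r_neq0 hb := pe b.
by rewrite /smooth_pos -/(pos a) -/(pos b); field; rewrite ha hb.
Qed.

Let slope a b : 0 <= 1 - e ^+ 2 / ((pos a + e) * (pos b + e)) <= 1.
Proof.
have ha := pe a; have hb := pe b.
have hab : 0 < (pos a + e) * (pos b + e) by rewrite mulr_gt0.
rewrite subr_ge0 ler_pdivrMr// mul1r gerBl divr_ge0 ?sqr_ge0 ?(ltW hab)// andbT expr2.
by apply: ler_pM; rewrite ?(ltW e0)// lerDr.
Qed.

Let pos_lip a b : `|pos a - pos b| <= `|a - b|.
Proof.
rewrite /pos; case: (leP a 0) => [a0|a0]; case: (leP b 0) => [b0|b0];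
  rewrite ?(max_idPr a0) ?(max_idPr b0) ?(max_idPl (ltW a0)) ?(max_idPl (ltW b0)) //.
- by rewrite subrr normr0.
- rewrite sub0r normrN gtr0_norm// ler0_norm; lra.
- rewrite subr0 gtr0_norm// ger0_norm; lra.
Qed.

Lemma smooth_pos_lip a b : `|smooth_pos a - smooth_pos b| <= `|a - b|.
Proof.
rewrite smooth_posB normrM; have /andP[h1 h2] := slope a b.
by apply: le_trans (pos_lip a b); rewrite ler_piMr// ger0_norm.
Qed.

Lemma smooth_pos_ge0 t : 0 <= smooth_pos t.
Proof.
have := smooth_posB t 0; rewrite (smooth_pos_le0 (lexx 0)) subr0 => ->.
by apply: mulr_ge0; [rewrite {2}/pos maxxx subr0 pos0|have /andP[] := slope t 0].
Qed.

Lemma smooth_pos_pos t : `|smooth_pos t - Num.max t 0| <= e.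
Proof.
rewrite /smooth_pos -/(pos t) (_ : _ - _ = - (e - e ^+ 2 / (pos t + e))); last by ring.
have h := pe t; rewrite normrN ger0_norm.
  by rewrite gerBl divr_ge0 ?sqr_ge0 ?ltW.
by rewrite subr_ge0 ler_pdivrMr// expr2 ler_pM2l// lerDr.
Qed.

Let cpos : continuous pos.
Proof.
move=> t; apply/cvgrPdist_le => d d0; near=> s.
apply: le_trans (pos_lip _ _) _; near: s; exact: cvgr_dist_le d0.
Unshelve. all: end_near. Qed.

Lemma continuous_dsmooth_pos : continuous dsmooth_pos.
Proof.
move=> t; rewrite /dsmooth_pos; apply: cvgB; first exact: cvg_cst.
apply: cvgM; first exact: cvg_cst.
apply: cvgV; first by rewrite expf_neq0// gt_eqF// pe.
have h : Num.max s 0 + e @[s --> t] --> Num.max t 0 + e.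
  by apply: cvgD; [exact: cpos|exact: cvg_cst].
by rewrite expr2; under eq_fun do rewrite expr2; exact: cvgM.
Qed.

Lemma is_derive_smooth_pos (t : R) : is_derive t 1 smooth_pos (dsmooth_pos t).
Proof.
suff h : (fun h => h^-1 *: ((smooth_pos \o shift t) (h *: 1) - smooth_pos t)) @ 0^' --> dsmooth_pos t.
  by apply: DeriveDef; [exact: cvgP h|exact: cvg_lim h].
pose M h : R := 1 - e ^+ 2 / ((pos (h + t) + e) * (pos t + e)).
have cM : M h @[h --> 0^'] --> dsmooth_pos t.
  have h1 : pos (h + t) @[h --> 0^'] --> pos t.
    apply: cvg_within_filter; rewrite -{2}[t]add0r.
    apply: (continuous_comp (f := fun h => h + t) (g := pos)); last exact: cpos.
    by apply: cvgD; [exact: cvg_id|exact: cvg_cst].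
  rewrite /dsmooth_pos expr2; apply: cvgB; first exact: cvg_cst.
  apply: cvgM; first exact: cvg_cst.
  apply: cvgV; first by rewrite mulf_neq0// gt_eqF// pe.
  apply: cvgM; last exact: cvg_cst.
  by apply: cvgD => //; exact: cvg_cst.
have qE h : h^-1 *: ((smooth_pos \o shift t) (h *: 1) - smooth_pos t) = h^-1 * (pos (h + t) - pos t) * M h.
  by rewrite /= [h *: 1]mulr1 smooth_posB; exact: mulrA.
under eq_fun do rewrite qE.
(* For t > 0 the difference quotient of the positive part is eventually 1. For t <= 0 it is merely
   bounded by 1, but there the factor [M h] tends to 0. *)
have [t0|t0] := ltP 0 t.
  apply: cvg_trans cM; apply: near_eq_cvg; near=> h.
  have h0 : h != 0 by near: h; exact: nbhs_dnbhs_neq.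
  have ht : `|h| < t.
    by near: h; apply: dnbhs0_lt.
  have ht0 : 0 < h + t by move: ht; rewrite ltr_norml; lra.
  by rewrite /pos (max_idPl (ltW t0)) (max_idPl (ltW ht0)) addrK mulVf// mul1r.
have Dt : dsmooth_pos t = 0.
  by rewrite /dsmooth_pos (max_idPr t0) add0r divff ?subrr// expf_neq0// gt_eqF.
rewrite Dt in cM *; apply/cvgrPdist_le => d d0.
near=> h.
have h0 : h != 0 by near: h; exact: nbhs_dnbhs_neq.
have Mh : `|0 - M h| <= d by near: h; move/cvgrPdist_le : cM; exact.
rewrite sub0r normrN normrM.
apply: le_trans (_ : `|M h| <= d); last by move: Mh; rewrite sub0r normrN.
rewrite ler_piMl// normrM normfV ler_pdivrMl ?normr_gt0// mulr1.
by apply: le_trans (pos_lip _ _) _; rewrite addrK.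
Unshelve. all: end_near. Qed.

End smooth_pos.

(** * C^1 functions and compact supports in the half-space *)

Section C1.
Variables (R : realType) (n : nat).
Local Notation V := 'rV[R]_n.
Implicit Types f g : V -> R.

(** The partial derivatives are explicit witnesses, so that combinations and compositions yield
    theirs by formula. *)
Definition C1w f (df : 'I_n -> V -> R) : Prop :=
  [/\ continuous f, forall i x, is_derive x (delta_mx 0 i) f (df i x) &
      forall i, continuous (df i)].

Definition csupp f : Prop :=
  compact (closure [set x | f x != 0]) /\ closure [set x | f x != 0] `<=` halfspace n.

Lemma C1c_halfP f : C1c_half f <-> (exists df, C1w f df) /\ csupp f.
Proof.
split=> [[cf df cdf K H]|[[df [cf hdf cdf]] [K H]]].
  split=> //; exists (fun i x => 'D_(delta_mx 0 i) f x); split => // i x.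
split => // i.
rewrite (_ : (fun x => _) = df i); first exact: cdf.
by apply/funext => x; exact: (@derive_val _ _ _ _ _ _ _ (hdf i x)).
Qed.

Lemma is_derive_line f (x v : V) d :
  is_derive x v f d <-> is_derive (0 : R) 1 (fun h : R => f (h *: v + x)) d.
Proof.
have E : (fun h : R => h^-1 *: ((f \o shift x) (h *: v) - f x)) =
  (fun h : R => h^-1 *: (((fun h : R => f (h *: v + x)) \o shift 0) (h *: 1) - f (0 *: v + x))).
  by apply/funext => h /=; rewrite addr0 scale0r add0r [h *: 1]mulr1.
split=> -[h1 h2]; apply: DeriveDef.
- by rewrite /derivable -E.
- by rewrite -h2 /derive -E.
- by rewrite /derivable E.
- by rewrite -h2 /derive E.
Qed.

Lemma C1w_comp f df (g dg : R -> R) : C1w f df ->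
  (forall t : R, is_derive t 1 g (dg t)) -> continuous dg ->
  C1w (g \o f) (fun i x => dg (f x) * df i x).
Proof.
move=> [cf hdf cdf] hg cdg; split.
- move=> x; apply: continuous_comp; first exact: cf.
  apply/differentiable_continuous/derivable1_diffP.
  exact: (@ex_derive _ _ _ _ _ _ _ (hg (f x))).
- move=> i x; apply/is_derive_line.
  have h := (is_derive_line f x (delta_mx 0 i) (df i x)).1 (hdf i x).
  apply: (@is_derive1_comp _ g (fun h => f (h *: delta_mx 0 i + x))) => //.
  by rewrite scale0r add0r.
- move=> i x; apply: (@cvgM _ _ _ (nbhs_filter x)); last exact: cdf.
  exact: (cvg_comp _ _ (cf x) (cdg (f x))).
Qed.

Lemma C1w_lin f df g dg (a b : R) : C1w f df -> C1w g dg ->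
  C1w (fun x => a * f x + b * g x) (fun i x => a * df i x + b * dg i x).
Proof.
move=> [cf hdf cdf] [cg hdg cdg]; split.
- by move=> x; apply: (@cvgD _ _ _ _ (nbhs_filter x)); apply: (@cvgMr _ _ _ (nbhs_filter x)); [exact: cf|exact: cg].
- move=> i x; have h1 := hdf i x; have h2 := hdg i x.
  exact: (@is_deriveD _ _ _ (a \*: f) (b \*: g)).
- by move=> i x; apply: (@cvgD _ _ _ _ (nbhs_filter x)); apply: (@cvgMr _ _ _ (nbhs_filter x)); [exact: cdf|exact: cdg].
Qed.

Lemma continuous_aff (c : R) (a : V) : continuous (aff c a).
Proof.
move=> x; apply: (@cvgZr _ _ _ _ (nbhs_filter x)); apply: (@cvgB _ _ _ _ (nbhs_filter x)); [exact: cvg_id|exact: cvg_cst].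
Qed.

Lemma C1w_aff f df (c : R) (a : V) : C1w f df ->
  C1w (fun x => f (aff c a x)) (fun i x => c * df i (aff c a x)).
Proof.
move=> [cf hdf cdf]; split.
- by move=> x; exact: (@continuous_comp _ _ _ (aff c a) f x (@continuous_aff c a x) (cf _)).
- move=> i x; apply/is_derive_line.
  rewrite (_ : (fun h => _) = (fun h => f (h *: delta_mx 0 i + aff c a x)) \o (fun h : R => c * h)); last first.
    by apply/funext => h /=; congr f; rewrite /aff -addrA scalerDr scalerA.
  rewrite mulrC; apply: is_derive1_comp.
    by rewrite mulr0; apply/is_derive_line; exact: hdf.
  have := @is_deriveZ R R^o R^o id c 0 1 1 _.
  by rewrite [c *: 1]mulr1; apply; exact: is_derive_id.
- move=> i x; apply: (@cvgMr _ _ _ (nbhs_filter x)).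
  exact: (@continuous_comp _ _ _ (aff c a) (df i) x (@continuous_aff c a x) (cdf i _)).
Qed.

Lemma csupp_sub f g : csupp f -> (forall x, g x != 0 -> f x != 0) -> csupp g.
Proof.
move=> [K H] gf; have S : closure [set x | g x != 0] `<=` closure [set x | f x != 0].
  exact: closureS.
split; last exact: subset_trans H.
by apply: (subclosed_compact _ K S); exact: closed_closure.
Qed.

Lemma csuppU f g h : csupp f -> csupp g ->
  (forall x, h x != 0 -> f x != 0 \/ g x != 0) -> csupp h.
Proof.
move=> [K H] [K' H'] hfg.
have S : closure [set x | h x != 0] `<=` closure [set x | f x != 0] `|` closure [set x | g x != 0].
  by rewrite -closureU; exact: closureS.
split; last by move=> x /S [/H|/H'].
by apply: (subclosed_compact _ (compactU K K') S); exact: closed_closure.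
Qed.

Lemma csupp_aff f (c : R) (a : V) : (0 < n)%N -> 0 < c -> xlast a = 0 -> csupp f ->
  csupp (fun x => f (aff c a x)).
Proof.
move=> n0 c0 a0 [K H].
have cl : closure [set x | f (aff c a x) != 0] `<=` aff c a @^-1` closure [set x | f x != 0].
  rewrite -[X in closure X]/(aff c a @^-1` [set x | f x != 0]).
  apply: (subset_trans (closureS (preimage_subset (@subset_closure _ _)))).
  rewrite -(iffLR (closure_id _))//.
  by apply: preimage_closed; [move=> x _; exact: continuous_aff|exact: closed_closure].
split.
  have K' : compact ((fun y => c^-1 *: y + a) @` closure [set x | f x != 0]).
    apply: continuous_compact => //; apply: continuous_subspaceT => x.
    by apply: (@cvgD _ _ _ _ (nbhs_filter x)); [apply: (@cvgZr _ _ _ _ (nbhs_filter x)); exact: cvg_id|exact: cvg_cst].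
  apply: (subclosed_compact _ K'); first exact: closed_closure.
  move=> x /cl hx; exists (aff c a x) => //.
  by rewrite /aff scalerA mulVf ?gt_eqF// scale1r subrK.
move=> x /cl/H; rewrite /halfspace /= !(xlastE n0) /aff !mxE.
by move: a0; rewrite (xlastE n0) => ->; rewrite subr0 pmulr_rgt0.
Qed.

End C1.

(** * The space on the half-space *)

Section Hhalf.
Variables (R : realType) (n : nat) (sigma : R).
Hypotheses (n0 : (0 < n)%N) (s0 : 0 < sigma) (sn : 2 * sigma < n%:R).
Local Notation mu := (lam R n).
Local Notation p := (crit n sigma).
Local Notation ker := (@ker R n sigma).
Local Notation J := (J mu ker).
Local Notation LL := (@LL R n sigma).
Local Notation Om := (@halfspace R n).
Local Notation H := (@Hhalf R n sigma).
Implicit Types (u v : 'rV[R]_n -> R) (A : set 'rV[R]_n).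

Let p0 : 0 < p. Proof. by apply: lt_trans (crit_gt2 s0 sn). Qed.
Let mOm : measurable Om. Proof. exact: measurable_halfspace. Qed.
Let mw : measurable_fun setT ker. Proof. exact: measurable_ker. Qed.
Let w0 : forall z, 0 <= ker z. Proof. exact: ker_ge0. Qed.

Lemma LL_ge0 A u : (0 <= LL A u)%E.
Proof. by apply: Int_ge0 => x; nng. Qed.

(** Moves the domain into the function, so that results on the whole space, such as Brezis-Lieb,
    apply to the half-space. *)
Lemma LLE A u : LL A u = Int mu (fun x => `|\1_A x * u x| `^ p).
Proof.
congr Int; apply/funext => x; rewrite indicE; case: (_ \in _) => /=; first by rewrite !mul1r.
by rewrite !mul0r normr0 powR0 ?gt_eqF.
Qed.

Lemma le_LL A u v : measurable A -> measurable_fun setT u -> measurable_fun setT v ->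
  (forall x, A x -> `|u x| <= `|v x|) -> (LL A u <= LL A v)%E.
Proof.
move=> mA mu' mv uv; have mI : measurable_fun setT (\1_A : _ -> R) by exact: measurable_indic.
apply: le_Int; side; move=> x; rewrite indicE; have [Ax|] := boolP (x \in A); last by rewrite !mul0r.
by rewrite !mul1r powR_le_mono// uv// -in_setE.
Qed.

Lemma LL_lin A u v (a b : R) : measurable A -> measurable_fun setT u -> measurable_fun setT v ->
  (LL A (fun x => a * u x + b * v x)%R <=
     (2 `^ p * `|a| `^ p)%:E * LL A u + (2 `^ p * `|b| `^ p)%:E * LL A v)%E.
Proof.
move=> mA mu' mv; have mI : measurable_fun setT (\1_A : _ -> R) by exact: measurable_indic.
rewrite -!IntZ; side; try by rewrite mulr_ge0 ?powR_ge0.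
rewrite -IntD; side; try by move=> x; rewrite !mulr_ge0 ?powR_ge0 ?indic_nneg.
apply: le_Int; side; move=> x.
rewrite !(mulrCA _ (\1_A x)) -mulrDr; apply: ler_wpM2l; first exact: indic_nneg.
rewrite -!mulrA -mulrDr -!powRM// -!normrM; exact: powR_normD_le.
Qed.

Lemma J_lin A u v (a b : R) : measurable A -> measurable_fun setT u -> measurable_fun setT v ->
  (J A (fun x => a * u x + b * v x)%R <= (2 * a ^+ 2)%:E * J A u + (2 * b ^+ 2)%:E * J A v)%E.
Proof.
move=> mA mu' mv; apply: le_J2 => //; do ?by rewrite mulr_ge0 ?sqr_ge0.
  by meas.
move=> x y _ _; have := sqr_ge0 (a * (u x - u y) - b * (v x - v y)).
rewrite (_ : a * u x + b * v x - _ = a * (u x - u y) + b * (v x - v y)); last by ring.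
set s := u x - u y; set t := v x - v y; nra.
Qed.

Lemma C1c_measurable u : C1c_half u -> measurable_fun setT u.
Proof. by case=> cu _ _ _ _; exact: continuous_measurable. Qed.

Lemma C1c_LL u : C1c_half u -> (LL Om u < +oo)%E.
Proof.
move=> hu; have mu' := C1c_measurable hu.
have mI : measurable_fun setT (\1_Om : _ -> R) by exact: measurable_indic.
case: hu => cu _ _ K _; set S := closure _ in K.
have [M [Mr hM]] := compact_bounded K.
have [N [Nr hN]] := compact_bounded (continuous_compact (continuous_subspaceT cu) K).
pose m := `|M| + 1; pose k := `|N| + 1.
pose Q : set 'rV[R]_n := cube (const_mx (- m)) (2 * m + 1).
have mQ : measurable Q by exact: measurable_cube.
have mIQ : measurable_fun setT (\1_Q : _ -> R) by exact: measurable_indic.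
have m0 : 0 <= m by rewrite addr_ge0.
have SQ x : S x -> Q x.
  move=> Sx i; have := hM m _ x Sx; rewrite mxE => /(_ _)/wrap[].
    by apply: le_lt_trans (ler_norm _) _; rewrite ltrDl.
  have h2 : `|x 0 i| <= `|x|.
    rewrite [leRHS](mx_normrE x : `|x| = _); exact: (le_bigmax _ (fun j : 'I_1 * 'I_n => `|x j.1 j.2|) (0, i)).
  by move=> h1; have := le_trans h2 h1; rewrite ler_norml; lra.
apply: (@le_lt_trans _ _ (Int mu (fun x => k `^ p * \1_Q x))); last first.
  rewrite IntZ; side.
  by rewrite Int_cube; [rewrite -EFinM ltry|lra].
apply: le_Int; side => x.
have [fx|fx] := eqVneq (u x) 0.
  by rewrite fx normr0 powR0 ?gt_eqF// mulr0; nng.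
have Sx : S x by exact: subset_closure.
rewrite [\1_Q x]indicE [x \in Q]mem_set ?mulr1; last exact: SQ.
apply: (@le_trans _ _ (`|u x| `^ p)).
  by rewrite ler_piMl ?powR_ge0// indicE; case: (_ \in _).
apply: powR_le_mono => //; apply: hN; last by exists x.
by apply: le_lt_trans (ler_norm _) _; rewrite ltrDl.
Qed.

(** Closure of a class in energy and L^p on the half-space. The class is a parameter because shifted
    functions are approximated by C^1 functions with no condition on the support, and because
    closures are iterated in [approximable_idem]. *)
Definition approximable (P : ('rV[R]_n -> R) -> Prop) u : Prop := measurable_fun setT u /\ forall e : R, 0 < e -> exists f, [/\ P f, (J Om (fun x => u x - f x)%R <= e%:E)%E &
    (LL Om (fun x => u x - f x)%R <= e%:E)%E].

Lemma HhalfP u : H u <-> approximable (@C1c_half R n) u.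
Proof.
split=> [[/BmeasP mu' [phi [hphi]]]|[mu' hu]].
  have mphi k : measurable_fun setT (u \- phi k).
    by apply: measurable_funB => //; exact: C1c_measurable.
  rewrite (_ : (fun j => Igag _ _ _) = (fun j => J Om (u \- phi j))); last first.
    by apply/funext => j; rewrite IgagE.
  rewrite (_ : (fun j => Lpint _ _ _) = (fun j => LL Om (u \- phi j))); last first.
    by apply/funext => j; rewrite LpintE.
  move=> J0 L0; split => // e e0.
  have hJ := (cvge0P (fun k => J_ge0 mu ker Om (u \- phi k))).1 J0 e e0.
  have hL := (cvge0P (fun k => LL_ge0 Om (u \- phi k))).1 L0 e e0.
  by have [k [h1 h2]] := filter_ex (filterI hJ hL); exists (phi k).
split; first exact/BmeasP.
have e_gt0 (k : nat) : (0 : R) < k.+1%:R^-1 by rewrite invr_gt0.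
pose phi k := projT1 (cid (hu _ (e_gt0 k))).
have phiP k : [/\ C1c_half (phi k), (J Om (fun x => u x - phi k x)%R <= (k.+1%:R^-1)%:E)%E &
    (LL Om (fun x => u x - phi k x)%R <= (k.+1%:R^-1)%:E)%E].
  exact: projT2 (cid (hu _ (e_gt0 k))).
have mphi k : measurable_fun setT (u \- phi k).
  by apply: measurable_funB => //; apply: C1c_measurable; have [] := phiP k.
exists phi; split.
- by move=> k; have [] := phiP k.
- under eq_fun do rewrite IgagE//.
  apply/(cvge0P (fun k => J_ge0 mu ker Om (u \- phi k))) => e e0.
  near=> k; have [_ h _] := phiP k; apply: le_trans h _; rewrite lee_fin.
  by apply/ltW; near: k; exact: near_infty_natSinv_lt (PosNum e0).
- under eq_fun do rewrite LpintE//.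
  apply/(cvge0P (fun k => LL_ge0 Om (u \- phi k))) => e e0.
  near=> k; have [_ _ h] := phiP k; apply: le_trans h _; rewrite lee_fin.
  by apply/ltW; near: k; exact: near_infty_natSinv_lt (PosNum e0).
Unshelve. all: end_near. Qed.

Lemma Hhalf_measurable u : H u -> measurable_fun setT u.
Proof. by case=> /BmeasP. Qed.

Lemma lin_small (a b : R) (c : R) : 0 <= a -> 0 <= b -> 0 < c ->
  exists2 d, 0 < d & forall X Y : \bar R, (X <= d%:E)%E -> (Y <= d%:E)%E ->
    (a%:E * X + b%:E * Y <= c%:E)%E.
Proof.
move=> a0 b0 c0; have ab : 0 < a + b + 1 by rewrite ltr_wpDl ?addr_ge0.
exists (c / (a + b + 1)); first by rewrite divr_gt0.
move=> X Y hX hY; apply: (@le_trans _ _ ((a * (c / (a + b + 1)) + b * (c / (a + b + 1)))%:E)).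
  by rewrite EFinD (EFinM a) (EFinM b) leeD// lee_wpmul2l// lee_fin.
rewrite lee_fin -mulrDl mulrCA ler_piMr ?(ltW c0)// ler_pdivrMr// mul1r; lra.
Qed.

Lemma approximable_lin P Q u v (a b : R) :
  (forall f, P f -> measurable_fun setT f) -> (forall f, Q f -> measurable_fun setT f) ->
  approximable P u -> approximable Q v ->
  approximable (fun h => exists f g, [/\ P f, Q g & h = (fun x => a * f x + b * g x)])
    (fun x => a * u x + b * v x).
Proof.
move=> mP mQ [mu' hu] [mv hv]; split; first by meas.
move=> e e0.
have [d1 d10 h1] := @lin_small (2 * a ^+ 2) (2 * b ^+ 2) e ltac:(by rewrite mulr_ge0 ?sqr_ge0) ltac:(by rewrite mulr_ge0 ?sqr_ge0) e0.
have [d2 d20 h2] := @lin_small (2 `^ p * `|a| `^ p) (2 `^ p * `|b| `^ p) e ltac:(by rewrite mulr_ge0 ?powR_ge0) ltac:(by rewrite mulr_ge0 ?powR_ge0) e0.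
have d0 : 0 < Num.min d1 d2 by rewrite lt_min d10.
have [f [Pf Jf Lf]] := hu _ d0; have [g [Qg Jg Lg]] := hv _ d0.
exists (fun x => a * f x + b * g x); split; first by exists f, g.
  rewrite (_ : (fun x => _) = (fun x => a * (u x - f x) + b * (v x - g x))); last first.
    by apply/funext => x; ring.
  have mf := mP _ Pf; have mg := mQ _ Qg.
  apply: (le_trans (J_lin a b mOm (measurable_funB mu' mf) (measurable_funB mv mg))).
  by apply: h1; [apply: (le_trans Jf)|apply: (le_trans Jg)]; rewrite lee_fin ge_min lexx.
rewrite (_ : (fun x => _) = (fun x => a * (u x - f x) + b * (v x - g x))); last first.
  by apply/funext => x; ring.
have mf := mP _ Pf; have mg := mQ _ Qg.
apply: (le_trans (LL_lin a b mOm (measurable_funB mu' mf) (measurable_funB mv mg))).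
by apply: h2; [apply: (le_trans Lf)|apply: (le_trans Lg)]; rewrite lee_fin ge_min lexx orbT.
Qed.

Lemma approximable_sub (P Q : ('rV[R]_n -> R) -> Prop) u : (forall f, P f -> Q f) ->
  approximable P u -> approximable Q u.
Proof.
by move=> PQ [mu' hu]; split => // e /hu[f [/PQ Qf Jf Lf]]; exists f.
Qed.

Lemma Hhalf_lin u v (a b : R) : H u -> H v -> H (fun x => a * u x + b * v x).
Proof.
move=> /HhalfP hu /HhalfP hv; apply/HhalfP.
apply: approximable_sub (approximable_lin a b (@C1c_measurable) (@C1c_measurable) hu hv).
move=> _ [f [g [/C1c_halfP[[df hf] sf] /C1c_halfP[[dg hg] sg] ->]]]; apply/C1c_halfP.
split; first by eexists; exact: (C1w_lin a b hf hg).
apply: (csuppU sf sg) => x; case: (eqVneq (f x) 0) => [->|]; last by left.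
by case: (eqVneq (g x) 0) => [->|]; [rewrite !mulr0 addr0 eqxx|right].
Qed.

Lemma approximable_idem P u : (forall f, P f -> measurable_fun setT f) ->
  approximable (approximable P) u -> approximable P u.
Proof.
move=> mP [mu' hu]; split => // e e0.
have [d1 d10 h1] := @lin_small (2 * 1 ^+ 2) (2 * 1 ^+ 2) e ltac:(lra) ltac:(lra) e0.
have [d2 d20 h2] := @lin_small (2 `^ p * `|1| `^ p) (2 `^ p * `|1| `^ p) e ltac:(by rewrite mulr_ge0 ?powR_ge0) ltac:(by rewrite mulr_ge0 ?powR_ge0) e0.
have d0 : 0 < Num.min d1 d2 by rewrite lt_min d10.
have [f [[mf hf] Jf Lf]] := hu _ d0; have [g [Pg Jg Lg]] := hf _ d0.
have mg := mP _ Pg.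
have E : (fun x => u x - g x) = (fun x => 1 * (u x - f x) + 1 * (f x - g x)).
  by apply/funext => x; ring.
exists g; split => //; rewrite E.
  apply: (le_trans (J_lin 1 1 mOm (measurable_funB mu' mf) (measurable_funB mf mg))).
  by apply: h1; [apply: (le_trans Jf)|apply: (le_trans Jg)]; rewrite lee_fin ge_min lexx.
apply: (le_trans (LL_lin 1 1 mOm (measurable_funB mu' mf) (measurable_funB mf mg))).
by apply: h2; [apply: (le_trans Lf)|apply: (le_trans Lg)]; rewrite lee_fin ge_min lexx orbT.
Qed.

Lemma Hhalf_closed u : approximable H u -> H u.
Proof.
move=> hu; apply/HhalfP; apply: approximable_idem; first exact: C1c_measurable.
by apply: approximable_sub hu => f /HhalfP.
Qed.

Lemma Hhalf_LL u : H u -> (LL Om u < +oo)%E.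
Proof.
move=> /HhalfP[mu' /(_ 1 ltr01)[f [Cf _ L1]]]; have mf := C1c_measurable Cf.
rewrite (_ : u = (fun x => 1 * (u x - f x) + 1 * f x)); last by apply/funext => x; ring.
apply: le_lt_trans (LL_lin 1 1 mOm (measurable_funB mu' mf) mf) _.
rewrite lte_add_pinfty// lte_mul_pinfty ?lee_fin ?mulr_ge0 ?powR_ge0//.
  by apply: le_lt_trans L1 _; rewrite ltry.
exact: C1c_LL.
Qed.

Lemma rescale_halfspace (c : R) (a : 'rV[R]_n) : 0 < c -> xlast a = 0 ->
  aff c a @^-1` Om = Om.
Proof.
move=> c0 a0; apply/seteqP; split => x; rewrite /halfspace /= !(xlastE n0) /aff !mxE.
  by move: a0; rewrite (xlastE n0) => ->; rewrite subr0 pmulr_rgt0.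
by move: a0; rewrite (xlastE n0) => ->; rewrite subr0 pmulr_rgt0.
Qed.

Lemma Hhalf_rescale u (c : R) (a : 'rV[R]_n) : 0 < c -> xlast a = 0 ->
  H u -> H (rescale sigma c a u).
Proof.
move=> c0 a0 /HhalfP[mu' hu]; apply/HhalfP; split; first exact: measurable_rescale.
move=> e /hu[f [/[dup] /C1c_measurable mf /C1c_halfP[[df hf] sf] Jf Lf]].
exists (rescale sigma c a f).
have E : (fun x => rescale sigma c a u x - rescale sigma c a f x) =
    rescale sigma c a (fun x => u x - f x).
  by apply/funext => x; rewrite /rescale mulrBr.
have mB : measurable_fun setT (fun x => u x - f x) by exact: measurable_funB.
split; last first.
- by rewrite E -(rescale_halfspace c0 a0) LL_rescale.
- by rewrite E -(rescale_halfspace c0 a0) J_rescale.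
apply/C1c_halfP; split.
  eexists; have := C1w_lin (c `^ ((n%:R - 2 * sigma) / 2)) 0 (C1w_aff c a hf) (C1w_aff c a hf).
  congr C1w; apply/funext => x; rewrite mul0r addr0; reflexivity.
apply: (csupp_sub (csupp_aff n0 c0 a0 sf)) => x; apply: contra_neq.
by rewrite /rescale -/(aff c a x) => ->; rewrite mulr0.
Qed.

End Hhalf.

Section truncation.
Variables (R : realType) (e : R).
Hypothesis e0 : 0 < e.

Lemma max0E (t : R) : Num.max t 0 = 2^-1 * (t + `|t|).
Proof.
by have [t0|t0] := leP t 0; [rewrite ler0_norm//|rewrite gtr0_norm//]; lra.
Qed.

Definition smooth_abs (t : R) := smooth_pos e t + smooth_pos e (- t).

Lemma smooth_abs_lip a b : `|smooth_abs a - smooth_abs b| <= 2 * `|a - b|.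
Proof.
have h0 := e0; have h1 := smooth_pos_lip h0 a b; have h2 := smooth_pos_lip h0 (- a) (- b).
rewrite /smooth_abs (_ : _ - _ = (smooth_pos e a - smooth_pos e b) + (smooth_pos e (- a) - smooth_pos e (- b))); last by ring.
apply: le_trans (ler_normD _ _) _; move: h2; rewrite -opprD normrN; lra.
Qed.

Lemma smooth_abs_near t : `|smooth_abs t - `|t| | <= 2 * e.
Proof.
have h0 := e0; have h1 := smooth_pos_pos h0 t; have h2 := smooth_pos_pos h0 (- t).
have -> : `|t| = Num.max t 0 + Num.max (- t) 0.
  by rewrite !max0E normrN; lra.
rewrite /smooth_abs (_ : _ - _ = (smooth_pos e t - Num.max t 0) + (smooth_pos e (- t) - Num.max (- t) 0)); last by ring.
by apply: le_trans (ler_normD _ _) _; lra.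
Qed.

Lemma smooth_abs0 : smooth_abs 0 = 0.
Proof. by rewrite /smooth_abs oppr0 smooth_pos_le0 ?addr0. Qed.

Lemma smooth_abs_ge0 t : 0 <= smooth_abs t.
Proof. by rewrite addr_ge0 ?smooth_pos_ge0. Qed.

(** A smooth version of (|a| - |b|)^+. It vanishes at a = 0 whatever b is, so a composition keeps
    the support of the first function and asks nothing of the second. *)
Definition smooth_trunc (a b : R) := smooth_pos e (smooth_abs a - smooth_abs b).

Lemma max0_lip (s t : R) : `|Num.max s 0 - Num.max t 0| <= `|s - t|.
Proof.
rewrite !max0E (_ : _ - _ = 2^-1 * (s - t) + 2^-1 * (`|s| - `|t|)); last by ring.
have := ler_dist_dist s t => h; apply: le_trans (ler_normD _ _) _.
rewrite !normrM !(@ger0_norm _ 2^-1)//; lra.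
Qed.

Lemma smooth_trunc_near a b : `|smooth_trunc a b - Num.max (`|a| - `|b|) 0| <= 5 * e.
Proof.
have h0 := e0; have h1 := smooth_pos_pos h0 (smooth_abs a - smooth_abs b).
have h2 := max0_lip (smooth_abs a - smooth_abs b) (`|a| - `|b|).
have h3 := smooth_abs_near a; have h4 := smooth_abs_near b.
move: h1 h2; rewrite -/(smooth_trunc a b).
set X := Num.max (smooth_abs a - _) 0; set Y := Num.max (`|a| - _) 0 => h1 h2.
have h5 : `|smooth_abs a - smooth_abs b - (`|a| - `|b|)| <= 4 * e.
  move: h3 h4; rewrite !ler_norml; lra.
move: h1 (le_trans h2 h5); rewrite !ler_norml; lra.
Qed.

(** The outer function is 1-Lipschitz and the inner ones are 2-Lipschitz, whatever e is; the energy
    bounds are therefore uniform as e tends to 0. *)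
Lemma smooth_trunc_lip a b a' b' :
  (smooth_trunc a b - smooth_trunc a' b') ^+ 2 <= 8 * (a - a') ^+ 2 + 8 * (b - b') ^+ 2.
Proof.
have h0 := e0; have := smooth_pos_lip h0 (smooth_abs a - smooth_abs b) (smooth_abs a' - smooth_abs b').
have := smooth_abs_lip a a'; have := smooth_abs_lip b b'.
rewrite -/(smooth_trunc a b) -/(smooth_trunc a' b') => h1 h2 h3.
have h4 : `|smooth_trunc a b - smooth_trunc a' b'| <= 2 * (`|a - a'| + `|b - b'|).
  apply: le_trans h3 _.
  rewrite (_ : _ - _ = (smooth_abs a - smooth_abs a') - (smooth_abs b - smooth_abs b')); last by ring.
  by apply: le_trans (ler_normB _ _) _; lra.
rewrite -[X in X <= _](real_normK (num_real _)) -[X in 8 * X + _](real_normK (num_real _)).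
rewrite -[X in _ + 8 * X](real_normK (num_real _)).
have := normr_ge0 (smooth_trunc a b - smooth_trunc a' b'); move: h4.
set X := `|smooth_trunc _ _ - _|; set Y := `|a - a'|; set Z := `|b - b'| => h4 X0.
have : X ^+ 2 <= (2 * (Y + Z)) ^+ 2 by rewrite ler_pXn2r ?nnegrE//; apply: le_trans h4.
have := sqr_ge0 (Y - Z); nra.
Qed.

Lemma smooth_trunc_eq0 b : smooth_trunc 0 b = 0.
Proof. by rewrite /smooth_trunc smooth_abs0 smooth_pos_le0// sub0r oppr_le0 smooth_abs_ge0. Qed.

Lemma C1w_smooth_abs n (f : 'rV[R]_n -> R) df : C1w f df -> exists dg, C1w (smooth_abs \o f) dg.
Proof.
have h0 := e0 => hf; have hN := C1w_lin (-1) 0 hf hf.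
have h1 := C1w_comp hf (is_derive_smooth_pos h0) (continuous_dsmooth_pos h0).
have h2 := C1w_comp hN (is_derive_smooth_pos h0) (continuous_dsmooth_pos h0).
eexists; have := C1w_lin 1 1 h1 h2.
congr C1w; first by apply/funext => x /=; rewrite /smooth_abs !mul1r mul0r addr0 mulN1r.
Qed.

Lemma C1w_smooth_trunc n (f g : 'rV[R]_n -> R) df dg : C1w f df -> C1w g dg ->
  exists dh, C1w (fun x => smooth_trunc (f x) (g x)) dh.
Proof.
have h0 := e0 => /C1w_smooth_abs[df' hf] /C1w_smooth_abs[dg' hg].
have h1 := C1w_comp (C1w_lin 1 (-1) hf hg) (is_derive_smooth_pos h0) (continuous_dsmooth_pos h0).
eexists; move: h1; congr C1w; first by apply/funext => x /=; rewrite mul1r mulN1r.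
Qed.

End truncation.

Lemma J_0 d (T : measurableType d) (R : realType) (mu : {sigma_finite_measure set T -> \bar R})
  (w : T * T -> R) A : J mu w A (fun=> 0) = 0%E.
Proof. by apply: integral0_eq => z _; rewrite /dq subrr mulr0 mul0r expr0n. Qed.

(** * Stability of the half-space functions under limits and truncation *)

Section weak.
Variables (R : realType) (n : nat) (sigma : R).
Hypotheses (n0 : (0 < n)%N) (s0 : 0 < sigma) (sn : 2 * sigma < n%:R).
Local Notation mu := (lam R n).
Local Notation p := (crit n sigma).
Local Notation ker := (@ker R n sigma).
Local Notation J := (J mu ker).
Local Notation LL := (@LL R n sigma).
Local Notation Om := (@halfspace R n).
Local Notation H := (@Hhalf R n sigma).
Implicit Types (u v : 'rV[R]_n -> R) (A : set 'rV[R]_n).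

Let p0 : 0 < p. Proof. by apply: lt_trans (crit_gt2 s0 sn). Qed.
Let mOm : measurable Om. Proof. exact: measurable_halfspace. Qed.
Let mw : measurable_fun setT ker. Proof. exact: measurable_ker. Qed.
Let w0 : forall z, 0 <= ker z. Proof. exact: ker_ge0. Qed.

Lemma Csob_ge0 : 0 <= Csob n sigma.
Proof. by rewrite /Csob mulr_ge0 ?powR_ge0. Qed.

Lemma sobolev_le A u (C : R) : measurable A ->
  (forall x l, A x -> 0 < l -> cube x l `<=` A) -> measurable_fun setT u ->
  (J A u <= C%:E)%E -> (LL A u < +oo)%E -> (LL A u <= ((Csob n sigma * C) `^ (p / 2))%:E)%E.
Proof.
move=> mA Acube mu' JC Lfin; have [j Jj /andP[j0 jC]] := ge0_le_fin (J_ge0 _ _ _ _) JC.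
have LE : LL A u = (fine (LL A u))%:E by rewrite fineK// ge0_fin_numE ?LL_ge0.
have := sobolev s0 sn mA Acube mu' LE Jj => h.
have L0 : 0 <= fine (LL A u) by rewrite fine_ge0 ?LL_ge0.
rewrite LE lee_fin -[leLHS](@powRVK _ (p / 2))// ?(invf_div p 2); last by rewrite divr_gt0.
apply: powR_le_mono; [by rewrite divr_gt0|exact: powR_ge0|].
exact: (le_trans h (ler_wpM2l Csob_ge0 jC)).
Qed.

(** Fatou bounds the energy and the L^p norm of v. Then [weak_closure] approximates v by members of
    the space in energy alone; Sobolev, applied to the difference, turns this into approximation in
    L^p, and the space is closed. *)
Lemma Hhalf_weak (g : nat -> 'rV[R]_n -> R) v (C : R) :
  (forall k, H (g k)) -> (forall k, (J Om (g k) <= C%:E)%E) -> measurable_fun setT v ->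
  {ae mu, forall x, Om x -> g ^~ x @ \oo --> v x} -> H v /\ (J Om v <= C%:E)%E.
Proof.
move=> Hg gC mv gv; have mI : measurable_fun setT (\1_Om : _ -> R) by exact: measurable_indic.
have mg k : measurable_fun setT (g k) by apply: Hhalf_measurable (Hg k).
have cubeOm := @halfspace_cube R n n0.
have Jv : (J Om v <= C%:E)%E.
  apply: (J_lim_le mw (fun=> mOm) mOm mg mv _ gC).
  apply: filterS gv => x gvx; have [Ax|nAx] := pselect (Om x).
    by left; split => //; split; [exact: nearW|exact: gvx].
  by right; split => //; exact: nearW.
have Lg k : (LL Om (g k) <= ((Csob n sigma * C) `^ (p / 2))%:E)%E.
  by apply: (sobolev_le mOm cubeOm (mg k) (gC k)); apply: Hhalf_LL.
have Lv : (LL Om v <= ((Csob n sigma * C) `^ (p / 2))%:E)%E.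
  rewrite LLE//; apply: (@Int_powR_lim_le _ _ _ mu p p0 (fun k x => \1_Om x * g k x)).
  - by move=> k; meas.
  - by meas.
  - apply: filterS gv => x; rewrite indicE; case: (boolP (x \in Om)) => [/set_mem Ox|_] h /=.
      by under eq_fun do rewrite mul1r; rewrite mul1r; exact: h.
    by under eq_fun do rewrite mul0r; rewrite mul0r; exact: cvg_cst.
  - by move=> k; rewrite -LLE.
split => //; apply: Hhalf_closed => //; split => // e e0.
(* Chosen so that the Sobolev bound (Csob d)^(p/2) is at most e. *)
pose d := Num.min e (e `^ (2 / p) / (Csob n sigma + 1)).
have c1 : 0 < Csob n sigma + 1 by have := Csob_ge0; lra.
have d0 : 0 < d by rewrite lt_min e0 divr_gt0 ?powR_gt0.
have [|f Hf Jf] := weak_closure mw w0 mOm (@Hhalf_measurable _ _ _) _ mv Hg gC gv d0.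
  by move=> u1 u2 t _ h1 h2; exact: Hhalf_lin.
have mf := Hhalf_measurable Hf.
exists f; split => //; first by apply: le_trans Jf _; rewrite lee_fin ge_min lexx.
apply: le_trans (sobolev_le mOm cubeOm (measurable_funB mv mf) Jf _) _.
  rewrite [X in LL _ X](_ : _ = (fun x => 1 * v x + (-1) * f x)); last by apply/funext => x /=; ring.
  apply: le_lt_trans (LL_lin s0 sn 1 (-1) mOm mv mf) _.
  rewrite lte_add_pinfty// lte_mul_pinfty ?lee_fin ?mulr_ge0 ?powR_ge0//.
    by apply: le_lt_trans Lv _; rewrite ltry.
  by apply: Hhalf_LL.
rewrite lee_fin -[leRHS](@powRVK _ (p / 2)) ?(ltW e0)// ?(invf_div p 2); last by rewrite divr_gt0.
apply: powR_le_mono; first by rewrite divr_gt0.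
  by rewrite mulr_ge0 ?Csob_ge0// ltW.
apply: (@le_trans _ _ (Csob n sigma * (e `^ (2 / p) / (Csob n sigma + 1)))).
  by apply: ler_wpM2l; [exact: Csob_ge0|rewrite ge_min lexx orbT].
rewrite mulrCA ler_piMr ?powR_ge0// ler_pdivrMr// mul1r; lra.
Qed.

(** Approximation at the rate 4^-k in L^p leaves the weighted errors 2^k |u - f_k|^p with summable
    integrals, so that they are bounded at almost every point. *)
Lemma approximable_ae P u (C : R) : (forall f, P f -> measurable_fun setT f) ->
  approximable sigma P u -> (J Om u <= C%:E)%E -> exists f : nat -> 'rV[R]_n -> R,
  [/\ forall j, P (f j), forall j, (J Om (f j) <= (2 * C + 2)%:E)%E &
   {ae mu, forall x, Om x -> f ^~ x @ \oo --> u x}].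
Proof.
move=> mP [mu' hu] JC; have mI : measurable_fun setT (\1_Om : _ -> R) by exact: measurable_indic.
have e_gt0 (k : nat) : (0 : R) < 4^-1 ^+ k by rewrite exprn_gt0.
pose f k := projT1 (cid (hu _ (e_gt0 k))).
have fP k : [/\ P (f k), (J Om (fun x => u x - f k x)%R <= (4^-1 ^+ k)%:E)%E &
    (LL Om (fun x => u x - f k x)%R <= (4^-1 ^+ k)%:E)%E].
  exact: projT2 (cid (hu _ (e_gt0 k))).
have mf k : measurable_fun setT (f k) by apply: mP; have [] := fP k.
exists f; split.
- by move=> j; have [] := fP j.
- move=> j; have [_ hj _] := fP j.
  rewrite (_ : f j = (fun x => u x - (u x - f j x))); last by apply/funext => x; ring.
  apply: le_trans (J_le_2D mu mw w0 mOm mu' (measurable_funB mu' (mf j))) _.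
  rewrite (_ : (2 * C + 2)%:E = (2%:E * C%:E + 2%:E * 1%:E)%E) ?leeD ?lee_wpmul2l ?lee_fin//; last first.
    by rewrite -!EFinM -EFinD mulr1.
  by apply: le_trans hj _; rewrite lee_fin exprn_ile1//; lra.
- have mD j : measurable_fun setT (fun x => u x - f j x) by exact: measurable_funB.
  have := @ae_bounded _ _ _ mu (fun j x => 2 ^+ j * (\1_Om x * `|u x - f j x| `^ p)).
  case/(_ _ _ _)/wrap.
  - by move=> j; have := mD j => mDj; meas.
  - by move=> j x; rewrite !mulr_ge0 ?exprn_ge0 ?powR_ge0 ?indic_nneg.
  - move=> j; have := mD j => mDj; rewrite IntZ ?exprn_ge0//; side.
    have [_ _ hj] := fP j; apply: (@le_trans _ _ ((2 ^+ j)%:E * (4^-1 ^+ j)%:E)%E).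
      by apply: lee_wpmul2l; rewrite ?lee_fin ?exprn_ge0.
    by rewrite -EFinM lee_fin -exprMn (_ : 2 * 4^-1 = 2^-1)//; lra.
  apply: filterS => x [K hK] Ox; apply/cvgrPdist_le => e e0.
  have ep : 0 < e `^ p by rewrite powR_gt0.
  have h0 : (fun j => K * 2^-1 ^+ j : R) @ \oo --> 0.
    rewrite -(mulr0 K); apply: cvgMr; apply: cvg_expr.
    by rewrite ger0_norm ?invr_ge0// invf_lt1// ltr1n.
  move/cvgrPdist_le : h0 => /(_ _ ep); apply: filterS => j.
  rewrite sub0r normrN => hj; rewrite leNgt; apply/negP => lt_e.
  have := gt0_ltr_powR p0 (_ : e \in Num.nneg) (_ : `|u x - f j x| \in Num.nneg) lt_e.
  rewrite !nnegrE (ltW e0) normr_ge0 => /(_ isT isT) h1.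
  have := hK j; rewrite indicE mem_set// mul1r => h2.
  have : `|u x - f j x| `^ p <= K * 2^-1 ^+ j.
    by rewrite exprVn ler_pdivlMr ?exprn_gt0// mulrC.
  by move/(lt_le_trans h1)/lt_le_trans => /(_ _ (ler_norm _))/lt_le_trans => /(_ _ hj); rewrite ltxx.
Qed.

Lemma LL_subset A B u : measurable A -> measurable B -> measurable_fun setT u ->
  A `<=` B -> (LL A u <= LL B u)%E.
Proof.
move=> mA mB mu' AB; have mIA : measurable_fun setT (\1_A : _ -> R) by exact: measurable_indic.
have mIB : measurable_fun setT (\1_B : _ -> R) by exact: measurable_indic.
apply: le_Int; side; move=> x; apply: ler_wpM2r; first exact: powR_ge0.
rewrite !indicE; case: (boolP (x \in A)) => [/set_mem/AB Bx|//].
by rewrite mem_set.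
Qed.

Lemma rescale1 u (a : 'rV[R]_n) : rescale sigma 1 a u = (fun x => u (aff 1 a x)).
Proof. by apply/funext => x; rewrite /rescale powR1 mul1r. Qed.

Lemma LL_aff1 A u a : measurable A -> measurable_fun setT u ->
  LL (aff 1 a @^-1` A) (fun x => u (aff 1 a x)) = LL A u.
Proof. by move=> mA mu'; rewrite -rescale1 LL_rescale. Qed.

Lemma J_aff1 A u a : measurable A -> measurable_fun setT u ->
  J (aff 1 a @^-1` A) (fun x => u (aff 1 a x)) = J A u.
Proof. by move=> mA mu'; rewrite -rescale1 J_rescale. Qed.

Lemma halfspace_aff1 (a : 'rV[R]_n) : xlast a <= 0 -> Om `<=` aff 1 a @^-1` Om.
Proof.
rewrite (xlastE n0) => a0 x; rewrite /halfspace /= !(xlastE n0) /aff !mxE; lra.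
Qed.

(** Such a shift moves the function towards the boundary and part of it out of the half-space, so
    the energy that remains can only decrease. *)
Lemma J_shift u a : xlast a <= 0 -> measurable_fun setT u ->
  (J Om (fun x => u (aff 1 a x)) <= J Om u)%E.
Proof.
move=> a0 mu'; rewrite -[leRHS](J_aff1 a)//.
have mT : measurable (aff 1 a @^-1` Om) by exact: measurable_preimage_aff.
have mua : measurable_fun setT (fun x => u (aff 1 a x)) by exact: measurable_aff_comp.
by apply: le_J => //; exact: halfspace_aff1.
Qed.

Lemma LL_shift u a : xlast a <= 0 -> measurable_fun setT u ->
  (LL Om (fun x => u (aff 1 a x)) <= LL Om u)%E.
Proof.
move=> a0 mu'; rewrite -[leRHS](LL_aff1 a)//.
have mT : measurable (aff 1 a @^-1` Om) by exact: measurable_preimage_aff.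
have mua : measurable_fun setT (fun x => u (aff 1 a x)) by exact: measurable_aff_comp.
by apply: LL_subset => //; exact: halfspace_aff1.
Qed.

Lemma C1c_Hhalf u : C1c_half u -> H u.
Proof.
move=> Cu; apply/HhalfP => //; split; first exact: C1c_measurable.
move=> e e0; exists u; rewrite (_ : (fun x => u x - u x) = fun=> 0); last first.
  by apply/funext => x; rewrite subrr.
split => //; first by rewrite J_0 lee_fin ltW.
rewrite (_ : LL _ _ = 0%E) ?lee_fin ?(ltW e0)//.
by apply: integral0_eq => x _; rewrite normr0 powR0 ?mulr0// gt_eqF.
Qed.

(** The shifted h need not lie in the space, as its support may reach the boundary. Truncating
    approximants of u by shifted approximants of h keeps the compact support of the former; the
    results have bounded energy and converge almost everywhere, so [Hhalf_weak] applies. *)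
Lemma Hhalf_trunc u h a (C : R) : H u -> H h -> (J Om u <= C%:E)%E -> (J Om h <= C%:E)%E ->
  xlast a <= 0 -> H (fun x => Num.max (`|u x| - `|h (aff 1 a x)|) 0).
Proof.
move=> Hu Hh JuC JhC a0; have mu' := Hhalf_measurable Hu; have mh := Hhalf_measurable Hh.
have apx v : H v <-> approximable sigma (@C1c_half R n) v by exact: HhalfP.
(* C^1 with no condition on the support, which is what survives the shift. *)
pose Q f := exists df, @C1w R n f df.
have mQ f : Q f -> measurable_fun setT f by move=> [df [cf _ _]]; exact: continuous_measurable.
have mha : measurable_fun setT (fun x => h (aff 1 a x)) by exact: measurable_aff_comp.
have [f [Pf Jf fu]] := approximable_ae (@C1c_measurable R n) ((apx _).1 Hu) JuC.
have Jha : (J Om (fun x => h (aff 1 a x)) <= C%:E)%E by apply: le_trans (J_shift a0 mh) JhC.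
have [|g [Qg Jg gh]] := approximable_ae mQ _ Jha.
  split => // e e0; have [_ /(_ e e0)[psi [Cpsi Jpsi Lpsi]]] := (apx _).1 Hh.
  have mpsi := C1c_measurable Cpsi.
  exists (fun x => psi (aff 1 a x)); split.
  - by move/C1c_halfP : Cpsi => [[dpsi hpsi] _]; eexists; exact: (C1w_aff 1 a hpsi).
  - exact: le_trans (J_shift a0 (measurable_funB mh mpsi)) Jpsi.
  - exact: le_trans (LL_shift a0 (measurable_funB mh mpsi)) Lpsi.
have e_gt0 (k : nat) : (0 : R) < k.+1%:R^-1 by rewrite invr_gt0.
pose G k x := smooth_trunc (k.+1%:R^-1) (f k x) (g k x).
have CG k : C1c_half (G k).
  move/C1c_halfP : (Pf k) => [[df hf] sf]; have [dg hg] := Qg k; apply/C1c_halfP; split.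
    exact: C1w_smooth_trunc hf hg.
  by apply: (csupp_sub sf) => x; apply: contra_neq; rewrite /G => ->; exact: smooth_trunc_eq0.
have mf k := C1c_measurable (Pf k); have mg k := mQ _ (Qg k).
have mG k := C1c_measurable (CG k).
have HG k : H (G k) by exact: C1c_Hhalf.
have JG k : (J Om (G k) <= (16 * (2 * C + 2))%:E)%E.
  apply: (@le_trans _ _ (8%:E * J Om (f k) + 8%:E * J Om (g k))%E).
    apply: le_J2 => // x y _ _; exact: smooth_trunc_lip.
  rewrite (_ : (16 * (2 * C + 2))%:E = (8%:E * (2 * C + 2)%:E + 8%:E * (2 * C + 2)%:E)%E) ?leeD ?lee_wpmul2l ?lee_fin//.
  by rewrite -!EFinM -EFinD; congr EFin; ring.
apply: (proj1 (Hhalf_weak HG JG _ _)); first by meas.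
apply: filterS2 fu gh => x fux ghx Ox; have := fux Ox; have := ghx Ox => {}ghx {}fux.
pose m (k : nat) : R := Num.max (`|f k x| - `|g k x|) 0.
have mc : m @ \oo --> Num.max (`|u x| - `|h (aff 1 a x)|) 0.
  have hB : (fun k => `|f k x| - `|g k x|) @ \oo --> `|u x| - `|h (aff 1 a x)|.
    by apply: cvgB; exact: cvg_norm.
  rewrite /m max0E; under eq_fun do rewrite max0E.
  by apply: cvgMr; apply: cvgD => //; exact: cvg_norm.
have Gm : (fun k => `|G k x - m k|) @ \oo --> (0 : R).
  apply: (@squeeze_norm0 _ _ (fun k => 5 * k.+1%:R^-1)) => [k|].
    rewrite normr_ge0/= [leRHS]ger0_norm ?mulr_ge0//; exact: smooth_trunc_near.
  rewrite -(mulr0 5); apply: cvgMr; apply/cvgrPdist_lt => e e0.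
  near=> k; rewrite sub0r normrN ger0_norm//.
  by near: k; exact: near_infty_natSinv_lt (PosNum e0).
have Gm' : (fun k => G k x - m k) @ \oo --> (0 : R) by exact: norm_cvg0.
rewrite -[X in _ --> X]add0r (_ : (fun k => G k x) = (fun k => (G k x - m k) + m k)); first exact: cvgD.
by apply/funext => k; rewrite subrK.
Unshelve. all: end_near. Qed.

End weak.

(** * The Sobolev quotients *)

Section powR_subadd.
Variables (R : realType) (t : R).
Hypotheses (t0 : 0 < t) (t1 : t < 1).

(** A ratio in (0,1) is smaller than its power with exponent t < 1. The two ratios of A = a + b add
    up to 1, which gives strict subadditivity. *)
Let frac (a A : R) : 0 < a -> a < A -> A `^ t * (a / A) < a `^ t.
Proof.
move=> a0 aA; have A0 : 0 < A by exact: lt_trans aA.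
have r0 : 0 < a / A by rewrite divr_gt0.
have -> : a `^ t = A `^ t * (a / A) `^ t by rewrite -powRM ?ltW// mulrCA divff ?mulr1 ?gt_eqF.
have {1}-> : a / A = (a / A) `^ t * (a / A) `^ (1 - t).
  by rewrite -powRD ?(gt_eqF r0) ?implybT// subrKC powRr1// ltW.
rewrite ltr_pM2l ?powR_gt0// gtr_pMr ?powR_gt0//.
rewrite -[ltRHS](_ : 1 `^ (1 - t) = 1 :> R); last by rewrite powR1.
have t1' := t1; apply: gt0_ltr_powR; rewrite ?nnegrE ?subr_gt0// ?ltW//.
by rewrite ltr_pdivrMr// mul1r.
Qed.

Lemma powR_lt_subadd (a b : R) : 0 < a -> 0 < b -> (a + b) `^ t < a `^ t + b `^ t.
Proof.
move=> a0 b0; have ab : 0 < a + b by exact: addr_gt0.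
have h1 : (a + b) `^ t * (a / (a + b)) < a `^ t by apply: frac => //; rewrite ltrDl.
have h2 : (a + b) `^ t * (b / (a + b)) < b `^ t by apply: frac => //; rewrite ltrDr.
apply: le_lt_trans (ltrD h1 h2); rewrite -mulrDr -mulrDl divff ?mulr1// gt_eqF//.
Qed.

Lemma powR_le_subadd (a b : R) : 0 <= a -> 0 <= b -> (a + b) `^ t <= a `^ t + b `^ t.
Proof.
rewrite le_eqVlt => /predU1P[<- _|a0]; first by rewrite add0r powR0 ?add0r// gt_eqF.
rewrite le_eqVlt => /predU1P[<-|b0]; first by rewrite addr0 powR0 ?addr0// gt_eqF.
exact/ltW/powR_lt_subadd.
Qed.

End powR_subadd.

Section quotient.
Variables (R : realType) (n : nat) (sigma : R).
Hypotheses (n0 : (0 < n)%N) (s0 : 0 < sigma) (sn : 2 * sigma < n%:R).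
Local Notation mu := (lam R n).
Local Notation p := (crit n sigma).
Local Notation ker := (@ker R n sigma).
Local Notation J := (J mu ker).
Local Notation LL := (@LL R n sigma).
Local Notation Om := (@halfspace R n).
Local Notation H := (@Hhalf R n sigma).
Local Notation th := ((n%:R - 2 * sigma) / n%:R).
Implicit Types (u v : 'rV[R]_n -> R) (A Q : set 'rV[R]_n).

Let p0 : 0 < p. Proof. by apply: lt_trans (crit_gt2 s0 sn). Qed.
Let mOm : measurable Om. Proof. exact: measurable_halfspace. Qed.
Let n0' : 0 < n%:R :> R. Proof. by rewrite ltr0n. Qed.

Lemma th_gt0 : 0 < th.
Proof. by rewrite divr_gt0// subr_gt0. Qed.

Lemma th_lt1 : th < 1.
Proof. by have s0' := s0; rewrite ltr_pdivrMr// mul1r; lra. Qed.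

Lemma LL_eq0P A u : measurable A -> measurable_fun setT u ->
  LL A u = 0%E <-> {ae mu, forall x, A x -> u x = 0}.
Proof.
move=> mA mu'; have mI : measurable_fun setT (\1_A : _ -> R) by exact: measurable_indic.
have mf : measurable_fun setT (fun x => (\1_A x * `|u x| `^ p)%:E).
  by apply/measurable_EFinP; meas.
have := ae_eq_integral_abs mu measurableT mf.
rewrite (_ : integral _ _ _ = LL A u); last first.
  by apply: eq_integral => x _; rewrite gee0_abs// lee_fin; nng.
move=> ->; split; apply: filterS => x h.
  move=> Ax; have := h I; rewrite /= indicE mem_set// mul1r => -[/powR_eq0_eq0] /eqP.
  by rewrite normr_eq0 => /eqP.
move=> _ /=; rewrite indicE; case: (boolP (x \in A)) => [/set_mem/h ->|_].
  by rewrite normr0 powR0 ?mulr0// gt_eqF.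
by rewrite mul0r.
Qed.

Lemma nonzero_onP A u : measurable A -> measurable_fun setT u ->
  nonzero_on A u <-> LL A u != 0%E.
Proof.
move=> mA mu'.
have mS : measurable [set x | A x /\ u x != 0].
  rewrite (_ : [set x | _] = A `&` (u @^-1` [set~ 0])).
    apply: measurableI => //; rewrite -[X in measurable X]setTI; apply: mu' => //.
    exact: measurableC.
  by apply/seteqP; split => x [Ax /eqP ux]; split => //; apply/eqP.
rewrite /nonzero_on lebnE//.
suff h : lam R n [set x | A x /\ u x != 0] = 0%E <-> LL A u = 0%E.
  by split; apply: contra_neq => /h.
rewrite LL_eq0P// -negligibleP//.
rewrite (_ : [set x | _] = ~` [set x | A x -> u x = 0])//.
apply/seteqP; split => x /= => [[Ax /eqP ux] /(_ Ax)//|/not_implyP[Ax /eqP ux]]; by split.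
Qed.

Lemma quotE A u : measurable A -> measurable_fun setT u ->
  quot sigma A u = fine (J A u) / fine (LL A u) `^ th.
Proof. by move=> mA mu'; rewrite /quot IgagE// LpintE. Qed.

Let quot_ge0 A u : measurable A -> measurable_fun setT u -> 0 <= quot sigma A u.
Proof.
move=> mA mu'; rewrite quotE// divr_ge0 ?powR_ge0// fine_ge0//; exact: J_ge0.
Qed.

(** Functions vanishing almost everywhere are excluded from the infimum but satisfy the inequality
    trivially, so it can be used without case distinction. *)
Let quot_lower A u (S : R) : measurable A -> measurable_fun setT u -> (LL A u < +oo)%E ->
  (nonzero_on A u -> S <= quot sigma A u) -> S * fine (LL A u) `^ th <= fine (J A u).
Proof.
move=> mA mu' Lfin; have [L0 _|L0] := eqVneq (LL A u) 0%E.
  by rewrite L0/= powR0 ?gt_eqF ?th_gt0// mulr0 fine_ge0//; exact: J_ge0.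
move=> /(_ ((nonzero_onP mA mu').2 L0)); rewrite quotE// ler_pdivlMr//.
by rewrite powR_gt0// fine_gt0// lt0e L0 LL_ge0.
Qed.

Lemma S_half_le u : H u -> S_half n sigma * fine (LL Om u) `^ th <= fine (J Om u).
Proof.
move=> Hu; apply: quot_lower => //; first exact: Hhalf_measurable Hu.
  by apply: Hhalf_LL.
move=> u0; apply: ge_inf; last by exists u.
by exists 0 => _ [v [Hv _] <-]; apply: quot_ge0 => //; exact: Hhalf_measurable Hv.
Qed.

(** Membership in [Hfull] asks for level sets of finite measure, which Chebyshev's inequality draws
    from the L^p bound. *)
Lemma S_full_le u : measurable_fun setT u -> (J setT u < +oo)%E -> (LL setT u < +oo)%E ->
  S_full n sigma * fine (LL setT u) `^ th <= fine (J setT u).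
Proof.
move=> mu' Jfin Lfin; apply: quot_lower => // u0; apply: ge_inf.
  by exists 0 => _ [v [[/BmeasP mv _ _] _] <-]; apply: quot_ge0.
exists u => //; split => //; split; [exact/BmeasP|by rewrite IgagE|].
move=> tau tau0.
have mS : measurable [set x | tau < `|u x|].
  rewrite (_ : [set x | _] = (fun x => `|u x|) @^-1` `]tau, +oo[%classic); last first.
    by apply/seteqP; split => x; rewrite /= in_itv/= andbT.
  rewrite -[X in measurable X]setTI; have mn : measurable_fun setT (fun x => `|u x|) by meas.
  exact: mn.
have mI : measurable_fun setT (\1_[set x | tau < `|u x|] : _ -> R) by exact: measurable_indic.
have tp : 0 < tau `^ p by rewrite powR_gt0.
rewrite lebnE// -[X in (lam _ _ X < _)%E]setIT -integral_indic//.
have h : ((tau `^ p)%:E * Int mu \1_[set x | (tau < `|u x|)%R] <= LL setT u)%E.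
  rewrite -IntZ; side.
  have mI' : measurable_fun setT (\1_(@setT 'rV[R]_n) : _ -> R) by exact: measurable_indic.
  apply: le_Int; side; move=> x.
  rewrite !indicE in_setT mul1r; case: (boolP (x \in _)) => [/set_mem/= hx|_].
    by rewrite mulr1; apply: powR_le_mono => //; exact: ltW.
  by rewrite mulr0 powR_ge0.
rewrite -/(Int mu \1_[set x | (tau < `|u x|)%R]).
move: h; have : (0 <= Int mu \1_[set x | (tau < `|u x|)%R])%E by apply: Int_ge0; nng.
case: (Int _ _) => [r _ _|_|//]; first by rewrite ltry.
by rewrite gt0_muley// leye_eq => /eqP hL; move: Lfin; rewrite hL.
Qed.

(* A sequence bounded in L^p with p > 2 is uniformly square integrable on sets of
   finite measure. *)
Lemma nonvanishing (Q : set 'rV[R]_n) (g : nat -> 'rV[R]_n -> R) v (c M : R) :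
  measurable Q -> (Int mu \1_Q < +oo)%E -> (forall k, measurable_fun setT (g k)) ->
  measurable_fun setT v -> 0 < c ->
  (forall k, c%:E <= Int mu (fun x => \1_Q x * g k x ^+ 2)%R)%E ->
  (forall k, LL Q (g k) <= M%:E)%E ->
  {ae mu, forall x, Q x -> g ^~ x @ \oo --> v x} -> LL Q v != 0%E.
Proof.
move=> mQ Qfin mg mv c0 hc hM gv; apply/eqP => /(LL_eq0P mQ mv) v0.
have mI : measurable_fun setT (\1_Q : _ -> R) by exact: measurable_indic.
have p2 : 0 < p - 2 by rewrite subr_gt0 crit_gt2.
have M0 : 0 <= M by rewrite -lee_fin; apply: le_trans (hM 0%N); exact: LL_ge0.
pose K := (2 * (M + 1) / c) `^ (p - 2)^-1.
have K0 : 0 < K by rewrite powR_gt0// divr_gt0// mulr_gt0//; lra.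
have X0 : 0 < 2 * (M + 1) / c by rewrite divr_gt0// mulr_gt0//; lra.
have KE : K `^ (p - 2) = 2 * (M + 1) / c by exact: (powRVK p2 (ltW X0)).
have KM : (K `^ (p - 2))^-1 * M < c / 2.
  rewrite KE ltr_pdivrMl// mulrA divfK ?(gt_eqF c0)//; lra.
pose h k x : R := \1_Q x * Num.min (g k x ^+ 2) (K ^+ 2).
have mh k : measurable_fun setT (h k).
  have mgk := mg k; apply: measurable_funM => //.
  by apply: measurable_minr; meas.
have min0 k x : 0 <= Num.min (g k x ^+ 2) (K ^+ 2) by rewrite le_min !sqr_ge0.
have h0 : (fun k => Int mu (h k)) @ \oo --> 0%E.
  apply: (@dct0 _ _ _ mu h (fun x => K ^+ 2 * \1_Q x)) => //.
  - by meas.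
  - by move=> k x; rewrite mulr_ge0// indic_nneg.
  - move=> k x; rewrite mulrC; apply: ler_wpM2l; first exact: indic_nneg.
    by rewrite ge_min lexx orbT.
  - apply: filterS2 gv v0 => x gx vx; rewrite /h indicE.
    case: (boolP (x \in Q)) => [/set_mem Qx|_]; last first.
      by under eq_fun do rewrite mul0r; exact: cvg_cst.
    have := gx Qx; rewrite vx// => gx0.
    apply: (@squeeze_norm0 _ _ (fun k => g k x * g k x)).
      by move=> k; rewrite mul1r min0/= ger0_norm -?expr2 ?sqr_ge0// ge_min lexx.
    by rewrite -(mulr0 0); apply: cvgM.
  - rewrite IntZ ?sqr_ge0//; side; rewrite lte_mul_pinfty// lee_fin sqr_ge0//.
have hI k : (0 <= Int mu (h k))%E by apply: Int_ge0 => x; rewrite mulr_ge0// indic_nneg.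
have c20 : 0 < c / 2 by rewrite divr_gt0.
have [k hk] := filter_ex ((cvge0P hI).1 h0 (c / 2) c20).
suff hlt : (Int mu (fun x => \1_Q x * g k x ^+ 2)%R < c%:E)%E.
  by have := le_lt_trans (hc k) hlt; rewrite ltxx.
apply: (@le_lt_trans _ _ (Int mu (fun x => h k x + (K `^ (p - 2))^-1 * (\1_Q x * `|g k x| `^ p)))).
  have mgk := mg k; have mhk := mh k; apply: le_Int; side; move=> x.
  rewrite /h [X in _ + X]mulrCA -mulrDr; apply: ler_wpM2l; first exact: indic_nneg.
  have [gK|gK] := leP (g k x ^+ 2) (K ^+ 2).
    by rewrite lerDl mulr_ge0 ?invr_ge0 ?powR_ge0.
  apply: (@le_trans _ _ ((K `^ (p - 2))^-1 * `|g k x| `^ p)); last by rewrite lerDr sqr_ge0.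
  have gn : K < `|g k x|.
    rewrite ltNge; apply/negP => h1; move: gK; rewrite ltNge => /negP; apply.
    by rewrite -(real_normK (num_real (g k x))) ler_pXn2r ?nnegrE// (ltW K0).
  have -> : `|g k x| `^ p = `|g k x| `^ (p - 2) * g k x ^+ 2.
    rewrite -(real_normK (num_real (g k x))) -powR_mulrn// -powRD ?subrK//.
    by rewrite (gt_eqF p0).
  rewrite mulrA ler_peMl ?sqr_ge0//.
  rewrite ler_pdivlMl ?(powR_gt0 _ K0)// mulr1; apply: powR_le_mono => //; exact: ltW.
have mgk := mg k; have mhk := mh k; have hk0 x : 0 <= h k x by rewrite mulr_ge0// indic_nneg.
rewrite IntD; side; last by move=> x; rewrite mulr_ge0 ?invr_ge0 ?powR_ge0//; nng.
rewrite IntZ; side; last by rewrite invr_ge0 powR_ge0.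
apply: (@le_lt_trans _ _ ((c / 2)%:E + ((K `^ (p - 2))^-1)%:E * M%:E)%E).
  by apply: leeD => //; apply: lee_wpmul2l; rewrite ?lee_fin ?invr_ge0 ?powR_ge0//; exact: hM.
rewrite -EFinM -EFinD lte_fin [ltRHS](splitr c) ltrD2l; exact: KM.
Qed.

Lemma ae_aff (a : 'rV[R]_n) (P : 'rV[R]_n -> Prop) :
  {ae mu, forall x, P x} -> {ae mu, forall x, P (aff 1 a x)}.
Proof.
move=> [N [mN N0 PN]]; exists (aff 1 a @^-1` N); split; last by move=> x /PN.
  exact: measurable_preimage_aff.
have mI : measurable_fun setT (\1_N : _ -> R) by exact: measurable_indic.
rewrite -[X in lam _ _ X]setIT -integral_indic//; last exact: measurable_preimage_aff.
under eq_integral do rewrite indic_preimage_aff.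
have := @Int_aff R n 1 a ltr01 \1_N mI (@indic_nneg _ _ N).
rewrite expr1n mul1e /Int => ->.
by rewrite integral_indic// setIT.
Qed.

End quotient.

(** * Minimizing sequences *)

Lemma subseq_cvgny (phi : nat -> nat) : {homo phi : i j / (i < j)%N >-> (i < j)%N} ->
  phi @ \oo --> \oo.
Proof.
move=> hphi P [N _ hN]; exists N => // k /= Nk; apply: hN => /=; apply: leq_trans Nk _.
by elim: k => // k IH; exact: leq_ltn_trans IH (hphi _ _ (ltnSn k)).
Qed.

Section limits.
Variable R : realType.

(** Turns the two-sided Brezis-Lieb bounds into a limit for the remainder [X k], which may be
    infinite for finitely many k. *)
Lemma split_cvg (X Y : nat -> \bar R) (b A : R) : 0 <= b ->
  (forall k, (0 <= X k)%E) -> (forall k, (0 <= Y k < +oo)%E) ->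
  (forall e : R, 0 < e -> \forall k \near \oo,
    (Y k <= X k + b%:E + e%:E)%E /\ (X k + b%:E <= Y k + e%:E)%E) ->
  (fun k => fine (Y k)) @ \oo --> A ->
  (\forall k \near \oo, X k \is a fin_num) /\ (fun k => fine (X k)) @ \oo --> A - b.
Proof.
move=> b0 X0 Y0 hXY YA.
have YE k : Y k = (fine (Y k))%:E by rewrite fineK// ge0_fin_numE; have /andP[] := Y0 k.
have Xfin : \forall k \near \oo, X k \is a fin_num.
  move: (hXY 1 ltr01); apply: filterS => k [_ h]; rewrite ge0_fin_numE//.
  apply: le_lt_trans (_ : (X k + b%:E < +oo)%E); first by rewrite leeDl// lee_fin.
  by apply: le_lt_trans h _; rewrite YE -EFinD ltry.
split => //; apply/cvgrPdist_le => e e0; have e2 : 0 < e / 2 by rewrite divr_gt0.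
move/cvgrPdist_le : YA => /(_ _ e2) YA.
apply: filterS3 Xfin YA (hXY _ e2) => k Xk h [h1 h2].
have [x xE] : exists x, X k = x%:E by exists (fine (X k)); rewrite fineK.
have [y yE] : exists y, Y k = y%:E by exists (fine (Y k)); rewrite -YE.
move: h1 h2 h; rewrite xE yE -!EFinD !lee_fin /= => h1 h2.
by rewrite !ler_norml; lra.
Qed.

Lemma lim_quot (S t L j : R) (l : nat -> R) : 0 < t -> (forall k, 0 <= l k) -> l @ \oo --> L ->
  (forall e : R, 0 < e -> \forall k \near \oo, S * l k `^ t <= j + e) ->
  0 <= L /\ S * L `^ t <= j.
Proof.
move=> t0 l0 lL h; have L0 : 0 <= L.
  by rewrite -(cvg_lim (@Rhausdorff R) lL); apply: limr_ge; [exact: cvgP lL|exact: nearW].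
split => //; apply/ler_addgt0Pr => e e0.
have := powR_norm_cvg t0 lL; rewrite (ger0_norm L0) => lLt.
have hS : (fun k => S * `|l k| `^ t) @ \oo --> S * L `^ t by exact: cvgMr.
rewrite -(cvg_lim (@Rhausdorff R) hS); apply: limr_le; first exact: cvgP hS.
by move: (h e e0); apply: filterS => k; rewrite ger0_norm.
Qed.

End limits.

Lemma dqB d (T : measurableType d) (R : realType) (w : T * T -> R) A u v z :
  dq w A (fun x => u x - v x) z = dq w A u z - dq w A v z.
Proof. by rewrite /dq; ring. Qed.

Section profile.
Variables (R : realType) (n : nat) (sigma : R).
Hypotheses (n0 : (0 < n)%N) (s0 : 0 < sigma) (sn : 2 * sigma < n%:R).
Local Notation mu := (lam R n).
Local Notation p := (crit n sigma).
Local Notation ker := (@ker R n sigma).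
Local Notation J := (J mu ker).
Local Notation LL := (@LL R n sigma).
Local Notation Om := (@halfspace R n).
Local Notation H := (@Hhalf R n sigma).
Local Notation th := ((n%:R - 2 * sigma) / n%:R).
Local Notation S := (S_half n sigma).
Local Notation en := (delta_mx 0 (ilast n0) : 'rV[R]_n).
Implicit Types (u v f : 'rV[R]_n -> R).

Let p0 : 0 < p. Proof. by apply: lt_trans (crit_gt2 s0 sn). Qed.
Let mOm : measurable Om. Proof. exact: measurable_halfspace. Qed.
Let mw : measurable_fun setT ker. Proof. exact: measurable_ker. Qed.
Let w0 : forall z, 0 <= ker z. Proof. exact: ker_ge0. Qed.
Let mI : measurable_fun setT (\1_Om : _ -> R). Proof. exact: measurable_indic. Qed.
Let t0 : 0 < th. Proof. exact: th_gt0. Qed.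
Let t1 : th < 1. Proof. exact: th_lt1. Qed.

Variables (w : nat -> 'rV[R]_n -> R) (s : nat -> R) (A M c : R).
Hypotheses (Hw : forall k, H (w k)) (Jw : forall k, J Om (w k) = 1%E).
Hypothesis LM : forall k, (LL Om (w k) <= M%:E)%E.
Hypothesis LA : (fun k => fine (LL Om (w k))) @ \oo --> A.
Hypotheses (S0 : 0 < S) (A0 : 0 < A) (SA : S * A `^ th = 1).
Hypotheses (c0 : 0 < c) (sk0 : forall k, 0 < s k).
Hypothesis wc : forall k,
  (c%:E <= Int mu (fun x => \1_(cube (s k *: en) 1) x * w k x ^+ 2)%R)%E.

Let mwk k : measurable_fun setT (w k). Proof. exact: Hhalf_measurable (Hw k). Qed.
Let Jw1 k : (J Om (w k) <= 1%:E)%E. Proof. by rewrite Jw. Qed.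
Let LLw k : (0 <= LL Om (w k) < +oo)%E.
Proof. by rewrite LL_ge0; apply: le_lt_trans (LM k) _; rewrite ltry. Qed.

Lemma le_indic (B C : set 'rV[R]_n) x : B `<=` C -> \1_B x <= \1_C x :> R.
Proof.
by move=> BC; rewrite !indicE; case: (boolP (x \in B)) => [/set_mem/BC/mem_set ->|].
Qed.

Lemma en_last (t : R) : (t *: en) 0 (ilast n0) = t.
Proof. by rewrite !mxE !eqxx mulr1. Qed.

(** With b and j the L^p mass and energy of v, the remainder gives S (A - b)^th <= 1 - j and v gives
    S b^th <= j. The sum of the left sides is at most 1 = S A^th, which strict subadditivity
    excludes unless A = b; then j = 1 and no energy is left for w_k - v. *)
Lemma bounded_case v (S1 : R) : measurable_fun setT v -> (forall k, s k <= S1) ->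
  {ae mu, forall x, Om x -> w ^~ x @ \oo --> v x} ->
  [/\ H v, J Om v = 1%E, fine (LL Om v) = A &
    (fun k => J Om (fun x => w k x - v x)) @ \oo --> 0%E].
Proof.
move=> mv sS1 wv.
have S1pos : 0 < S1 + 1 by have := sk0 0%N; have := sS1 0%N; lra.
have [Hv Jv] := Hhalf_weak n0 s0 sn Hw Jw1 mv wv.
pose Q := Om `&` cube (0 : 'rV[R]_n) (S1 + 1).
have mC l (x : 'rV[R]_n) : measurable (cube x l) by exact: measurable_cube.
have mQ : measurable Q by exact: measurableI.
have mIQ : measurable_fun setT (\1_Q : _ -> R) by exact: measurable_indic.
(* The unit cubes that carry mass all lie in the fixed bounded set [Q], so the mass survives in the
   limit. *)
have Lv0 : LL Om v != 0%E.
  have : LL Q v != 0%E.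
    apply: (@nonvanishing R n sigma s0 sn Q w v c M) => //.
    - apply: (@le_lt_trans _ _ (Int mu \1_(cube (0 : 'rV[R]_n) (S1 + 1)))).
        apply: le_Int => //.
        by move=> x; apply: le_indic => y [].
      by rewrite Int_cube ?(ltW S1pos)// ltry.
    - move=> k; apply: le_trans (wc k) _; have mwk' := mwk k.
      have mIc : measurable_fun setT (\1_(cube (s k *: en) 1) : _ -> R) by exact: measurable_indic.
      apply: le_Int; side; move=> x; apply: ler_wpM2r; first exact: sqr_ge0.
      apply: le_indic => y hy; split.
        have := hy (ilast n0); rewrite en_last /halfspace /= (xlastE n0) => /andP[h _].
        exact: lt_le_trans (sk0 k) h.
      move=> i; have h1 := sk0 k; have h2 := sS1 k.
      have [e01 e02] : 0 <= en 0 i /\ en 0 i <= 1 by rewrite mxE; case: (_ && _); rewrite /= ?lexx.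
      have := hy i; rewrite [(s k *: en) 0 i]mxE [(0 : 'rV[R]_n) 0 i]mxE => /andP[h3 h4].
      have h5 : 0 <= s k * en 0 i by rewrite mulr_ge0// ltW.
      have h6 : s k * en 0 i <= s k by rewrite ler_piMr// ltW.
      apply/andP; split; lra.
    - move=> k; apply: le_trans (LM k); by apply: LL_subset => //; exact: subIsetl.
    - by apply: filterS wv => x h [Ox _]; exact: h.
  by apply: contra_neq => h; apply/eqP; rewrite eq_le LL_ge0 andbT -h; by apply: LL_subset => //; exact: subIsetl.
have Lvfin : (LL Om v < +oo)%E by apply: Hhalf_LL.
set b := fine (LL Om v).
have b0 : 0 < b by rewrite fine_gt0// lt0e Lv0 LL_ge0.
have LvE : LL Om v = b%:E by rewrite fineK// ge0_fin_numE ?LL_ge0.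
have [j JvE /andP[j0 j1]] := ge0_le_fin (J_ge0 _ _ _ _) Jv.
have LLdist k : Int mu (fun x => `|\1_Om x * w k x - \1_Om x * v x| `^ p) =
    LL Om (fun x => w k x - v x).
  by under eq_fun do rewrite -mulrBr; rewrite -(LLE s0 sn).
have [] := @split_cvg R (fun k => LL Om (fun x => w k x - v x)) (fun k => LL Om (w k)) b A (ltW b0)
  (fun k => LL_ge0 _ _ _) LLw _ LA.
  move=> e e0; have mf k : measurable_fun setT (fun x => \1_Om x * w k x).
    by have := mwk k => mwk'; meas.
  have mg : measurable_fun setT (fun x => \1_Om x * v x) by meas.
  have fg : {ae mu, forall x, (fun k => \1_Om x * w k x) @ \oo --> \1_Om x * v x}.
    apply: filterS wv => x h; rewrite indicE; case: (boolP (x \in Om)) => [/set_mem/h h'|_].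
      by under eq_fun do rewrite mul1r; rewrite mul1r.
    by under eq_fun do rewrite mul0r; rewrite mul0r; exact: cvg_cst.
  have fM k : (Int mu (fun x => `|\1_Om x * w k x| `^ p)%R <= M%:E)%E by rewrite -LLE.
  by apply: filterS (brezis_lieb_near p0 mf mg fg fM e0) => k; rewrite LLdist -!LLE// LvE.
move=> _ LLc.
have Jdist k : Int (mu \x mu)%E (fun z => (dq ker Om (w k) z - dq ker Om v z) ^+ 2) =
    J Om (fun x => w k x - v x).
  by congr Int; apply/funext => z; rewrite dqB.
have [] := @split_cvg R (fun k => J Om (fun x => w k x - v x)) (fun k => J Om (w k)) j 1 j0
  (fun k => J_ge0 _ _ _ _) _ _ _.
- by move=> k; rewrite Jw lee_fin ler01 ltry.
- move=> e e0; have ukv : {ae mu, forall x,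
      (Om x /\ (\forall k \near \oo, Om x) /\ w ^~ x @ \oo --> v x) \/
      (~ Om x /\ \forall k \near \oo, ~ Om x)}.
    apply: filterS wv => x h; have [Ox|nOx] := pselect (Om x).
      by left; split => //; split; [exact: nearW|exact: h].
    by right; split => //; exact: nearW.
  have := J_brezis_lieb mw (fun=> mOm) mOm mwk mv ukv Jw1 e0.
  by apply: filterS => k; rewrite Jdist JvE.
- by under eq_fun do rewrite Jw; exact: cvg_cst.
move=> Jfin Jc.
have [] := @lim_quot R S th (A - b) (1 - j) _ t0 _ LLc.
- by move=> k; rewrite fine_ge0// LL_ge0.
- move=> e e0; move/cvgrPdist_le : (Jc) => /(_ _ e0); apply: filterS => k hk.
  have Hd : H (fun x => w k x - v x).
    rewrite (_ : (fun x => _) = (fun x => 1 * w k x + (-1) * v x)); first exact: Hhalf_lin.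
    by apply/funext => x; ring.
  apply: le_trans (S_half_le n0 s0 sn Hd) _.
  move: hk; rewrite ler_norml; lra.
move=> Ab hS; have := S_half_le n0 s0 sn Hv; rewrite -/b JvE/= => hv.
have Ab0 : A - b = 0.
  apply/eqP; rewrite eq_le Ab andbT leNgt; apply/negP => Ab1.
  have := powR_lt_subadd t1 Ab1 b0; rewrite subrK => h.
  have : S * A `^ th < S * ((A - b) `^ th + b `^ th) by rewrite ltr_pM2l.
  rewrite SA mulrDr; lra.
have bA : b = A by lra.
have j1' : j = 1 by move: hv; rewrite bA SA; lra.
split => //; first by rewrite j1'.
by apply/fine_cvgP; split => //; rewrite -[X in _ --> X](_ : 1 - j = 0)// j1' subrr.
Qed.

Lemma sqr_le_norm (x y : R) : `|x| <= `|y| -> x ^+ 2 <= y ^+ 2.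
Proof.
move=> xy; rewrite -[leLHS](real_normK (num_real x)) -[leRHS](real_normK (num_real y)).
by rewrite ler_pXn2r ?nnegrE.
Qed.

Lemma aff1_comp (b d x : 'rV[R]_n) : aff 1 b (aff 1 (- d) x) = aff 1 (b - d) x.
Proof. by rewrite /aff !scale1r opprK opprB addrA. Qed.

Lemma aff1K (b x : 'rV[R]_n) : aff 1 (- b) (aff 1 b x) = x.
Proof. by rewrite /aff !scale1r opprK subrK. Qed.

(** * Mass moving away from the boundary *)

Section escaping.
Variable f : 'rV[R]_n -> R.
Local Notation a k := (- (s k *: en)).
Local Notation O k := (aff 1 (a k) @^-1` Om).
Local Notation W k := (fun x => `|w k (aff 1 (a k) x)|).
Local Notation E k := (fun x => Num.max (`|w k x| - f (aff 1 (- a k) x)) 0).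
Hypotheses (mf : measurable_fun setT f) (f0 : forall x, 0 <= f x).
Hypothesis sinf : forall t, \forall k \near \oo, t <= s k.
Hypothesis Wf : {ae mu, forall x, (fun k => `|w k (aff 1 (a k) x)|) @ \oo --> f x}.

Let OE k x : O k x <-> 0 < x 0 (ilast n0) + s k.
Proof.
by rewrite /halfspace /= (xlastE n0) /aff scale1r opprK mxE [X in _ + X]en_last.
Qed.

Let in_O x : \forall k \near \oo, O k x.
Proof.
apply: filterS (sinf (1 - x 0 (ilast n0))) => k h; apply/OE; lra.
Qed.

Let mO k : measurable (O k). Proof. exact: measurable_preimage_aff. Qed.

Let mW k : measurable_fun setT (W k).
Proof. by have := measurable_aff_comp 1 (a k) (mwk k) => h; meas. Qed.

Let mIO k : measurable_fun setT (\1_(O k) : _ -> R). Proof. exact: measurable_indic. Qed.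

Let JW k : (J (O k) (W k) <= 1%:E)%E.
Proof.
have mwa := measurable_aff_comp 1 (a k) (mwk k).
rewrite -(Jw k) -(J_aff1 sigma (a k) mOm (mwk k)); apply: le_J => //.
by move=> x y _ _; apply: sqr_le_norm; exact: ler_dist_dist.
Qed.

Let LW k : LL (O k) (W k) = LL Om (w k).
Proof.
rewrite -(LL_aff1 sn (a k) mOm (mwk k)).
by congr Int; apply/funext => x; rewrite normr_id.
Qed.

Let IWf : {ae mu, forall x, (fun k => \1_(O k) x * W k x) @ \oo --> f x}.
Proof.
apply: filterS Wf => x h; apply: cvg_trans h; apply: near_eq_cvg.
by apply: filterS (in_O x) => k Ox; rewrite indicE mem_set// mul1r.
Qed.

Let mIW k : measurable_fun setT (fun x => \1_(O k) x * W k x).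
Proof. by have h1 := mIO k; have h2 := mW k; apply: measurable_funM. Qed.

Let IWM k : (Int mu (fun x => `|\1_(O k) x * W k x| `^ p)%R <= M%:E)%E.
Proof. by rewrite -(LLE s0 sn) LW. Qed.

Let LfE : LL setT f = Int mu (fun x => `|f x| `^ p).
Proof. by congr Int; apply/funext => x; rewrite indicT mul1r. Qed.

Let Lf : (LL setT f <= M%:E)%E.
Proof. by rewrite LfE; exact: (Int_powR_lim_le p0 mIW mf IWf IWM). Qed.

Let ukv : {ae mu, forall x, (setT x /\ (\forall k \near \oo, O k x) /\
    (fun k => W k x) @ \oo --> f x) \/ (~ setT x /\ \forall k \near \oo, ~ O k x)}.
Proof. by apply: filterS Wf => x h; left; split => //; split => //; exact: in_O. Qed.

Let Jf : (J setT f <= 1%:E)%E.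
Proof. exact: (J_lim_le mw mO measurableT mW mf ukv JW). Qed.

(** The translation brings every mass-carrying cube to the unit cube at the origin, so
    [nonvanishing] applies on that one cube. *)
Let Lf0 : LL setT f != 0%E.
Proof.
pose Q := cube (0 : 'rV[R]_n) 1.
have mQ : measurable Q by exact: measurable_cube.
have QO k : Q `<=` O k.
  move=> y /(_ (ilast n0)); rewrite mxE => /andP[h _]; apply/OE.
  by have := sk0 k; lra.
have : LL Q f != 0%E.
  have Qfin : (Int mu \1_Q < +oo)%E by rewrite Int_cube// ltry.
  have hc k : (c%:E <= Int mu (fun x => \1_Q x * (W k x) ^+ 2)%R)%E.
    apply: le_trans (wc k) _; have mwk' := mwk k.
    have mIc : measurable_fun setT (\1_(cube (s k *: en) 1) : _ -> R).
      by apply: measurable_indic; exact: measurable_cube.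
    rewrite -(@Int_aff R n 1 (a k) ltr01)//; [|by meas|by move=> x; nng].
    rewrite expr1n mul1e le_eqVlt; apply/orP; left; apply/eqP; congr Int; apply/funext => x.
    rewrite real_normK ?num_real//; congr (_ * _); rewrite !indicE; congr (_%:R); congr nat_of_bool.
    apply/idP/idP => /set_mem hx; apply/mem_set => i; have := hx i;
      rewrite /aff scale1r opprK [(x + _) 0 i]mxE [(0 : 'rV[R]_n) 0 i]mxE => /andP[? ?]; apply/andP; split; lra.
  have hM k : (LL Q (W k) <= M%:E)%E.
    by apply: le_trans (LM k); rewrite -LW; exact: (LL_subset sigma mQ (mO k) (mW k) (QO k)).
  have hW : {ae mu, forall x, Q x -> (fun k => W k x) @ \oo --> f x}.
    by apply: filterS Wf => x h _.
  exact: (nonvanishing s0 sn mQ Qfin mW mf c0 hc hM hW).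
apply: contra_neq => h; apply/eqP; rewrite eq_le LL_ge0 andbT -h.
exact: (LL_subset sigma mQ measurableT mf (@subsetT _ Q)).
Qed.

(** The subtracted function f(. - s_k e_n) is itself the limit in m of |w_m(. + (s_m - s_k) e_n)|.
    For s_m >= s_k these are shifts allowed in [Hhalf_trunc], and [Hhalf_weak] passes to the
    limit. *)
Let HE k : H (E k).
Proof.
have [N _ hN] := sinf (s k).
have cN : (fun m : nat => (m + N)%N) @ \oo --> \oo.
  by apply: subseq_cvgny => i j ij; rewrite ltn_add2r.
pose v m := w (m + N)%N; pose d m := a (m + N)%N - a k.
have d0 m : xlast (d m) <= 0.
  rewrite (xlastE n0) /d opprK [X in X <= _]mxE [X in X + _]mxE !en_last.
  by have := hN (m + N)%N (leq_addl _ _); rewrite /=; lra.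
have Hg m : H (fun x => Num.max (`|w k x| - `|v m (aff 1 (d m) x)|) 0).
  exact: (Hhalf_trunc n0 s0 sn (Hw k) (Hw _) (Jw1 k) (Jw1 _) (d0 m)).
have Jg m : (J Om (fun x => Num.max (`|w k x| - `|v m (aff 1 (d m) x)|) 0)%R <= 4%:E)%E.
  have mva : measurable_fun setT (fun x => v m (aff 1 (d m) x)).
    exact: (measurable_aff_comp 1 (d m) (mwk (m + N)%N)).
  apply: (@le_trans _ _ (2%:E * J Om (w k) + 2%:E * J Om (fun x => v m (aff 1 (d m) x)))%E).
    have mgm := Hhalf_measurable (Hg m); apply: le_J2 => //.
    move=> x y _ _; have := max0_lip (`|w k x| - `|v m (aff 1 (d m) x)|) (`|w k y| - `|v m (aff 1 (d m) y)|).
    set X := Num.max _ _; set Y := Num.max _ _.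
    have := ler_dist_dist (w k x) (w k y); have := ler_dist_dist (v m (aff 1 (d m) x)) (v m (aff 1 (d m) y)).
    set x1 := w k x; set y1 := w k y; set x2 := v m _; set y2 := v m _ => h2 h1 h3.
    have h4 : `|X - Y| <= `|(`|x1 - y1| + `|x2 - y2|)|.
      rewrite [leRHS]ger0_norm ?addr_ge0//; apply: le_trans h3 _.
      rewrite (_ : _ - _ = (`|x1| - `|y1|) - (`|x2| - `|y2|)); last by ring.
      by apply: le_trans (ler_normB _ _) _; exact: lerD.
    apply: le_trans (sqr_le_norm h4) _.
    rewrite -(real_normK (num_real (x1 - y1))) -(real_normK (num_real (x2 - y2))).
    by have := sqr_ge0 (`|x1 - y1| - `|x2 - y2|); nra.
  have h1 := Jw1 k; have h2 := le_trans (J_shift sigma n0 (d0 m) (mwk _)) (Jw1 (m + N)%N).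
  rewrite (_ : 4%:E = (2%:E * 1%:E + 2%:E * 1%:E)%E); first by rewrite leeD// lee_wpmul2l// lee_fin.
  by rewrite -!EFinM -EFinD; congr EFin; ring.
have mfa : measurable_fun setT (fun x => f (aff 1 (- a k) x)).
  exact: (measurable_aff_comp 1 (- a k) mf).
apply: (proj1 (Hhalf_weak n0 s0 sn Hg Jg _ _)).
  by have mwk' := mwk k; meas.
apply: filterS (ae_aff (- a k) Wf) => x h _.
have {}h : (fun m => `|v m (aff 1 (d m) x)|) @ \oo --> f (aff 1 (- a k) x).
  rewrite (_ : (fun m => _) = (fun m => `|w m (aff 1 (a m) (aff 1 (- a k) x))|) \o (fun m => (m + N)%N)).
    exact: (cvg_comp _ _ cN h).
  by apply/funext => m /=; rewrite aff1_comp.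
rewrite max0E; under eq_fun do rewrite max0E.
have hB : (fun m => `|w k x| - `|v m (aff 1 (d m) x)|) @ \oo --> `|w k x| - f (aff 1 (- a k) x).
  by apply: cvgB => //; exact: cvg_cst.
by apply: cvgMr; apply: cvgD => //; exact: cvg_norm.
Qed.

Let EE k : (fun x => E k (aff 1 (a k) x)) = (fun x => Num.max (W k x - f x) 0).
Proof. by apply/funext => x; rewrite /= aff1K. Qed.

Let mE k : measurable_fun setT (E k). Proof. exact: Hhalf_measurable (HE k). Qed.

(** Taking the positive part does not increase differences, so the energy of [E k] is at most the
    remainder in the Brezis-Lieb bound for [W k] and f. *)
Let JE e : 0 < e -> \forall k \near \oo, (J Om (E k) + J setT f <= 1%:E + e%:E)%E.
Proof.
move=> e0; have mw' := mw.
move: (J_brezis_lieb mw mO measurableT mW mf ukv JW e0).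
apply: filterS => k [_ h]; apply: le_trans (_ : _ <= J (O k) (W k) + e%:E)%E _; last by rewrite leeD.
apply: le_trans h; rewrite leeD2r// -(J_aff1 sigma (a k) mOm (mE k)) EE.
have mWk := mW k; have mEk : measurable_fun setT (fun x => Num.max (W k x - f x) 0).
  by apply: measurable_maxr => //; exact: measurable_funB.
have mdE := measurable_dq mw (mO k) mEk; have mdW := measurable_dq mw (mO k) mWk.
have mdf := measurable_dq mw measurableT mf.
apply: le_Int; side; move=> z; rewrite /dq !indicT !indicE.
case: (boolP (z.1 \in O k)) => h1; last by rewrite !mul0r expr0n sqr_ge0.
case: (boolP (z.2 \in O k)) => h2; last by rewrite mulr0 !mul0r expr0n sqr_ge0.
rewrite !mul1r -mulrBl !exprMn; apply: ler_wpM2r; first exact: sqr_ge0.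
apply: sqr_le_norm; apply: le_trans (max0_lip _ _) _.
by rewrite le_eqVlt; apply/orP; left; apply/eqP; congr (`|_|); ring.
Qed.

(** The negative part of the Brezis-Lieb remainder. It is at most f, so dominated convergence
    removes it ([rest0]). *)
Let rest k x : R := Num.max (f x - \1_(O k) x * W k x) 0.

Let mrest k : measurable_fun setT (rest k).
Proof. by have h := mIW k; rewrite /rest; apply: measurable_maxr => //; exact: measurable_funB. Qed.

Let IW0 k x : 0 <= \1_(O k) x * W k x.
Proof. by rewrite mulr_ge0 ?indic_nneg. Qed.

Let rest_le k x : 0 <= rest k x <= f x.
Proof. by rewrite /rest le_max lexx orbT ge_max f0 gerBl IW0. Qed.

Let rest0 : (fun k => Int mu (fun x => `|rest k x| `^ p)%R) @ \oo --> 0%E.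
Proof.
apply: (@dct0 _ _ _ mu (fun k x => `|rest k x| `^ p) (fun x => `|f x| `^ p)).
- by move=> k; have := mrest k => h; meas.
- by meas.
- by move=> k x; exact: powR_ge0.
- move=> k x; apply: powR_le_mono => //; have /andP[h1 h2] := rest_le k x.
  by rewrite !ger0_norm.
- have z0 : `|0 : R| `^ p = 0 by rewrite normr0 powR0// gt_eqF.
  apply: filterS IWf => x h; rewrite -[X in _ --> X]z0; apply: powR_norm_cvg => //.
  have hB : (fun k => f x - \1_(O k) x * W k x) @ \oo --> (0 : R).
    by rewrite -(subrr (f x)); apply: cvgB => //; exact: cvg_cst.
  apply: (squeeze_norm0 _ hB) => k; have /andP[-> _] := rest_le k x.
  by rewrite /rest ge_max normr_ge0 ler_norm.
- by rewrite -LfE; apply: le_lt_trans Lf _; rewrite ltry.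
Qed.

(** The positive and negative parts are never both nonzero, so their p-th powers add. Off [O k] the
    difference is -f, which is all negative part. *)
Let split_norm k x : `|\1_(O k) x * W k x - f x| `^ p =
  \1_(O k) x * `|Num.max (W k x - f x) 0| `^ p + `|rest k x| `^ p.
Proof.
have z0 : `|0 : R| `^ p = 0 by rewrite normr0 powR0// gt_eqF.
rewrite /rest indicE; case: (x \in O k); rewrite ?mul1r ?mul0r.
  have [h|h] := leP (W k x) (f x).
    rewrite [Num.max (_ - f x) 0](max_idPr _) ?subr_le0// z0 add0r.
    by rewrite [Num.max _ 0](max_idPl _) ?subr_ge0// distrC.
  rewrite [Num.max (_ - f x) 0](max_idPl _) ?subr_ge0 ?(ltW h)//.
  by rewrite [Num.max (f x - _) 0](max_idPr _) ?subr_le0 ?(ltW h)// z0 addr0.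
by rewrite sub0r normrN subr0 add0r (max_idPl (f0 x)).
Qed.

Let LE : exists2 b : R, 0 < b /\ LL setT f = b%:E &
  (fun k => fine (LL Om (E k))) @ \oo --> A - b.
Proof.
have [b bE /andP[b0 _]] := ge0_le_fin (LL_ge0 _ _ _) Lf.
have b1 : 0 < b by rewrite lt_neqAle b0 andbT eq_sym; move: Lf0; rewrite bE.
exists b => //.
have h : forall e : R, 0 < e -> \forall k \near \oo,
    (LL Om (w k) <= LL Om (E k) + b%:E + e%:E)%E /\ (LL Om (E k) + b%:E <= LL Om (w k) + e%:E)%E.
  move=> e e0; have e2 : 0 < e / 2 by rewrite divr_gt0.
  have r0 k : (0 <= Int mu (fun x => `|rest k x| `^ p)%R)%E by apply: Int_ge0 => x; exact: powR_ge0.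
  have gen (X Y Z : \bar R) : (0 <= Y)%E -> (Y <= (e / 2)%:E)%E ->
      (Z <= X + Y + b%:E + (e / 2)%:E)%E /\ (X + Y + b%:E <= Z + (e / 2)%:E)%E ->
      (Z <= X + b%:E + e%:E)%E /\ (X + b%:E <= Z + e%:E)%E.
    move=> Y0 Ye [h1 h2]; split.
      apply: le_trans h1 _; rewrite [e in leRHS]splitr (EFinD (e / 2)) -!addeA leeD2l//.
      by rewrite addeCA leeD2l// leeD2r.
    apply: le_trans (_ : _ <= Z + (e / 2)%:E)%E _.
      by apply: le_trans h2; rewrite leeD2r// leeDl.
    by rewrite leeD2l// lee_fin; lra.
  apply: filterS2 ((cvge0P r0).1 rest0 _ e2) (brezis_lieb_near p0 mIW mf IWf IWM e2) => k hr.
  rewrite -LfE bE -(LLE s0 sn) LW.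
  under eq_fun do rewrite split_norm.
  rewrite (_ : Int mu _ = (LL Om (E k) + Int mu (fun x => `|rest k x| `^ p)%R)%E); last first.
    rewrite -(LL_aff1 sn (a k) mOm (mE k)) EE; have hr' := mrest k; have hW := mW k.
    have hO := mIO k.
    have mEk : measurable_fun setT (fun x => Num.max (W k x - f x) 0).
      by apply: measurable_maxr => //; exact: measurable_funB.
    apply: IntD.
    - by apply: measurable_funM => //; apply: measurable_powR_comp; exact: measurable_norm_comp.
    - by apply: measurable_powR_comp; exact: measurable_norm_comp.
    - by move=> x; rewrite mulr_ge0 ?powR_ge0 ?indic_nneg.
    - by move=> x; exact: powR_ge0.
  exact: gen (r0 k) hr.
exact: (split_cvg b0 (fun k => LL_ge0 _ _ _) LLw h LA).2.
Qed.

Lemma escaping_compactness : exists (phi : nat -> nat) (g : 'rV[R]_n -> R),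
  [/\ {homo phi : i j / (i < j)%N >-> (i < j)%N}, measurable_fun setT g, forall x, 0 <= g x &
   {ae mu, forall x, (fun k => `|w (phi k) (aff 1 (a (phi k)) x)|) @ \oo --> g x}].
Proof.
have M1 : 0 < M + 1.
  by rewrite ltr_wpDl// -lee_fin; apply: le_trans (LM 0%N); exact: LL_ge0.
have WM k : (LL (O k) (W k) <= (M + 1)%:E)%E.
  by rewrite LW; apply: le_trans (LM k) _; rewrite lee_fin lerDl.
have OT (x : 'rV[R]_n) : setT x -> exists2 e, 0 < e & exists N, forall k, (N <= k)%N ->
    [set y : 'rV[R]_n | forall i, `|y 0 i - x 0 i| < e] `<=` O k.
  move=> _; exists 1 => //; have [N _ hN] := sinf (1 - x 0 (ilast n0)).
  exists N => k Nk y /(_ (ilast n0)); rewrite ltr_norml => /andP[hy _]; apply/OE.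
  by have := hN k Nk; rewrite /=; lra.
have [phi [v [hphi mv hv]]] := local_compactness s0 sn mW mO JW M1 WM OT.
exists phi, (fun x => `|v x|); split => //; first by meas.
apply: filterS hv => x /(_ I) h.
under eq_fun do rewrite -normr_id; exact: cvg_norm.
Qed.

(** With b and j the L^p mass and energy of f on the whole space, S (A - b)^th <= 1 - j and S_full
    b^th <= j. Since 1 = S A^th <= S (A - b)^th + S b^th, this leaves S_full b^th <= S b^th, with b
    > 0. *)
Lemma escaping_case : S_full n sigma <= S.
Proof.
have [b [b0 bE] Lc] := LE.
have [j JE' /andP[j0 j1]] := ge0_le_fin (J_ge0 _ _ _ _) Jf.
have [] := @lim_quot R S th (A - b) (1 - j) _ t0 _ Lc.
- by move=> k; rewrite fine_ge0// LL_ge0.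
- move=> e e0; apply: filterS (JE e0) => k; rewrite JE' => h.
  apply: le_trans (S_half_le n0 s0 sn (HE k)) _.
  have h' : (J Om (E k) <= (1 + e - j)%:E)%E.
    by rewrite EFinB EFinD leeBrDr.
  have [r -> /andP[_ ?]] := ge0_le_fin (J_ge0 _ _ _ _) h'.
  by rewrite /=; lra.
move=> Ab h1.
have h2 : S_full n sigma * b `^ th <= j.
  have := @S_full_le R n sigma n0 s0 sn f mf; rewrite JE' bE /=; apply; by rewrite ltry.
have h3 := powR_le_subadd t0 t1 Ab (ltW b0); rewrite subrK in h3.
have h4 : S * A `^ th <= S * ((A - b) `^ th + b `^ th) by rewrite ler_pM2l.
rewrite SA mulrDr in h4.
have h5 : S_full n sigma * b `^ th <= S * b `^ th.
  apply: (le_trans h2); rewrite -(lerD2l (S * (A - b) `^ th)); apply: le_trans h4.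
  by rewrite -lerBrDr.
by rewrite -(ler_pM2r (powR_gt0 th b0)).
Qed.

End escaping.

End profile.

Lemma frequently_subseq (P : nat -> Prop) : (forall K, exists k, (K <= k)%N /\ P k) ->
  exists psi : nat -> nat, {homo psi : i j / (i < j)%N >-> (i < j)%N} /\ forall k, P (psi k).
Proof.
move=> hP; pose nxt K := projT1 (cid (hP K)).
have nxtP K : (K <= nxt K)%N /\ P (nxt K) by exact: projT2 (cid (hP K)).
exists (fun k => iter k (fun j => nxt j.+1) (nxt 0%N)); split; last first.
  by case=> [|k]; [exact: (nxtP 0%N).2|exact: (nxtP _).2].
by apply: homo_ltn => [i j k|i]; [exact: ltn_trans|exact: (nxtP _).1].
Qed.

(** At unit energy the quotient is l^(-t), so its limit determines that of l. The bound M, which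
    Sobolev provides, keeps S away from 0. *)
Lemma minimizing_mass (R : realType) (t S M : R) (l : nat -> R) : 0 < t ->
  (forall k, 0 < l k <= M) -> (fun k => (l k `^ t)^-1) @ \oo --> S ->
  [/\ 0 < S, l @ \oo --> S^-1 `^ t^-1 & S * (S^-1 `^ t^-1) `^ t = 1].
Proof.
move=> t0 hl lS; have S0 : 0 < S.
  have M0 : 0 < M by have /andP[h1 h2] := hl 0%N; exact: lt_le_trans h2.
  apply: (@lt_le_trans _ _ ((M `^ t)^-1)); first by rewrite invr_gt0 powR_gt0.
  rewrite -(cvg_lim (@Rhausdorff R) lS); apply: limr_ge; first exact: cvgP lS.
  apply: nearW => k; have /andP[h1 h2] := hl k.
  rewrite lef_pV2 ?posrE ?powR_gt0//; apply: powR_le_mono => //; exact: ltW.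
split => //; last first.
  by rewrite (powRVK t0) ?invr_ge0 ?ltW// divff// gt_eqF.
have h : (fun k => ((l k `^ t)^-1)^-1) @ \oo --> S^-1 by apply: cvgV => //; rewrite gt_eqF.
have ti : 0 < t^-1 by rewrite invr_gt0.
have := powR_norm_cvg ti h; rewrite [`|S^-1|]ger0_norm ?invr_ge0 ?ltW//.
rewrite (_ : (fun k => _) = l)//; apply/funext => k; have /andP[h1 h2] := hl k.
by rewrite invrK ger0_norm ?powR_ge0// -powRrM divff ?gt_eqF// powRr1// ltW.
Qed.

Lemma preimage_cube (R : realType) n (x e : 'rV[R]_n) (l : R) : 0 < l ->
  aff l (e - l^-1 *: x) @^-1` cube x l = cube e 1.
Proof.
move=> l0; have E (y : 'rV[R]_n) i : aff l (e - l^-1 *: x) y 0 i = l * (y 0 i - e 0 i) + x 0 i.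
  by rewrite /aff !mxE; field; rewrite gt_eqF.
have key (y : 'rV[R]_n) i : x 0 i <= aff l (e - l^-1 *: x) y 0 i < x 0 i + l = (e 0 i <= y 0 i < e 0 i + 1).
  by rewrite E lerDr pmulr_rge0// subr_ge0 [l * _ + _]addrC ltrD2l gtr_pMr// ltrBlDl.
by apply/seteqP; split => y hy i; have := hy i; rewrite /= key.
Qed.

Section compactness.
Variables (R : realType) (n : nat) (sigma : R).
Hypotheses (n0 : (0 < n)%N) (s0 : 0 < sigma) (sn : 2 * sigma < n%:R).
Local Notation mu := (lam R n).
Local Notation p := (crit n sigma).
Local Notation ker := (@ker R n sigma).
Local Notation J := (J mu ker).
Local Notation LL := (@LL R n sigma).
Local Notation Om := (@halfspace R n).
Local Notation H := (@Hhalf R n sigma).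
Local Notation th := ((n%:R - 2 * sigma) / n%:R).
Local Notation S := (S_half n sigma).
Local Notation en := (delta_mx 0 (ilast n0) : 'rV[R]_n).

Let mOm : measurable Om. Proof. exact: measurable_halfspace. Qed.

(** Either some bound on [s k] holds for infinitely many k, and a subsequence falls under the
    bounded case, or [s k] tends to infinity, which contradicts the strict inequality between the
    two constants. *)
Lemma normalized_compactness (w : nat -> 'rV[R]_n -> R) (s : nat -> R) (A M c : R) :
  S < S_full n sigma ->
  (forall k, H (w k)) -> (forall k, J Om (w k) = 1%E) ->
  (forall k, (LL Om (w k) <= M%:E)%E) -> (fun k => fine (LL Om (w k))) @ \oo --> A ->
  0 < S -> S * A `^ th = 1 -> 0 < c -> (forall k, 0 < s k) ->
  (forall k, (c%:E <= Int mu (fun x => \1_(cube (s k *: en) 1) x * w k x ^+ 2)%R)%E) ->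
  exists (phi : nat -> nat) (v : 'rV[R]_n -> R),
  [/\ {homo phi : i j / (i < j)%N >-> (i < j)%N},
     [/\ H v, J Om v = 1%E & fine (LL Om v) = A] &
    (fun k => J Om (fun x => w (phi k) x - v x)) @ \oo --> 0%E].
Proof.
move=> hS Hw Jw LM LA S0 SA c0 sk0 wc.
have mw k : measurable_fun setT (w k) := Hhalf_measurable (Hw k).
have [[S1 hS1]|hs] := pselect (exists S1, forall K, exists k, (K <= k)%N /\ s k <= S1).
  have [psi [hpsi psiS]] := frequently_subseq hS1.
  have M1 : 0 < M + 1.
    by rewrite ltr_wpDl// -lee_fin; apply: le_trans (LM 0%N); exact: LL_ge0.
  have OT (x : 'rV[R]_n) : Om x -> exists2 e, 0 < e & exists N : nat, forall k : nat, (N <= k)%N ->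
      [set y : 'rV[R]_n | forall i, `|y 0 i - x 0 i| < e] `<=` Om.
    rewrite /halfspace /= (xlastE n0) => x0; exists (x 0 (ilast n0)) => //; exists 0%N => k _ y.
    by move=> /(_ (ilast n0)); rewrite /= (xlastE n0) ltr_norml ltrBrDr addNr => /andP[].
  have J1 k : (J Om (w (psi k)) <= 1)%E by rewrite Jw.
  have L1 k : (LL Om (w (psi k)) <= (M + 1)%:E)%E.
    by apply: le_trans (LM _) _; rewrite lee_fin lerDl.
  have [phi [v [hphi mv hv]]] := local_compactness s0 sn (fun k => mw (psi k)) (fun=> mOm) J1 M1 L1 OT.
  have hpp : {homo psi \o phi : i j / (i < j)%N >-> (i < j)%N} by move=> i j ij; exact/hpsi/hphi.
  have LA' := cvg_comp _ _ (subseq_cvgny hpp) LA.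
  have [Hv Jv Lv Jc] := bounded_case s0 sn (fun k => Hw (psi (phi k))) (fun k => Jw _)
    (fun k => LM _) LA' S0 SA c0 (fun k => sk0 _) (fun k => wc _) mv (fun k => psiS (phi k)) hv.
  by exists (psi \o phi), v.
have sinf t : \forall k \near \oo, t <= s k.
  apply: contrapT => nt; apply: hs; exists t => K; apply: contrapT => nk; apply: nt.
  exists K => // k /= Kk; rewrite leNgt; apply/negP => kt; apply: nk; exists k; split => //.
  exact: ltW.
have [phi [f [hphi mf f0 Wf]]] := escaping_compactness n0 s0 sn Hw Jw LM sinf.
have LA' := cvg_comp _ _ (subseq_cvgny hphi) LA.
have sinf' t : \forall k \near \oo, t <= s (phi k).
  exact: (subseq_cvgny hphi (sinf t)).
have := escaping_case s0 sn (fun k => Hw (phi k)) (fun k => Jw _)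
    (fun k => LM _) LA' S0 SA c0 (fun k => sk0 _) (fun k => wc _) mf f0 sinf' Wf.
by rewrite leNgt hS.
Qed.

End compactness.

Lemma two_sigma_lt (R : realType) (n : nat) (sigma : R) : (0 < n)%N ->
  (n = 1%N -> sigma < 1 / 2) -> ((1 < n)%N -> sigma < 1) -> 2 * sigma < n%:R.
Proof.
case: n => // -[_ /(_ erefl) + _|n _ _ /(_ isT) s1]; first by lra.
apply: (@lt_le_trans _ _ 2%:R); last by rewrite ler_nat.
by move: s1; lra.
Qed.

Theorem theorem1p2 (R : realType) (n : nat) (sigma : R)
  (hn : (0 < n)%N) (hs0 : 0 < sigma)
  (hs1 : n = 1%N -> sigma < 1 / 2)
  (hs2 : (1 < n)%N -> sigma < 1 /\ sigma != 1 / 2)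
  (hS : S_half n sigma < S_full n sigma)
  (u : nat -> 'rV[R]_n -> R)
  (hu : forall k, Hhalf sigma (u k) /\ nonzero_on (halfspace n) (u k))
  (hnorm : forall k, Igag sigma (halfspace n) (u k) = 1%E)
  (hmin : (fun k => quot sigma (halfspace n) (u k)) @ \oo --> S_half n sigma) :
  (exists (phi : nat -> nat) (lam : nat -> R) (a : nat -> 'rV[R]_n)
          (v : 'rV[R]_n -> R),
     [/\ {homo phi : i j / (i < j)%N >-> (i < j)%N},
         forall k, 0 < lam k,
         forall k, xlast (a k) = 0,
         Hhalf sigma v &
         (fun k => Igag sigma (halfspace n)
                     (rescale sigma (lam k) (a k) (u (phi k)) \- v)) @ \oo --> 0%E])
  /\
  (exists w : 'rV[R]_n -> R,
     [/\ Hhalf sigma w, nonzero_on (halfspace n) w &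
         quot sigma (halfspace n) w = S_half n sigma]).
Proof.
have sn := two_sigma_lt hn hs1 (fun h => (hs2 h).1).
pose Om := @halfspace R n; pose en := (delta_mx 0 (ilast hn) : 'rV[R]_n).
pose th := (n%:R - 2 * sigma) / n%:R.
have th0 : 0 < th by exact: th_gt0.
have mOm : measurable Om by exact: measurable_halfspace.
have Hu k : Hhalf sigma (u k) := (hu k).1.
have mu' k : measurable_fun setT (u k) := Hhalf_measurable (Hu k).
have Ju k : J (lam R n) (ker sigma) Om (u k) = 1%E by rewrite -(hnorm k) IgagE.
have Lfin k : (LL sigma Om (u k) < +oo)%E by exact: Hhalf_LL.
have L0 k : LL sigma Om (u k) != 0%E.
  by apply/(nonzero_onP hs0 sn mOm (mu' k)); exact: (hu k).2.
pose M := (Csob n sigma * 1) `^ (crit n sigma / 2).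
have LM k : (LL sigma Om (u k) <= M%:E)%E.
  apply: (sobolev_le hs0 sn mOm (@halfspace_cube R n hn) (mu' k)) => //.
  by rewrite Ju.
pose l k := fine (LL sigma Om (u k)).
have lE k : LL sigma Om (u k) = (l k)%:E by rewrite fineK// ge0_fin_numE ?LL_ge0.
have l0M k : 0 < l k <= M.
  by rewrite fine_gt0 ?lt0e ?L0 ?LL_ge0//= -lee_fin -lE.
have lS : (fun k => (l k `^ th)^-1) @ \oo --> S_half n sigma.
  rewrite (_ : (fun k => _) = (fun k => quot sigma (halfspace n) (u k)))//.
  by apply/funext => k; rewrite quotE// Ju div1r.
have [S0 lA SA] := minimizing_mass th0 l0M lS.
set A := (_ `^ th^-1) in lA SA.
have A0 : 0 < A by rewrite powR_gt0// invr_gt0.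
have A2 : 0 < A / 2 by rewrite divr_gt0.
(* Concentration needs a lower bound on the mass, which holds only from some index on; the finitely
   many earlier terms are dropped. *)
have [N _ hN] : \forall k \near \oo, A / 2 <= l k.
  move/cvgrPdist_le : lA => /(_ _ A2); apply: filterS => k.
  by rewrite ler_norml => /andP[_]; rewrite lerBlDl -lerBlDr {1}[A]splitr addrK.
pose U k := u (N + k)%N.
have hc k : exists xl : 'rV[R]_n * R, [/\ Om xl.1, 0 < xl.2 &
    ((conc n sigma (A / 2) * xl.2 `^ (2 * sigma))%:E <
      Int (lam R n) (fun y => \1_(cube xl.1 xl.2) y * U k y ^+ 2)%R)%E].
  have J1 : (J (lam R n) (ker sigma) Om (U k) <= 1)%E by rewrite Ju.
  have L1 : ((A / 2)%:E <= LL sigma Om (U k))%E.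
    by rewrite lE lee_fin; apply: hN; rewrite /= leq_addr.
  have [x [r [Ox r0 hx]]] := concentration hs0 sn mOm (@halfspace_cube R n hn) (mu' _) A2 J1 L1.
  by exists (x, r).
have [xl hxl] := choice hc.
pose r k := (xl k).2; pose x k := (xl k).1.
have r0 k : 0 < r k by have [] := hxl k.
(* The height of the base corner in units of the side of the cube. It equals the last coordinate of
   x_k / r_k, so the translation [a k] below is parallel to the boundary. *)
pose s k := x k 0 (ilast hn) / r k.
have sk0 k : 0 < s k.
  by have [h _ _] := hxl k; rewrite divr_gt0//; move: h; rewrite /Om /halfspace /= (xlastE hn).
pose a k := s k *: en - (r k)^-1 *: x k.
have a0 k : xlast (a k) = 0.
  by rewrite (xlastE hn) /a !mxE !eqxx mulr1 /s mulrC subrr.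
pose w k := rescale sigma (r k) (a k) (U k).
have Hw k : Hhalf sigma (w k) := Hhalf_rescale hn sn (r0 k) (a0 k) (Hu _).
have Jw k : J (lam R n) (ker sigma) Om (w k) = 1%E.
  rewrite -(Ju (N + k)%N) -(J_rescale sigma (a k) (r0 k) mOm (mu' (N + k)%N)).
  by rewrite (rescale_halfspace hn (r0 k) (a0 k)).
have Lw k : LL sigma Om (w k) = LL sigma Om (U k).
  rewrite -(LL_rescale sn (a k) (r0 k) mOm (mu' (N + k)%N)).
  by rewrite (rescale_halfspace hn (r0 k) (a0 k)).
have LwM k : (LL sigma Om (w k) <= M%:E)%E by rewrite Lw; exact: LM.
have LwA : (fun k => fine (LL sigma Om (w k))) @ \oo --> A.
  under eq_fun do rewrite Lw.
  have cN : (fun k => (N + k)%N) @ \oo --> \oo.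
    by apply: subseq_cvgny => i j ij; rewrite ltn_add2l.
  exact: (cvg_comp _ _ cN lA).
have c0 : 0 < conc n sigma (A / 2) by exact: conc_gt0.
have wc k : ((conc n sigma (A / 2))%:E <=
    Int (lam R n) (fun y => \1_(cube (s k *: en) 1) y * w k y ^+ 2)%R)%E.
  have mQ : measurable (cube (x k) (r k)) by exact: measurable_cube.
  have := sqr_rescale sigma (a k) (r0 k) mQ (mu' (N + k)%N).
  rewrite (preimage_cube _ _ (r0 k)) => ->.
  have [_ _ /ltW h] := hxl k.
  apply: (@le_trans _ _ ((r k `^ (- (2 * sigma)))%:E *
    (conc n sigma (A / 2) * r k `^ (2 * sigma))%:E)%E).
    by rewrite -EFinM lee_fin mulrCA -powRD ?(gt_eqF (r0 k)) ?implybT// addNr powRr0 mulr1.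
  by apply: lee_wpmul2l; rewrite ?lee_fin ?powR_ge0.
have [phi [v [hphi [Hv Jv Lv] Jc]]] :=
  normalized_compactness hs0 sn hS Hw Jw LwM LwA S0 SA c0 sk0 wc.
have mv := Hhalf_measurable Hv.
split; [exists (fun k => N + phi k)%N, (r \o phi), (a \o phi), v; split => //=|exists v; split => //].
- by move=> i j ij; rewrite ltn_add2l hphi.
- rewrite (_ : (fun k => Igag _ _ _) = (fun k => J (lam R n) (ker sigma) Om (fun y => w (phi k) y - v y)))//.
  by apply/funext => k; rewrite IgagE//; apply: measurable_funB => //; exact: (Hhalf_measurable (Hw (phi k))).
- apply/(nonzero_onP hs0 sn mOm mv); apply: contraTneq A0 => Lv0.
  by rewrite -Lv Lv0 ltxx.
- rewrite quotE// Jv Lv div1r; apply: (mulIf (lt0r_neq0 (powR_gt0 th A0))).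
  by rewrite mulVf ?SA// gt_eqF// powR_gt0.
Qed.
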